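(* Let $a\in(0,1)$ be irrational and let $\omega_1$ be the lower convex envelope of the sequence $\left(\sin^2\left(\left(n+\frac12\right)\pi a\right)\right)_{n\in\mathbb N}$. Set $\varphi(t)=\dfrac{\omega_1(t)}{t^2}$ for all $t>0$. Then there exists a constant $C=C(a)>0$ such that for any initial data $(u^0,u^1)\in\mathcal D(\mathcal A_2)$, the corresponding solution $u$ of $$u_{tt}-u_{xx}+\delta_a u_t(t,a)=0\ \text{ in }(0,\infty)\times(0,1),\quad u(t,0)=u_x(t,1)=0,\quad u(0,\cdot)=u^0,\ u_t(0,\cdot)=u^1,$$ satisfies $$\forall t\ge0,\quad\|(u(t),u_t(t))\|_{V_2\times L^2(0,1)}\le\frac{C}{\varphi^{-1}\left(\frac1{t+1}\right)}\|(u^0,u^1)\|_{\mathcal D(\mathcal A_2)}.$$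
   Context: Conventions: $\mathbb N=\{1,2,3,\dots\}$; ''decreasing'' is strict; $\delta_a$ is the Dirac mass at $a$. Lower convex envelope: for $(u_n)_{n\in\mathbb N}\subset(0,\infty)$ with $\liminf_{n\to\infty}u_n=0$, let $\mathcal C\subset[1,\infty)\times[0,\infty)$ be the closure of the convex hull of $\{(n,u_n):n\in\mathbb N\}$. The lower convex envelope of $(u_n)$ is the function $\omega_1$ on $[0,\infty)$ given by $\omega_1(t)=\min\{s:(t,s)\in\mathcal C\}$ for $t\ge1$, extended to $[0,1]$ (in an arbitrary fixed way) so that $\omega_1$ is decreasing, continuous and convex on $[0,\infty)$. Then $\varphi:(0,\infty)\to(0,\infty)$ is a decreasing bijection and $\varphi^{-1}$ is its inverse. Wave equation setting (mixed boundary condition): $V_2=\{u\in H^1(0,1):u(0)=0\}$ with norm $\|u\|_{V_2}=\|u_x\|_{L^2(0,1)}$, $X_2=V_2\times L^2(0,1)$, $Y_2=\left\{u\in V_2\cap H^2(0,a)\cap H^2(a,1):\frac{du}{dx}(1)=0\right\}\times V_2$, $$\mathcal D(\mathcal A_2)=\left\{(u,v)\in Y_2:\ \tfrac{du}{dx}(a_+)-\tfrac{du}{dx}(a_-)=v(a)\right\},$$ $$\|(u,v)\|^2_{\mathcal D(\mathcal A_2)}=\|u\|^2_{H^2(0,a)}+\|u\|^2_{H^2(a,1)}+\|v\|^2_{H^1(0,1)}.$$ The operator $\mathcal A_2(u,v)=(v,\,u_{xx}-v(a)\delta_a)$ ($u_{xx}$ in the distributional sense on $(0,1)$) with domain $\mathcal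 D(\mathcal A_2)$ generates a semigroup of contractions on $X_2$, and the solution with data $(u^0,u^1)$ is given by $(u(t),u_t(t))$ being the trajectory of this semigroup starting at $(u^0,u^1)$. *)

(* Defs.v *)
From HB Require Import structures.
From mathcomp Require Import all_boot all_order all_algebra.
From mathcomp Require Import all_classical all_reals all_analysis.

Set Implicit Arguments.
Unset Strict Implicit.
Unset Printing Implicit Defensive.

Import Order.TTheory GRing.Theory Num.Theory.
Import numFieldNormedType.Exports.

Local Open Scope classical_set_scope.
Local Open Scope ring_scope.

Section Envelope.
Variable R : realType.
Implicit Types (u : nat -> R) (w : R -> R).

Definition convex_hull (A : set (R^o * R^o)) : set (R^o * R^o) :=
  smallest (@convex_set R (R^o * R^o)%type) A.

(** The sequence is indexed by the positive integers: [u 0] plays no role. *)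
Definition closed_hull u : set (R^o * R^o) :=
  closure (convex_hull [set (n%:R, u n) | n in [set n : nat | (0 < n)%N]]).

(** The extension to [0, 1] is not unique, whence a predicate;
    the values of [w] on negative arguments are irrelevant. *)
Record lower_convex_envelope u w : Prop := LowerConvexEnvelope {
  envelope_min : forall t, 1 <= t ->
    closed_hull u (t, w t) /\ lbound [set s | closed_hull u (t, s)] (w t) ;
  envelope_decreasing : forall x y, 0 <= x -> x < y -> w y < w x ;
  envelope_continuous : {within `[0, +oo[, continuous w} ;
  envelope_convex : convex_function (`[0, +oo[ : set (convex_lmodType R^o)) w
}.

Definition rate w (t : R) : R := w t / t ^+ 2.

(** Meaningful because [rate w] is a bijection of ]0, +oo[ onto itself. *)
Definition rate_inv w : R -> R := pinv_ (fun=> 0) `]0, +oo[ (rate w).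

End Envelope.

(** The Banach space is given by a set [X] of representatives in [E] with a
    seminorm [nrm]; two representatives [U], [W] denote the same vector iff
    [nrm (U - W) = 0]. *)

Section Semigroup.
Variables (R : realType) (E : lmodType R) (X : set E) (nrm : E -> R).
Implicit Types (S : R -> E -> E) (U W : E).

Record contraction_semigroup S : Prop := ContractionSemigroup {
  semigroup_stable : forall t U, 0 <= t -> X U -> X (S t U) ;
  semigroup_linear : forall t k U W, 0 <= t -> X U -> X W ->
    nrm (S t (k *: U + W) - (k *: S t U + S t W)) = 0 ;
  semigroup_id : forall U, X U -> nrm (S 0 U - U) = 0 ;
  semigroup_add : forall s t U, 0 <= s -> 0 <= t -> X U ->
    nrm (S (s + t) U - S s (S t U)) = 0 ;
  semigroup_contraction : forall t U, 0 <= t -> X U -> nrm (S t U) <= nrm U ;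
  semigroup_continuous : forall U, X U ->
    nrm (S t U - U) @[t --> 0^'+] --> (0 : R)
}.

(** [G U W] reads "[U] belongs to the domain of the generator, which maps it
    to [W]". *)
Definition generated_by (G : E -> E -> Prop) S : Prop :=
  forall U W, X U -> X W ->
    ((nrm (h^-1 *: (S h U - U) - W) @[h --> 0^'+] --> (0 : R)) <-> G U W).

End Semigroup.

(** Classes of real functions modulo a.e. equality on ]c, d[ are represented by
    functions on the whole line, whose values outside ]c, d[ play no role. *)

Section Sobolev.
Variable R : realType.
Let mu := @lebesgue_measure R.
Implicit Types (c d x : R) (u g phi : R -> R).

(** [\_] extends by 0 outside the interval. *)
Definition L2 c d u : Prop := u \_ `]c, d[ \in Lfun mu 2%:E.

Definition normL2 c d u : R := fine 'N[mu]_2%:E[EFin \o (u \_ `]c, d[)].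

(** The closure of the support is bounded, hence compact. *)
Definition test_function c d phi : Prop :=
  (forall n x, derivable (phi^`(n))%classic x 1) /\
  closure [set x | phi x != 0] `<=` `]c, d[.

Definition is_wderiv c d u g : Prop := forall phi, test_function c d phi ->
  \int[mu]_(x in `]c, d[) (u x * (phi^`())%classic x) =
  - \int[mu]_(x in `]c, d[) (g x * phi x).

Definition H1 c d u : Prop :=
  L2 c d u /\ exists2 g, L2 c d g & is_wderiv c d u g.

(** Unique modulo a.e. equality when [u] is in [H1 c d]. *)
Definition wderiv c d u : R -> R :=
  xget (cst 0) [set g | L2 c d g /\ is_wderiv c d u g].

Definition H2 c d u : Prop := H1 c d u /\ H1 c d (wderiv c d u).

(** Value at [x] in [c, d] of the continuous representative of [u]. *)
Definition trace c d u x : R :=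
  xget (cst 0) [set g | {within `[c, d], continuous g} /\
                        {ae mu, forall y, y \in `]c, d[ -> u y = g y}] x.

Definition normH1 c d u : R :=
  Num.sqrt (normL2 c d u ^+ 2 + normL2 c d (wderiv c d u) ^+ 2).

Definition normH2 c d u : R :=
  Num.sqrt (normL2 c d u ^+ 2 + normL2 c d (wderiv c d u) ^+ 2
            + normL2 c d (wderiv c d (wderiv c d u)) ^+ 2).

End Sobolev.

Section Wave.
Variable R : realType.
Let mu := @lebesgue_measure R.

Definition state : lmodType R := ((R -> R^o) * (R -> R^o))%type.

Implicit Types (a : R) (u : R -> R) (U W : state).

Definition V2 u : Prop := H1 0 1 u /\ trace 0 1 u 0 = 0.

Definition normV2 u : R := normL2 0 1 (wderiv 0 1 u).

Definition X2 : set state := [set U | V2 U.1 /\ L2 0 1 U.2].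

Definition normX2 U : R := Num.sqrt (normV2 U.1 ^+ 2 + normL2 0 1 U.2 ^+ 2).

Definition Y2 a : set state := [set U |
  [/\ V2 U.1, H2 0 a U.1, H2 a 1 U.1,
      trace a 1 (wderiv a 1 U.1) 1 = 0 & V2 U.2]].

Definition DA2 a : set state := [set U | Y2 a U /\
  trace a 1 (wderiv a 1 U.1) a - trace 0 a (wderiv 0 a U.1) a
  = trace 0 1 U.2 a].

Definition normDA2 a U : R :=
  Num.sqrt (normH2 0 a U.1 ^+ 2 + normH2 a 1 U.1 ^+ 2 + normH1 0 1 U.2 ^+ 2).

(** Graph of the operator (u, v) |-> (v, u_xx - v(a) delta_a): the second
    component is the element of L^2(0, 1) equal to u_xx - v(a) delta_a as a
    distribution on ]0, 1[. *)
Definition graph_A2 a U W : Prop :=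
  [/\ DA2 a U,
      {ae mu, forall x, x \in `]0, 1[ -> W.1 x = U.2 x},
      L2 0 1 W.2 &
      forall phi : R -> R, test_function 0 1 phi ->
        \int[mu]_(x in `]0, 1[) (U.1 x * (phi^`(2))%classic x)
        - trace 0 1 U.2 a * phi a
        = \int[mu]_(x in `]0, 1[) (W.2 x * phi x)].

End Wave.

(* Main.v *)
Require Import Defs.
From HB Require Import structures.
From mathcomp Require Import all_boot all_order all_algebra.
From mathcomp Require Import all_classical all_reals all_analysis.
From mathcomp Require Import measurable_realfun.
From mathcomp Require Import ring lra.

Set Implicit Arguments.
Unset Strict Implicit.
Unset Printing Implicit Defensive.

Import Order.TTheory GRing.Theory Num.Theory.
Import numFieldNormedType.Exports.

Local Open Scope classical_set_scope.
Local Open Scope ring_scope.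

(** Write [lam n = (n + 1/2) pi], [e_n = sin (lam n * a)] and [f(t) = v(t, a)]
    for a trajectory [(u, v)] of energy [E]; the dissipation law is
    [E' = - 2 f^2].  The adjoint undamped problem has d'Alembert solutions
    built on an arbitrary profile [chi]; pairing the trajectory with them gives
    a quantity whose time derivative is [f] times a combination of four
    translates of [chi].  A profile equal to a trigonometric polynomial in the
    frequencies [lam n] before time 1 and vanishing after time 3 makes the
    pairing vanish after time 4, and initially it recovers the modal
    coefficients with weights [e_n].  As the [lam n] are orthogonal over every
    interval of length 2, this yields
    [sum_{n < M} e_n^2 (al_n^2 + be_n^2) <= 9/4 (E(t) - E(t + 4))].

    The high modes are controlled by the graph norm: a primitive of [w] has
    squared norm at most twice the sum over [n < M] of its squared modal
    coefficients plus [|w|^2 / lam M ^ 2].  Hence, as [e_n^2 >= c0 * omega1 M]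
    for [n < M], the energy at time [t] is at most a multiple of
    [dE / omega1 M + D^2 / M^2], where [dE] is the energy lost over some
    earlier window of length 5 and [D] the norm of the data.  Among the windows
    before [t] one loses at most [O(D^2 / (t + 1))], and the choice
    [M = floor s] with [omega1 s / s^2 = 1 / (t + 1)] balances both terms. *)

(** * Square integrable functions on an interval *)

(** The waves come from the Green function of the undamped string with a source at [a], cleared of
    its denominator. For the profile [exp (i k t)] the velocity is a multiple of
    [sin (k x) cos (k (1 - a))] left of [a] and of [sin (k a) cos (k (1 - x))] right of it, and the
    source has strength [4 cos k]. At [k = lam n] the source disappears and the wave is [e_n] times
    the n-th mode; this is where the weights come from, and no Ingham-type inequality is needed. The
    graph norm enters through an identity at fixed time: strain and velocity of a state in the
    domain are primitives of the velocity and strain of its image under the generator, except for a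
    multiple of [f] that accounts for the jump at [a]. So [f] must be small at the very instant
    considered, and a window of length 5 is a unit interval in which to find such an instant,
    followed by the observation time 4. No regularity of [f] in time is established: the mean value
    theorem replaces integration in time. The sequence defining [omega1] starts at n = 1, so mode 0
    is treated apart; [c0] is its weight. *)

Section SquareIntegrable.
Variable R : realType.
Notation mu := (@lebesgue_measure R).
Implicit Types (c d : R) (f g u v : R -> R).

Definition itg c d f := mu.-integrable `]c, d[ (EFin \o f).

Lemma measurable_oo c d : measurable (`]c, d[ : set (measurableTypeR R)).
Proof. exact: measurable_itv. Qed.
#[local] Hint Resolve measurable_oo : core.

Lemma mu_oo_lty c d : (mu `]c, d[ < +oo)%E.
Proof. by rewrite lebesgue_measure_itv/=; case: ifP => // _; rewrite -EFinB ltry. Qed.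

Lemma mu_oo c d : c <= d -> mu `]c, d[ = (d - c)%:E.
Proof.
move=> cd; rewrite lebesgue_measure_itv/= lte_fin; case: ltgtP cd => //= -> _.
by rewrite subrr.
Qed.

Lemma itg_meas c d f : itg c d f -> measurable_fun `]c, d[ f.
Proof. by move=> /integrableP[/measurable_EFinP]. Qed.

Lemma itgD c d f g : itg c d f -> itg c d g -> itg c d (fun x => f x + g x).
Proof.
move=> hf hg; have := integrableD (measurable_oo c d) hf hg.
by apply: eq_integrable.
Qed.

Lemma itgZ c d k f : itg c d f -> itg c d (fun x => k * f x).
Proof.
move=> hf; have := integrableZl (measurable_oo c d) k hf.
by apply: eq_integrable.
Qed.

Lemma itgN c d f : itg c d f -> itg c d (fun x => - f x).
Proof. by move=> /(itgZ (-1)); apply: eq_integrable => // x _ /=; rewrite mulN1r. Qed.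

Lemma itgB c d f g : itg c d f -> itg c d g -> itg c d (fun x => f x - g x).
Proof. by move=> hf hg; apply: itgD => //; exact: itgN. Qed.

Lemma itg_dom c d f g : measurable_fun `]c, d[ f -> itg c d g ->
  (forall x, c < x < d -> `|f x| <= `|g x|) -> itg c d f.
Proof.
move=> mf ig fg; apply: (le_integrable _ _ _ ig) => //; exact/measurable_EFinP.
Qed.

Lemma itg_bounded c d f (M : R) : measurable_fun `]c, d[ f ->
  (forall x, c < x < d -> `|f x| <= M) -> itg c d f.
Proof.
move=> mf fM; apply: (itg_dom (g := cst M)) => //.
  apply: measurable_bounded_integrable => //; first exact: mu_oo_lty.
  by exists `|M|; split => // x Mx y _ /=; exact: ltW.
by move=> x xcd; rewrite (le_trans (fM x xcd))// ler_norm.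
Qed.

Lemma itg_sub c d c' d' f : c <= c' -> d' <= d -> itg c d f -> itg c' d' f.
Proof.
move=> cc dd; apply: integrableS => //.
by apply: subset_itvW.
Qed.

Lemma itg_cst c d k : itg c d (cst k).
Proof. exact: (@itg_bounded _ _ _ `|k|). Qed.

Lemma itg_sum c d (I : Type) (s : seq I) (P : pred I) (F : I -> R -> R) :
  (forall i, itg c d (F i)) -> itg c d (fun x => \sum_(i <- s | P i) F i x).
Proof.
move=> iF; elim: s => [|i s IH].
  under eq_fun do rewrite big_nil; exact: itg_cst.
under eq_fun do rewrite big_cons; case: (P i) => //; exact: itgD.
Qed.

Lemma int_sum c d (I : Type) (s : seq I) (P : pred I) (F : I -> R -> R) :
  (forall i, itg c d (F i)) ->
  \int[mu]_(x in `]c, d[) (\sum_(i <- s | P i) F i x) =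
  \sum_(i <- s | P i) \int[mu]_(x in `]c, d[) F i x.
Proof.
move=> iF; elim: s => [|i s IH].
  by under eq_Rintegral do rewrite big_nil; rewrite Rintegral_cst// mul0r big_nil.
under eq_Rintegral do rewrite big_cons; rewrite big_cons; case: (P i) => //.
by rewrite RintegralD// ?IH//; [exact: iF|exact: itg_sum].
Qed.

Lemma aeS (P Q : R -> Prop) : (forall x, P x -> Q x) ->
  {ae mu, forall x, P x} -> {ae mu, forall x, Q x}.
Proof. by move=> PQ; apply: (@filterS _ _ (ae_filter_ringOfSetsType mu)). Qed.

Lemma aeI (P Q : R -> Prop) : {ae mu, forall x, P x} -> {ae mu, forall x, Q x} ->
  {ae mu, forall x, P x /\ Q x}.
Proof. exact: (@filterI _ _ (ae_filter_ringOfSetsType mu)). Qed.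

Lemma intD c d f g : itg c d f -> itg c d g ->
  \int[mu]_(x in `]c, d[) (f x + g x) =
  \int[mu]_(x in `]c, d[) f x + \int[mu]_(x in `]c, d[) g x.
Proof. exact: RintegralD. Qed.

Lemma intB c d f g : itg c d f -> itg c d g ->
  \int[mu]_(x in `]c, d[) (f x - g x) =
  \int[mu]_(x in `]c, d[) f x - \int[mu]_(x in `]c, d[) g x.
Proof. exact: RintegralB. Qed.

Lemma intZ c d k f : itg c d f ->
  \int[mu]_(x in `]c, d[) (k * f x) = k * \int[mu]_(x in `]c, d[) f x.
Proof. exact: RintegralZl. Qed.

Lemma int_cst c d k : c <= d -> \int[mu]_(x in `]c, d[) k = k * (d - c).
Proof.
move=> cd; rewrite Rintegral_cst//; congr (_ * _).
transitivity (fine (d - c)%:E) => //; congr fine.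
exact: mu_oo.
Qed.

Lemma le_int c d f g : itg c d f -> itg c d g ->
  (forall x, c < x < d -> f x <= g x) ->
  \int[mu]_(x in `]c, d[) f x <= \int[mu]_(x in `]c, d[) g x.
Proof. by move=> hf hg fg; apply: le_Rintegral. Qed.

Lemma ae_int c d f g : itg c d f -> measurable_fun `]c, d[ g ->
  {ae mu, forall x, x \in `]c, d[ -> f x = g x} ->
  \int[mu]_(x in `]c, d[) f x = \int[mu]_(x in `]c, d[) g x.
Proof.
move=> /itg_meas mf mg fg; congr fine; apply: ae_eq_integral => //.
- exact/measurable_EFinP.
- exact/measurable_EFinP.
- by apply: aeS fg => x + xcd => /(_ xcd) ->.
Qed.

Lemma int_oc c d f : itg c d f ->
  \int[mu]_(x in `]c, d]) f x = \int[mu]_(x in `]c, d[) f x.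
Proof. by move=> hf; rewrite Rintegral_itv_bndo_bndc. Qed.

(** Trades the extended-valued norm for integrability of the square, so that closure properties of
    [L2] become statements about integrable functions. *)
Lemma L2P c d u : L2 c d u <->
  measurable_fun `]c, d[ u /\ itg c d (fun x => u x ^+ 2).
Proof.
have E : (fun x => ((u \_ `]c, d[) x ^+ 2)%:E) =
    ((EFin \o (fun x => u x ^+ 2)) \_ `]c, d[ : R -> \bar R).
  apply/funext => x; rewrite !patchE; case: ifP => //= _.
  by rewrite expr0n.
have memE : L2 c d u <-> measurable_fun setT (u \_ `]c, d[) /\
    ('N[mu]_2%:E[EFin \o (u \_ `]c, d[)] < +oo)%E.
  rewrite /L2; split.
    by move=> /andP[]; rewrite !inE/=.
  by move=> [h1 h2]; apply/andP; rewrite !inE/=.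
split.
  move=> h; split.
    by move/memE : h => [h _]; apply/measurable_restrictT.
  have := Lfun2_integrable_sqr h; rewrite /comp /= E => h'.
  by apply/(integrable_mkcond _ (measurable_oo c d)).
move=> [mu_ i2]; apply/memE; split.
  exact: (proj1 (measurable_restrictT u (measurable_oo c d))).
rewrite unlock poweR_lty//=.
move/(integrable_mkcond _ (measurable_oo c d)): i2; rewrite -E => /integrableP[_].
apply: le_lt_trans; rewrite le_eqVlt; apply/orP; left; apply/eqP.
by apply: eq_integral => x _ /=; rewrite powR_mulrn// normrX.
Qed.

Lemma normL2_sq c d u : L2 c d u ->
  normL2 c d u ^+ 2 = \int[mu]_(x in `]c, d[) (u x ^+ 2).
Proof.
move=> hu.
have fin : ('N[mu]_2%:E[EFin \o (u \_ `]c, d[)] < +oo)%E.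
  by move: hu; rewrite /L2 => /andP[_]; rewrite inE.
rewrite -powR_mulrn ?fine_ge0 ?Lnorm_ge0//.
have : ('N[mu]_2%:E[EFin \o (u \_ `]c, d[)] `^ 2 = 
  \int[mu]_(x in `]c, d[) (u x ^+ 2)%:E)%E.
  rewrite powR_Lnorm// [RHS]integral_mkcond.
  apply: eq_integral => x _ /=; rewrite !patchE; case: ifP => _ /=.
    by rewrite powR_mulrn// real_normK// num_real.
  by rewrite normr0 powR0.
rewrite /Rintegral => <-.
have : ('N[mu]_2%:E[EFin \o (u \_ `]c, d[)] \is a fin_num)%E.
  by rewrite ge0_fin_numE// Lnorm_ge0.
by rewrite /normL2; case: ('N[mu]_2%:E[_])%E.
Qed.

Lemma L2_meas c d u : L2 c d u -> measurable_fun `]c, d[ u.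
Proof. by move=> /L2P[]. Qed.

Lemma L2_sq c d u : L2 c d u -> itg c d (fun x => u x ^+ 2).
Proof. by move=> /L2P[]. Qed.

Lemma L2_mul c d u v : L2 c d u -> L2 c d v -> itg c d (fun x => u x * v x).
Proof.
move=> /L2P[mu_ u2] /L2P[mv v2].
apply: (@itg_dom c d _ (fun x => u x ^+ 2 + v x ^+ 2)).
- exact: measurable_funM.
- exact: itgD.
- move=> x _; rewrite [leRHS]ger0_norm ?addr_ge0 ?sqr_ge0//.
  by rewrite ler_norml; apply/andP; split; nra.
Qed.

Lemma L2_bounded c d u (M : R) : measurable_fun `]c, d[ u ->
  (forall x, c < x < d -> `|u x| <= M) -> L2 c d u.
Proof.
move=> mu_ uM; apply/L2P; split => //.
apply: (@itg_bounded _ _ _ (M ^+ 2)); first exact: measurable_funX.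
move=> x /uM uxM; rewrite normrX; apply: lerXn2r => //; rewrite nnegrE //.
exact: le_trans uxM.
Qed.

Lemma L2_cst c d k : L2 c d (cst k).
Proof. exact: (@L2_bounded _ _ _ `|k|). Qed.

Lemma L2_itg c d u : L2 c d u -> itg c d u.
Proof.
move=> hu; have := L2_mul hu (L2_cst c d 1).
by apply: eq_integrable => // x _ /=; rewrite mulr1.
Qed.

Lemma L2_bmul c d u v (M : R) : measurable_fun `]c, d[ v ->
  (forall x, c < x < d -> `|v x| <= M) -> L2 c d u -> L2 c d (fun x => v x * u x).
Proof.
move=> mv vM /L2P[mu_ u2]; apply/L2P; split; first exact: measurable_funM.
apply: (@itg_dom c d _ (fun x => M ^+ 2 * u x ^+ 2)).
- by apply: measurable_funX; exact: measurable_funM.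
- exact: itgZ.
- move=> x /vM h; rewrite exprMn !normrM ler_wpM2r//.
  by apply: ler_pM => //; rewrite (le_trans h)// ler_norm.
Qed.

Lemma L2Z c d k u : L2 c d u -> L2 c d (fun x => k * u x).
Proof. exact: (@L2_bmul _ _ _ (cst k) `|k|). Qed.

Lemma L2D c d u v : L2 c d u -> L2 c d v -> L2 c d (fun x => u x + v x).
Proof.
move=> hu hv; apply/L2P; split.
  by apply: measurable_funD; exact: L2_meas.
have := itgD (itgD (L2_sq hu) (itgZ 2 (L2_mul hu hv))) (L2_sq hv).
by apply: eq_integrable => // x _ /=; congr EFin; ring.
Qed.

Lemma L2N c d u : L2 c d u -> L2 c d (fun x => - u x).
Proof.
move=> /(L2Z (-1)); rewrite (_ : (fun x => -1 * u x) = (fun x => - u x))//.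
by apply/funext => x; rewrite mulN1r.
Qed.

Lemma L2B c d u v : L2 c d u -> L2 c d v -> L2 c d (fun x => u x - v x).
Proof. by move=> hu hv; apply: L2D => //; exact: L2N. Qed.

Lemma L2_sum c d (I : Type) (s : seq I) (P : pred I) (F : I -> R -> R) :
  (forall i, L2 c d (F i)) -> L2 c d (fun x => \sum_(i <- s | P i) F i x).
Proof.
move=> iF; elim: s => [|i s IH].
  under eq_fun do rewrite big_nil; exact: L2_cst.
under eq_fun do rewrite big_cons; case: (P i) => //; exact: L2D.
Qed.

Lemma L2_sub c d c' d' u : c <= c' -> d' <= d -> L2 c d u -> L2 c' d' u.
Proof.
move=> cc dd /L2P[mu_ u2]; apply/L2P; split; last exact: itg_sub u2.
by apply: measurable_funS mu_ => //; exact: subset_itvW.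
Qed.

Definition ip c d u v := \int[mu]_(x in `]c, d[) (u x * v x).

Lemma ipC c d u v : ip c d u v = ip c d v u.
Proof. by apply: eq_Rintegral => x _; rewrite mulrC. Qed.

Lemma ipDl c d u1 u2 v : L2 c d u1 -> L2 c d u2 -> L2 c d v ->
  ip c d (fun x => u1 x + u2 x) v = ip c d u1 v + ip c d u2 v.
Proof.
move=> h1 h2 hv; rewrite /ip -RintegralD//; try exact: L2_mul.
by apply: eq_Rintegral => x _; rewrite mulrDl.
Qed.

Lemma ipZl c d k u v : L2 c d u -> L2 c d v ->
  ip c d (fun x => k * u x) v = k * ip c d u v.
Proof.
move=> h1 hv; rewrite /ip -RintegralZl//; last exact: L2_mul.
by apply: eq_Rintegral => x _; rewrite mulrA.
Qed.

Lemma ip_ge0 c d u : 0 <= ip c d u u.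
Proof. by apply: Rintegral_ge0 => x _; rewrite -expr2 sqr_ge0. Qed.

Lemma ip_ae c d u u' v v' : L2 c d u -> L2 c d v ->
  measurable_fun `]c, d[ u' -> measurable_fun `]c, d[ v' ->
  {ae mu, forall x, x \in `]c, d[ -> u x = u' x} ->
  {ae mu, forall x, x \in `]c, d[ -> v x = v' x} -> ip c d u v = ip c d u' v'.
Proof.
move=> hu hv mu' mv' uu vv; apply: ae_int; first exact: L2_mul.
  exact: measurable_funM.
by apply: aeS (aeI uu vv) => x [h1 h2] xcd; rewrite h1// h2.
Qed.

Lemma normL2_ip c d u : L2 c d u -> normL2 c d u ^+ 2 = ip c d u u.
Proof. by move/normL2_sq ->. Qed.

Lemma psd_CS (A B C : R) : 0 <= A -> 0 <= C ->
  (forall k l, 0 <= k ^+ 2 * A + 2 * k * l * B + l ^+ 2 * C) -> B ^+ 2 <= A * C.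
Proof.
move=> A0 C0 key.
have [C1|C1] := eqVneq C 0.
  have [->|B0] := eqVneq B 0; first by rewrite expr0n/= mulr_ge0.
  (* With [C = 0] the form is affine in [l]; this value of [l] makes it equal to -1. *)
  have := key 1 (- (A + 1) / (2 * B)).
  rewrite C1 !mulr0 addr0.
  have -> : 2 * 1 * (- (A + 1) / (2 * B)) * B = - (A + 1) by field.
  by move=> h; exfalso; lra.
(* The minimiser up to scaling: the form takes the value [C * (A * C - B ^+ 2)] there. *)
have := key C (- B) => h.
have C2 : 0 < C by rewrite lt_def C1.
by rewrite -(ler_pM2l C2); nra.
Qed.

Lemma ip_CS c d u v : L2 c d u -> L2 c d v ->
  ip c d u v ^+ 2 <= ip c d u u * ip c d v v.
Proof.
move=> hu hv.
apply: psd_CS => [||k l]; try exact: ip_ge0.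
have := ip_ge0 c d (fun x => k * u x + l * v x).
have huk := L2Z k hu; have hvl := L2Z l hv; have hs := L2D huk hvl.
rewrite ipDl// !ipZl// ![ip _ _ _ (fun x => k * u x + l * v x)]ipC.
by rewrite !ipDl// !ipZl// (ipC _ _ v u) => h; nra.
Qed.

End SquareIntegrable.

(** * Iterated integrals, primitives and the fundamental theorem of calculus *)

Section IteratedIntegral.
Variable R : realType.
Notation mu := (@lebesgue_measure R).
Implicit Types (c d x y : R) (f g u v : R -> R).

#[local] Hint Resolve measurable_oo : core.

Lemma int_split c d x f : c <= x -> x <= d -> itg c d f ->
  \int[mu]_(y in `]c, d[) f y =
  \int[mu]_(y in `]c, x[) f y + \int[mu]_(y in `]x, d[) f y.
Proof.
rewrite le_eqVlt => /predU1P[<-|cx].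
  by rewrite [X in _ = X + _](_ : _ = 0) ?add0r// set_itv_ge ?bnd_simp ?ltxx// Rintegral_set0.
rewrite le_eqVlt => /predU1P[->|xd hf].
  by rewrite [X in _ = _ + X](_ : _ = 0) ?addr0// set_itv_ge ?bnd_simp ?ltxx// Rintegral_set0.
have hcx : itg c x f by apply: itg_sub hf => //; exact: ltW.
rewrite -(int_oc hcx) -(@Rintegral_itvB _ f (BRight c) (BLeft d) x)// ?bnd_simp//.
  by rewrite addrC subrK.
exact: ltW.
Qed.

Lemma int_itv0 c d f : d <= c -> \int[mu]_(y in `]c, d[) f y = 0.
Proof. by move=> dc; rewrite set_itv_ge ?Rintegral_set0// bnd_simp -leNgt. Qed.

Lemma fin_int c d f : itg c d f ->
  (\int[mu]_(y in `]c, d[) (f y)%:E)%E = (\int[mu]_(y in `]c, d[) f y)%:E.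
Proof. by move=> hf; rewrite fineK//; exact: integrable_fin_num. Qed.

Lemma patch_oo c d h x : (h \_ `]c, d[) x = if c < x < d then h x else 0 :> R.
Proof. by rewrite patchE; congr (if _ then _ else _); rewrite mem_setE in_itv. Qed.

(** The integrand over the triangle [c < y < x < d], with [p = (x, y)], extended by 0 to the plane
    so that Fubini applies on the full product. *)
Definition triangle_kernel c d f g (p : measurableTypeR R * measurableTypeR R) : R :=
  if p.2 < p.1 then (g \_ `]c, d[) p.1 * (f \_ `]c, d[) p.2 else 0.

Lemma triangle_kernel_fst c d f g x : itg c d f ->
  (\int[mu]_y (triangle_kernel c d f g (x, y))%:E)%E =
  (((fun x => (\int[mu]_(y in `]c, x[) f y) * g x) \_ `]c, d[) x)%:E.
Proof.
move=> hf; rewrite patch_oo; case: ifPn => [/andP[cx xd]|xD]; last first.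
  rewrite integral0_eq // => y _.
  by rewrite /triangle_kernel/= [in (g \_ _) _]patch_oo (negbTE xD) mul0r if_same.
have hcx : itg c x f := itg_sub (lexx c) (ltW xd) hf.
rewrite EFinM -(fin_int hcx) -(integralZr (measurable_oo c x) hcx).
rewrite [RHS]integral_mkcond; apply: eq_integral => y _.
rewrite /triangle_kernel !patch_oo /= cx xd/= patchE mem_setE in_itv/=.
case: (ltP c y) => cy /=; last by rewrite mulr0 if_same.
case: (ltP y x) => // yx.
by rewrite (lt_trans yx xd) mulrC EFinM.
Qed.

Lemma triangle_kernel_snd c d f g y : itg c d g ->
  (\int[mu]_x (triangle_kernel c d f g (x, y))%:E)%E =
  (((fun y => f y * (\int[mu]_(x in `]y, d[) g x)) \_ `]c, d[) y)%:E.
Proof.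
move=> hg; rewrite patch_oo; case: ifPn => [/andP[cy yd]|yD]; last first.
  rewrite integral0_eq // => x _.
  by rewrite /triangle_kernel/= [in (f \_ _) _]patch_oo (negbTE yD) mulr0 if_same.
have hyd : itg y d g := itg_sub (ltW cy) (lexx d) hg.
rewrite EFinM -(fin_int hyd) -(integralZl (measurable_oo y d) hyd).
rewrite [RHS]integral_mkcond; apply: eq_integral => x _.
rewrite /triangle_kernel !patch_oo /= cy yd/= patchE mem_setE in_itv/=.
case: (ltP y x) => yx //=.
rewrite (lt_trans cy yx)/=.
case: (ltP x d) => // xd; last by rewrite mul0r.
by rewrite mulrC EFinM.
Qed.

Lemma measurable_triangle_kernel c d f g : itg c d f -> itg c d g ->
  measurable_fun setT (triangle_kernel c d f g).
Proof.
move=> hf hg; apply: measurable_fun_ifT => //.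
- exact: measurable_fun_ltr measurable_snd measurable_fst.
- apply: measurable_funM.
  + apply: (measurableT_comp _ measurable_fst).
    by apply/(measurable_restrictT g (measurable_oo c d)); exact: itg_meas.
  + apply: (measurableT_comp _ measurable_snd).
    by apply/(measurable_restrictT f (measurable_oo c d)); exact: itg_meas.
Qed.

Lemma integrable_triangle_kernel c d f g : itg c d f -> itg c d g ->
  (mu \x mu)%E.-integrable setT (EFin \o triangle_kernel c d f g).
Proof.
move=> hf hg.
have mK : measurable_fun setT (EFin \o triangle_kernel c d f g).
  by apply/measurable_EFinP; exact: measurable_triangle_kernel.
have ifT : mu.-integrable setT (EFin \o (f \_ `]c, d[)).
  by rewrite -restrict_EFin; apply/(integrable_mkcond _ (measurable_oo c d)).
have igT : mu.-integrable setT (EFin \o (g \_ `]c, d[)).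
  by rewrite -restrict_EFin; apply/(integrable_mkcond _ (measurable_oo c d)).
have mf : measurable_fun setT (f \_ `]c, d[).
  by move/integrableP : ifT => [/measurable_EFinP].
have mg : measurable_fun setT (g \_ `]c, d[).
  by move/integrableP : igT => [/measurable_EFinP].
apply/integrable12ltyP => //.
have Ly : (\int[mu]_y `|(f \_ `]c, d[) y|%:E < +oo)%E by move/integrableP : ifT => [].
(* Dropping the constraint [y < x] leaves a product, whose iterated integral is the product of two
   finite ones. *)
apply: (@le_lt_trans _ _ (\int[mu]_x (`|(g \_ `]c, d[) x|%:E * \int[mu]_y `|(f \_ `]c, d[) y|%:E))%E).
  apply: ge0_le_integral => //.
  - by move=> x _; exact: integral_ge0.
  - apply: (measurable_fun_fubini_tonelli_F (abse \o (EFin \o triangle_kernel c d f g))) => //=.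
    exact: measurableT_comp.
  - apply: emeasurable_funM => //.
    by apply/measurable_EFinP; exact: measurableT_comp.
  - move=> x _ /=.
    rewrite -ge0_integralZl//; last first.
      by apply/measurable_EFinP; exact: measurableT_comp.
    apply: ge0_le_integral => //.
    + apply/measurable_EFinP; apply: measurableT_comp => //.
      apply/measurable_EFinP.
      exact: (measurableT_comp mK).
    + by apply: emeasurable_funM => //; apply/measurable_EFinP; exact: measurableT_comp.
    + move=> y _; rewrite /triangle_kernel/= -EFinM lee_fin -normrM.
      by case: ifP => // _; rewrite normr0.
rewrite ge0_integralZr//; first last.
- exact: integral_ge0.
- by apply/measurable_EFinP; exact: measurableT_comp.
apply: lte_mul_pinfty => //; first exact: integral_ge0.
by rewrite ge0_fin_numE ?integral_ge0//; move/integrableP : igT => [].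
Qed.

(** Integration by parts without boundary terms: the primitive from [c] and the primitive towards
    [d] are adjoint to each other. Pairings with modes, test functions and waves all reduce to
    it. *)
Lemma iterated_integral c d f g : itg c d f -> itg c d g ->
  \int[mu]_(x in `]c, d[) ((\int[mu]_(y in `]c, x[) f y) * g x) =
  \int[mu]_(y in `]c, d[) (f y * \int[mu]_(x in `]y, d[) g x).
Proof.
move=> hf hg; have := Fubini (integrable_triangle_kernel hf hg).
under eq_integral do rewrite /comp (triangle_kernel_fst _ _ hf).
under [in X in _ = X -> _]eq_integral do rewrite /comp (triangle_kernel_snd _ _ hg).
by move=> FF; rewrite Rintegral_mkcond [RHS]Rintegral_mkcond /Rintegral FF.
Qed.

Lemma int_norm_le c d f : itg c d f ->
  `|\int[mu]_(x in `]c, d[) f x| <= \int[mu]_(x in `]c, d[) `|f x|.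
Proof. exact: le_normr_Rintegral. Qed.

Lemma itg_norm c d f : itg c d f -> itg c d (fun x => `|f x|).
Proof. exact: integrable_norm. Qed.

Lemma prim_continuous c d f : c < d -> itg c d f ->
  {within `[c, d], continuous (fun x => \int[mu]_(y in `]c, x[) f y)}.
Proof.
move=> cd hf.
have hf' : mu.-integrable `[c, d] (EFin \o f).
  have E1 : mu.-integrable `]c, d] (EFin \o f).
    move/integrableP : (hf) => [m1 i1]; apply/integrableP; split.
      exact/emeasurable_fun_itv_bndo_bndcP.
    rewrite -integral_itv_bndo_bndc//; exact: measurableT_comp.
  move/integrableP : (E1) => [m1 i1]; apply/integrableP; split.
    exact/emeasurable_fun_itv_obnd_cbndP.
  rewrite -integral_itv_obnd_cbnd//; exact: measurableT_comp.
have := parameterized_integral_continuous (ltW cd) hf'.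
apply: subspace_eq_continuous => x; rewrite inE/= in_itv/= => /andP[cx xd].
rewrite /from_subspace /=.
have h1 : mu.-integrable `]c, x] (EFin \o f).
  apply: integrableS hf' => //; apply: subset_itv; rewrite bnd_simp//.
have h2 : itg c x f by apply: itg_sub hf.
by rewrite /parameterized_integral -Rintegral_itv_obnd_cbnd// int_oc.
Qed.

Lemma prim_bounded c d f x : c <= x -> x <= d -> itg c d f ->
  `|\int[mu]_(y in `]c, x[) f y| <= \int[mu]_(y in `]c, d[) `|f y|.
Proof.
move=> cx xd hf; rewrite (le_trans (int_norm_le (itg_sub _ xd hf)))//.
by rewrite (int_split cx xd (itg_norm hf)) lerDl Rintegral_ge0.
Qed.

Lemma int_FTC a b F f : a <= b -> (forall x, is_derive x 1 F (f x)) -> continuous f ->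
  \int[mu]_(x in `]a, b[) f x = F b - F a.
Proof.
rewrite le_eqVlt => /predU1P[->|ab] dF cf; first by rewrite int_itv0// subrr.
have itf : mu.-integrable `[a, b] (EFin \o f).
  by apply: continuous_compact_integrable; [exact: segment_compact|exact: continuous_subspaceT].
rewrite Rintegral_itv_obnd_cbnd; last first.
  by apply: integrableS itf => //; exact: subset_itv_oo_cc.
rewrite Rintegral_itv_bndo_bndc; last first.
  by apply: integrableS itf => //; exact: subset_itv_co_cc.
have F_C x : {for x, continuous F}.
  apply: differentiable_continuous; apply/derivable1_diffP.
  by have [] := dF x.
rewrite /Rintegral (@continuous_FTC2 _ f F)//.
- exact: continuous_subspaceT.
- split => //.
  + by apply: cvg_at_right_filter; exact: F_C.
  + by apply: cvg_at_left_filter; exact: F_C.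
- by move=> x _; rewrite derive1E; have [_ ->] := dF x.
Qed.

Lemma meas_cont (D : set (measurableTypeR R)) f : measurable D -> continuous f -> measurable_fun D f.
Proof. by move=> mD cf; apply: measurable_funTS; exact: continuous_measurable_fun. Qed.

Lemma cont_bounded c d f : continuous f -> exists M : R, forall x, c < x < d -> `|f x| <= M.
Proof.
move=> cf; have [dc|cd] := leP d c.
  by exists 0 => x /andP[cx xd]; have := lt_trans cx xd; rewrite ltNge dc.
have cf' : {within `[c, d], continuous f} by exact: continuous_subspaceT.
have [M [Mr HM]] := compact_bounded (continuous_compact cf' (@segment_compact _ c d)).
exists (`|M| + 1) => x /andP[cx xd]; apply: HM.
  by rewrite (le_lt_trans (ler_norm M))// ltrDl.
by exists x => //=; rewrite in_itv/= !ltW.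
Qed.

Lemma L2_cont c d f : continuous f -> L2 c d f.
Proof.
move=> cf; have [M fM] := cont_bounded c d cf.
by apply: L2_bounded fM; exact: meas_cont.
Qed.

End IteratedIntegral.

(** * Trigonometric systems and the tail of a primitive *)

Section Trigonometric.
Variable R : realType.
Notation mu := (@lebesgue_measure R).
Implicit Types (c d x y : R) (f g u v : R -> R).

Lemma is_derive_sinM (k x : R) : is_derive x 1 (fun x => sin (k * x)) (k * cos (k * x)).
Proof.
have H : is_derive x 1 (fun x : R => k * x) k.
  by apply: is_derive_eq; rewrite scaler1.
have := @is_derive1_comp _ sin (fun x => k * x) x _ _ (is_derive_sin _) H.
by move=> h; apply: is_derive_eq; rewrite mulrC.
Qed.

Lemma is_derive_cosM (k x : R) : is_derive x 1 (fun x => cos (k * x)) (- (k * sin (k * x))).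
Proof.
have H : is_derive x 1 (fun x : R => k * x) k.
  by apply: is_derive_eq; rewrite scaler1.
have := @is_derive1_comp _ cos (fun x => k * x) x _ _ (is_derive_cos _) H.
by move=> h; apply: is_derive_eq; rewrite mulrC mulrN.
Qed.

Lemma continuous_cosM (k : R) : continuous (fun x : R => cos (k * x)).
Proof.
move=> x; apply: differentiable_continuous; apply/derivable1_diffP.
by have [] := is_derive_cosM k x.
Qed.

Lemma continuous_sinM (k : R) : continuous (fun x : R => sin (k * x)).
Proof.
move=> x; apply: differentiable_continuous; apply/derivable1_diffP.
by have [] := is_derive_sinM k x.
Qed.

Lemma int_cosM (k c d : R) : k != 0 -> c <= d ->
  \int[mu]_(x in `]c, d[) cos (k * x) = (sin (k * d) - sin (k * c)) / k.
Proof.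
move=> k0 cd.
have dF x : is_derive x 1 (fun x => k^-1 * sin (k * x)) (cos (k * x)).
  have h := is_derive_sinM k x.
  by apply: is_derive_eq; rewrite /GRing.scale/= mulrA mulVf// mul1r.
by rewrite (int_FTC cd dF (@continuous_cosM k)); field.
Qed.

Lemma int_sinM (k c d : R) : k != 0 -> c <= d ->
  \int[mu]_(x in `]c, d[) sin (k * x) = (cos (k * c) - cos (k * d)) / k.
Proof.
move=> k0 cd.
have dF x : is_derive x 1 (fun x => - k^-1 * cos (k * x)) (sin (k * x)).
  have h := is_derive_cosM k x.
  by apply: is_derive_eq; rewrite /GRing.scale/= mulrN mulNr opprK mulrA mulVf// mul1r.
by rewrite (int_FTC cd dF (@continuous_sinM k)); field.
Qed.

(** Eigenfrequencies of the undamped problem: [sin (lam n * x)] vanishes at 0 and has zero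
    derivative at 1. *)
Definition lam (n : nat) : R := (n%:R + 2^-1) * pi.

Lemma lamE n : lam n = (n%:R + 2^-1) * pi. Proof. by []. Qed.

Lemma lam_gt0 n : 0 < lam n.
Proof. by rewrite mulr_gt0 ?pi_gt0// ltr_wpDl. Qed.

Lemma lam_neq0 n : lam n != 0. Proof. by rewrite gt_eqF ?lam_gt0. Qed.

Lemma sin_npi n : sin (n%:R * pi) = 0 :> R.
Proof.
elim: n => [|n IH]; first by rewrite mul0r sin0.
by rewrite -natr1 mulrDl mul1r sinDpi IH oppr0.
Qed.

Lemma cos_npi n : cos (n%:R * pi) = (-1) ^+ n :> R.
Proof.
elim: n => [|n IH]; first by rewrite mul0r cos0 expr0.
by rewrite -natr1 mulrDl mul1r cosDpi IH exprS mulN1r.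
Qed.

Lemma cos_lam n : cos (lam n) = 0.
Proof.
rewrite /lam mulrDl cosD sin_npi mul0r subr0 (mulrC 2^-1).
by rewrite cos_pihalf mulr0.
Qed.

Lemma sin_lam n : sin (lam n) = (-1) ^+ n.
Proof.
rewrite /lam mulrDl sinD sin_npi mul0r add0r (mulrC 2^-1).
by rewrite sin_pihalf mulr1 cos_npi.
Qed.

Lemma lamB_neq0 n m : n != m -> lam n - lam m != 0.
Proof.
move=> nm; rewrite /lam -mulrBl mulf_neq0//; last by rewrite gt_eqF ?pi_gt0.
by rewrite opprD addrACA subrr addr0 subr_eq0 eqr_nat.
Qed.

Lemma sin_lamB n m : sin (lam n - lam m) = 0.
Proof. by rewrite sinB !cos_lam mulr0 mul0r subr0. Qed.

Lemma sin_lamD n m : sin (lam n + lam m) = 0.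
Proof. by rewrite sinD !cos_lam mulr0 mul0r addr0. Qed.

Lemma itg_cont c d f : continuous f -> itg c d f.
Proof. by move=> cf; apply: L2_itg; exact: L2_cont. Qed.

Lemma L2_cosM (k c d : R) : L2 c d (fun x => cos (k * x)).
Proof. by apply: L2_cont; exact: continuous_cosM. Qed.

Lemma L2_sinM (k c d : R) : L2 c d (fun x => sin (k * x)).
Proof. by apply: L2_cont; exact: continuous_sinM. Qed.

Lemma ip_cos_cos (k l : R) c d : c <= d ->
  ip c d (fun x => cos (k * x)) (fun x => cos (l * x)) =
  2^-1 * (\int[mu]_(x in `]c, d[) cos ((k - l) * x) + \int[mu]_(x in `]c, d[) cos ((k + l) * x)).
Proof.
move=> cd; rewrite -intD; try by apply: itg_cont; exact: continuous_cosM.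
rewrite -intZ; last by apply: itgD; apply: itg_cont; exact: continuous_cosM.
by apply: eq_Rintegral => x _; rewrite mulrBl mulrDl cosB cosD; field.
Qed.

Lemma ip_sin_sin (k l : R) c d : c <= d ->
  ip c d (fun x => sin (k * x)) (fun x => sin (l * x)) =
  2^-1 * (\int[mu]_(x in `]c, d[) cos ((k - l) * x) - \int[mu]_(x in `]c, d[) cos ((k + l) * x)).
Proof.
move=> cd; rewrite -intB; try by apply: itg_cont; exact: continuous_cosM.
rewrite -intZ; last by apply: itgB; apply: itg_cont; exact: continuous_cosM.
by apply: eq_Rintegral => x _; rewrite mulrBl mulrDl cosB cosD; field.
Qed.

Lemma ip_sin_cos (k l : R) c d : c <= d ->
  ip c d (fun x => sin (k * x)) (fun x => cos (l * x)) =
  2^-1 * (\int[mu]_(x in `]c, d[) sin ((k - l) * x) + \int[mu]_(x in `]c, d[) sin ((k + l) * x)).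
Proof.
move=> cd; rewrite -intD; try by apply: itg_cont; exact: continuous_sinM.
rewrite -intZ; last by apply: itgD; apply: itg_cont; exact: continuous_sinM.
by apply: eq_Rintegral => x _; rewrite mulrBl mulrDl sinB sinD; field.
Qed.

Lemma int_cos0 c d : c <= d -> \int[mu]_(x in `]c, d[) cos (0 * x) = d - c.
Proof.
move=> cd; under eq_Rintegral do rewrite mul0r cos0.
by rewrite int_cst// mul1r.
Qed.

Lemma cos_ortho n m :
  ip 0 1 (fun x => cos (lam n * x)) (fun x => cos (lam m * x)) = (n == m)%:R / 2.
Proof.
rewrite ip_cos_cos//; have S0 : lam n + lam m != 0 by rewrite gt_eqF// addr_gt0 ?lam_gt0.
rewrite (int_cosM S0)// mulr1 mulr0 sin_lamD sin0 subrr mul0r addr0.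
have [->|nm] := eqVneq n m; first by rewrite subrr int_cos0// subr0 mulrC.
by rewrite int_cosM ?lamB_neq0// mulr1 mulr0 sin_lamB sin0 subrr mul0r mulr0 mul0r.
Qed.

Lemma sin_ortho n m :
  ip 0 1 (fun x => sin (lam n * x)) (fun x => sin (lam m * x)) = (n == m)%:R / 2.
Proof.
rewrite ip_sin_sin//; have S0 : lam n + lam m != 0 by rewrite gt_eqF// addr_gt0 ?lam_gt0.
rewrite (int_cosM S0)// mulr1 mulr0 sin_lamD sin0 subrr mul0r subr0.
have [->|nm] := eqVneq n m; first by rewrite subrr int_cos0// subr0 mulrC.
by rewrite int_cosM ?lamB_neq0// mulr1 mulr0 sin_lamB sin0 subrr mul0r mulr0 mul0r.
Qed.

Lemma ip_suml c d N (F : nat -> R -> R) v : (forall i, L2 c d (F i)) -> L2 c d v ->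
  ip c d (fun x => \sum_(i < N) F i x) v = \sum_(i < N) ip c d (F i) v.
Proof.
move=> hF hv; rewrite /ip -int_sum => [|i]; last exact: L2_mul.
by apply: eq_Rintegral => x _; rewrite mulr_suml.
Qed.

Section Orthogonal.
Variables (c d : R) (e : nat -> R -> R).
Hypothesis L2e : forall n, L2 c d (e n).
Hypothesis e_ortho : forall n m, ip c d (e n) (e m) = (n == m)%:R / 2.

(** Remainder of the orthogonal projection onto the first [N] functions; the factor 2 compensates
    for their squared norm 1/2. *)
Definition residual N w x := w x - \sum_(i < N) 2 * ip c d w (e i) * e i x.

Lemma L2_residual N w : L2 c d w -> L2 c d (residual N w).
Proof.
move=> hw; apply: L2B => //; apply: (@L2_sum _ c d _ _ _ (fun i : 'I_N => fun x => 2 * ip c d w (e i) * e i x)) => i.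
exact: L2Z.
Qed.

Lemma ip_residual_e N w (i : 'I_N) : L2 c d w -> ip c d (residual N w) (e i) = 0.
Proof.
move=> hw; have hs : L2 c d (fun x => \sum_(i < N) 2 * ip c d w (e i) * e i x).
  by apply: (@L2_sum _ c d _ _ _ (fun i : 'I_N => fun x => 2 * ip c d w (e i) * e i x)) => j; exact: L2Z.
have E : residual N w = fun x => w x + (-1) * \sum_(i < N) 2 * ip c d w (e i) * e i x.
  by apply/funext => x; rewrite mulN1r.
rewrite E ipDl//; last exact: L2Z.
rewrite ipZl//.
rewrite (@ip_suml c d N (fun i x => 2 * ip c d w (e i) * e i x))//; last by move=> j; exact: L2Z.
rewrite (bigD1 i)//= big1 ?addr0 => [|j ji].
  by rewrite ipZl// e_ortho eqxx/=; field.
by rewrite ipZl// e_ortho (_ : (j == i :> nat) = false) ?mul0r ?mulr0//; exact/negbTE.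
Qed.

Lemma ip_residual N w v : L2 c d w -> L2 c d v ->
  ip c d (residual N w) v = ip c d w v - \sum_(i < N) 2 * ip c d w (e i) * ip c d (e i) v.
Proof.
move=> hw hv; have hs : L2 c d (fun x => \sum_(i < N) 2 * ip c d w (e i) * e i x).
  by apply: (@L2_sum _ c d _ _ _ (fun i : 'I_N => fun x => 2 * ip c d w (e i) * e i x)) => j; exact: L2Z.
have E : residual N w = fun x => w x + (-1) * \sum_(i < N) 2 * ip c d w (e i) * e i x.
  by apply/funext => x; rewrite mulN1r.
rewrite E ipDl//; last exact: L2Z.
rewrite ipZl// mulN1r.
rewrite (@ip_suml c d N (fun i x => 2 * ip c d w (e i) * e i x))//; last by move=> j; exact: L2Z.
by congr (_ - _); apply: eq_bigr => i _; rewrite ipZl.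
Qed.

Lemma residual_sq N w : L2 c d w ->
  ip c d (residual N w) (residual N w) = ip c d w w - 2 * \sum_(i < N) ip c d w (e i) ^+ 2.
Proof.
move=> hw; have hr := L2_residual N hw.
rewrite (ip_residual N hw hr) ipC (ip_residual N hw hw) [X in _ - _ - X]big1 ?subr0.
  by rewrite mulr_sumr; congr (_ - _); apply: eq_bigr => i _; rewrite (ipC c d (e i)); ring.
by move=> i _; rewrite (ipC c d (e i)) ip_residual_e// mulr0.
Qed.

Lemma bessel N w : L2 c d w -> 2 * \sum_(i < N) ip c d w (e i) ^+ 2 <= ip c d w w.
Proof. by move=> hw; rewrite -subr_ge0 -residual_sq// ip_ge0. Qed.

End Orthogonal.

Section HilbertSchmidt.
Variables (e e' : nat -> R -> R) (h : R -> R -> R).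
Hypotheses (ce : forall n, continuous (e n)) (ce' : forall n, continuous (e' n)).
Hypothesis e_ortho : forall n m, ip 0 1 (e n) (e m) = (n == m)%:R / 2.
Hypothesis e'_ortho : forall n m, ip 0 1 (e' n) (e' m) = (n == m)%:R / 2.
Hypothesis L2h : forall x, 0 < x < 1 -> L2 0 1 (h x).
Hypothesis he : forall x n, 0 < x < 1 -> ip 0 1 (h x) (e n) = e' n x / lam n.
Hypothesis ihh : itg 0 1 (fun x => ip 0 1 (h x) (h x)).
Hypothesis hh : \int[mu]_(x in `]0, 1[) ip 0 1 (h x) (h x) = 2^-1.

(** [w] is integrated against a kernel [h] with singular functions [e], [e']
    and singular values [1 / lam n]; the tail of the expansion of [h] has
    squared Hilbert-Schmidt norm [1/2 - sum_{n < N} lam n ^- 2]. *)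
Lemma hilbert_schmidt_tail w N : L2 0 1 w ->
  L2 0 1 (fun x => ip 0 1 w (h x)) ->
  (forall n, ip 0 1 (fun x => ip 0 1 w (h x)) (e' n) = ip 0 1 w (e n) / lam n) ->
  ip 0 1 (fun x => ip 0 1 w (h x)) (fun x => ip 0 1 w (h x)) <=
  2 * \sum_(i < N) (ip 0 1 w (e i) / lam i) ^+ 2 +
  (2^-1 - \sum_(i < N) (lam i) ^- 2) * ip 0 1 w w.
Proof.
move=> hw; set V := fun x => _; move=> hV Ve.
have L2e n : L2 0 1 (e n) by exact: L2_cont.
have L2e' n : L2 0 1 (e' n) by exact: L2_cont.
suff: ip 0 1 (residual 0 1 e' N V) (residual 0 1 e' N V) <=
    (2^-1 - \sum_(i < N) (lam i) ^- 2) * ip 0 1 w w.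
  rewrite (residual_sq L2e' e'_ortho)// lerBlDl; congr (_ <= 2 * _ + _).
  by apply: eq_bigr => i _; rewrite Ve.
have Hs : L2 0 1 (residual 0 1 e' N V) by exact: L2_residual.
(* Pointwise Cauchy-Schwarz bound: the squared norm of the residual of [h x], times that of [w]. Its
   integral is the right-hand side sought. *)
pose B x := (ip 0 1 (h x) (h x) - 2 * \sum_(i < N) (e' i x / lam i) ^+ 2) * ip 0 1 w w.
have iS : forall i : 'I_N, itg 0 1 (fun x => (lam i) ^- 2 * (e' i x * e' i x)).
  by move=> i; apply: itgZ; exact: L2_mul.
have iSS : itg 0 1 (fun x => \sum_(i < N) (lam i) ^- 2 * (e' i x * e' i x)).
  exact: (@itg_sum _ 0 1 _ _ _ (fun i : 'I_N => fun x => (lam i) ^- 2 * (e' i x * e' i x))).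
have HB : B = fun x => ip 0 1 w w * (ip 0 1 (h x) (h x) -
     2 * \sum_(i < N) (lam i) ^- 2 * (e' i x * e' i x)).
  apply/funext => x; rewrite /B mulrC; congr (_ * (_ - 2 * _)).
  by apply: eq_bigr => i _; rewrite exprMn exprVn mulrC expr2.
have iB : itg 0 1 B.
  by rewrite HB; apply: itgZ; apply: itgB => //; apply: itgZ.
have -> : (2^-1 - \sum_(i < N) (lam i) ^- 2) * ip 0 1 w w = \int[mu]_(x in `]0, 1[) B x.
  rewrite HB intZ; last by apply: itgB => //; apply: itgZ.
  rewrite mulrC intB//; last exact: itgZ.
  rewrite hh intZ// (@int_sum _ 0 1 _ _ _ (fun i : 'I_N => fun x => (lam i) ^- 2 * (e' i x * e' i x)))//.
  congr (_ * (_ - _)); rewrite mulr_sumr; apply: eq_bigr => i _.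
  rewrite intZ; last exact: L2_mul.
  by have := e'_ortho i i; rewrite eqxx/= /ip => ->; field; exact: lam_neq0.
apply: le_int => //; first exact: L2_mul.
move=> x x01; have hx := L2h x01.
(* [V] is [w] integrated against [h], and its coefficients are those of [w] divided by [lam]; hence
   taking the residual of [V] amounts to replacing [h x] by its residual. *)
have -> : residual 0 1 e' N V x = ip 0 1 w (residual 0 1 e N (h x)).
  rewrite ipC (ip_residual L2e)//; rewrite /residual ipC; congr (_ - _).
  apply: eq_bigr => i _; rewrite Ve he// (ipC _ _ (e i)).
  by field; exact: lam_neq0.
rewrite -expr2 (le_trans (ip_CS hw (L2_residual L2e N hx)))//.
rewrite (residual_sq L2e)// mulrC /B; apply: ler_wpM2r; first exact: ip_ge0.
by rewrite lerB// ler_wpM2l//; apply: ler_sum => i _; rewrite he.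
Qed.

End HilbertSchmidt.

End Trigonometric.

(** * The Basel sum and the tail of primitives *)

Section Tail.
Variable R : realType.
Notation mu := (@lebesgue_measure R).
Implicit Types (c d x y : R) (f g u v w : R -> R).
Notation lam := (@lam R).

(** The function [sin x - x * cos x] vanishes at 0 and has derivative [x * sin x], nonnegative up to
    [pi]. *)
Lemma mul_cos_le_sin y : 0 <= y -> y <= pi -> y * cos y <= sin y.
Proof.
move=> y0 ypi.
have dF x : is_derive x 1 (fun x : R => sin x - x * cos x) (x * sin x).
  by apply: is_derive_eq; rewrite /GRing.scale/=; ring.
pose F x : R := sin x - x * cos x.
have : F 0 <= F y.
  have Fc : continuous F.
    by move=> x; apply: differentiable_continuous; apply/derivable1_diffP; have [] := dF x.
  apply: (@ger0_derive1_le_cc _ F 0 pi) => //.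
  - move=> x; rewrite in_itv/= => /andP[x0 xpi]; rewrite derive1E; have [_ ->] := dF x.
    by apply: mulr_ge0; [exact: ltW|rewrite ltW// sin_gt0_pi// x0].
  - exact: continuous_subspaceT.
  - by rewrite in_itv/= lexx pi_ge0.
  - by rewrite in_itv/= y0.
by rewrite /F sin0 mul0r subrr subr_ge0.
Qed.

(** Square [y * cos y <= sin y], replace the squared cosine by one minus the squared sine, and
    divide. *)
Lemma csc_sq_le y : 0 < y -> y < pi / 2 -> (sin y) ^- 2 <= y ^- 2 + 1.
Proof.
move=> y0 yp.
have ypi : y < pi by rewrite (lt_le_trans yp)// ler_pdivrMr// ler_peMr ?pi_ge0// ler1n.
have s0 : 0 < sin y by rewrite sin_gt0_pi// y0.
have c0 : 0 < cos y by rewrite cos_gt0_pihalf// yp andbT (lt_trans _ y0)// oppr_lt0 divr_gt0 ?pi_gt0.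
have ys := mul_cos_le_sin (ltW y0) (ltW ypi).
have E := cos2Dsin2 y.
rewrite -(ler_pM2l (_ : 0 < y ^+ 2 * sin y ^+ 2)); last by rewrite mulr_gt0 ?exprn_gt0.
have -> : y ^+ 2 * sin y ^+ 2 * sin y ^- 2 = y ^+ 2 by field; rewrite gt_eqF.
have -> : y ^+ 2 * sin y ^+ 2 * (y ^- 2 + 1) = sin y ^+ 2 + y ^+ 2 * sin y ^+ 2.
  by field; rewrite gt_eqF.
have : (y * cos y) ^+ 2 <= sin y ^+ 2.
  by rewrite lerXn2r ?nnegrE ?mulr_ge0// ltW.
have -> : (y * cos y) ^+ 2 = y ^+ 2 * cos y ^+ 2 by rewrite exprMn.
by nra.
Qed.

Lemma csc_sq_double y : sin y != 0 -> cos y != 0 ->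
  (sin y) ^- 2 + (cos y) ^- 2 = 4 * (sin (y *+ 2)) ^- 2.
Proof.
move=> s0 c0; rewrite sin_mulr2n.
have E := cos2Dsin2 y.
have -> : sin y ^- 2 + cos y ^- 2 = (cos y ^+ 2 + sin y ^+ 2) / (sin y ^+ 2 * cos y ^+ 2).
  by field; rewrite s0 c0.
by rewrite E -mulr_natr; field; rewrite s0 c0.
Qed.

(** For [k < 2 ^ m] these are the zeros of [cos (2 ^ (m + 1) y)] in []0, pi / 2[]. Doubling the
    angle lowers [m] by one, and [y -> pi / 2 - y] permutes them. *)
Definition node m k : R := lam k / 2 ^+ m.+1.

Lemma node_gt0 m k : 0 < node m k.
Proof. by rewrite divr_gt0 ?lam_gt0// exprn_gt0. Qed.

Lemma node_lt m k : (k < 2 ^ m)%N -> node m k < pi / 2.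
Proof.
move=> km; rewrite /node ltr_pdivrMr ?exprn_gt0// /lam exprS.
have -> : pi / 2 * (2 * 2 ^+ m) = (2 ^+ m) * pi :> R by field.
rewrite ltr_pM2r ?pi_gt0//.
apply: (@lt_le_trans _ _ k.+1%:R); last by rewrite -natrX ler_nat.
by rewrite -[k.+1]addn1 natrD ltrD2l; lra.
Qed.

Lemma node_double m k : node m.+1 k *+ 2 = node m k.
Proof. by rewrite /node -mulr_natr (exprS _ m.+1); field; rewrite expf_neq0. Qed.

Lemma node_compl m k : (k < 2 ^ m)%N ->
  node m.+1 (2 ^ m.+1 - k.+1) = pi / 2 - node m.+1 k.
Proof.
move=> km.
have kS : (k.+1 <= 2 ^ m.+1)%N by rewrite expnS mul2n -addnn (leq_trans km)// leq_addr.
rewrite /node /lam natrB// natrX -[k.+1]addn1 natrD (exprS _ m.+1); field.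
by rewrite expf_neq0.
Qed.

(** Applying [1/sin^2 y + 1/cos^2 y = 4/sin^2 (2y)] at every node; with
    [1/sin^2 y <= 1/y^2 + 1] this replaces the Basel sum [sum lam^-2 = 1/2]. *)
Lemma sum_csc_sq m : \sum_(k < 2 ^ m) (sin (node m k)) ^- 2 = 2 * 4 ^+ m.
Proof.
elim: m => [|m IH].
  rewrite expn0 big_ord1 expr0 mulr1 /node /lam expr1 add0r.
  have -> : 2^-1 * pi / 2 = pi / 4 :> R by field.
  rewrite (_ : sin (pi / 4) ^+ 2 = 2^-1) ?invrK//.
  have h := @cos_mulr2n R (pi / 4).
  have e : cos ((pi / 4) *+ 2) = 0 :> R.
    by rewrite (_ : (pi / 4) *+ 2 = pi / 2) ?cos_pihalf// -mulr_natr; field.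
  by have := @cos2Dsin2 R (pi / 4); move: h; rewrite e => h1 h2; lra.
have E2 : (2 ^ m.+1 = 2 ^ m + 2 ^ m)%N by rewrite expnS mul2n addnn.
rewrite -(big_mkord xpredT (fun k => (sin (node m.+1 k)) ^- 2)) {1}E2 big_mkord.
(* The upper half of the indices, reversed, is the reflection of the lower half: each pair
   contributes the sine and the cosine of one node. *)
rewrite big_split_ord/= [X in _ + X](reindex_inj rev_ord_inj)/= -big_split/=.
transitivity (\sum_(k < 2 ^ m) 4 * (sin (node m k)) ^- 2); last first.
  by rewrite -mulr_sumr IH exprS; ring.
apply: eq_bigr => k _.
have -> : (2 ^ m + (2 ^ m - k.+1) = 2 ^ m.+1 - k.+1)%N by rewrite E2 addnBA.
rewrite node_compl// -[in RHS](node_double m k) -csc_sq_double.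
- by rewrite sinB sin_pihalf cos_pihalf mul1r mul0r subr0.
- rewrite gt_eqF// sin_gt0_pi// node_gt0/=.
  have := @node_lt m.+1 k; rewrite E2 (leq_trans (ltn_ord k)) ?leq_addr// => /(_ isT).
  have := @pi_gt0 R; lra.
- rewrite gt_eqF// cos_gt0_pihalf//.
  have := @node_lt m.+1 k; rewrite E2 (leq_trans (ltn_ord k)) ?leq_addr// => /(_ isT) h.
  by apply/andP; split => //; rewrite (lt_trans _ (node_gt0 _ _))// oppr_lt0 divr_gt0 ?pi_gt0.
Qed.

(** Summed over the nodes, [csc_sq_le] reads [2 * 4 ^ m <= 4 * 4 ^ m * S + 2 ^ m] with [S] the
    partial sum, so the tail is even at most a quarter of this bound. *)
Lemma basel_tail m : 2^-1 - \sum_(k < 2 ^ m) (lam k) ^- 2 <= (2 ^+ m)^-1.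
Proof.
have e4 : 4 ^+ m = 2 ^+ m * 2 ^+ m :> R.
  have e : 4 = 2 ^+ 2 :> R by rewrite -natrX.
  by rewrite e -expr2 exprAC.
have h : \sum_(k < 2 ^ m) (sin (node m k)) ^- 2 <= \sum_(k < 2 ^ m) (4 * 4 ^+ m * (lam k) ^- 2 + 1).
  apply: ler_sum => k _; rewrite (le_trans (csc_sq_le (node_gt0 m k) (node_lt (ltn_ord k))))//.
  rewrite lerD2r le_eqVlt; apply/orP; left; apply/eqP.
  rewrite /node e4 (exprS 2 m).
  by field; rewrite lam_neq0 expf_neq0.
move: h; rewrite sum_csc_sq big_split/= -mulr_sumr sumr_const card_ord.
have p : 0 < 2 ^+ m :> R by exact: exprn_gt0.
rewrite e4 -natrX; set S := \sum_(_ < _) _.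
rewrite (_ : (2 ^ m)%:R = 2 ^+ m); last by rewrite natrX.
set z := 2 ^+ m in p *; move=> h.
rewrite -(ler_pM2r (_ : 0 < 4 * (z * z))); last by rewrite mulr_gt0// mulr_gt0.
have -> : z^-1 * (4 * (z * z)) = 4 * z by field; rewrite gt_eqF.
by nra.
Qed.

(** Bessel's inequality for the constant 1, whose sine coefficients are [1 / lam n]. *)
Lemma sum_lam_le N : \sum_(k < N) (lam k) ^- 2 <= 2^-1.
Proof.
have L1 := L2_cst 0 1 (1 : R).
have h := @bessel R 0 1 (fun n x => sin (lam n * x)) (fun n => L2_cont 0 1 (@continuous_sinM _ (lam n))) (@sin_ortho R) N _ L1.
have E n : ip 0 1 (cst 1) (fun x => sin (lam n * x)) = (lam n)^-1.
  rewrite /ip; under eq_Rintegral do rewrite mul1r.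
  by rewrite int_sinM ?lam_neq0// mulr1 mulr0 cos0 cos_lam subr0 mul1r.
have E1 : ip 0 1 (cst (1 : R)) (cst 1) = 1.
  by rewrite /ip/= int_cst// mulr1 subr0 mulr1.
move: h; rewrite E1; under eq_bigr do rewrite E exprVn.
by move=> h; lra.
Qed.

Lemma lam_ge n : n%:R <= lam n.
Proof.
have p1 : 1 <= pi :> R by rewrite (le_trans _ (@pi_ge2 R))// ler1n.
by rewrite /lam (le_trans (_ : _ <= n%:R + 2^-1))// ?ler_peMr ?lerDl// addr_ge0.
Qed.

Lemma lam_mono n m : (n <= m)%N -> lam n <= lam m.
Proof. by move=> nm; rewrite ler_pM2r ?pi_gt0// lerD2r ler_nat. Qed.

(** The Basel tail is known only for [2 ^ m] terms, so the limit is taken along powers of 2 beyond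
    [M]. *)
Lemma le_exp2_eps (a b c : R) (M : nat) : 0 <= c ->
  (forall m, (M <= 2 ^ m)%N -> a <= b + (2 ^+ m)^-1 * c) -> a <= b.
Proof.
move=> c0 H; apply/ler_addgt0Pr => eps e0.
have ce : 0 <= c / eps by rewrite divr_ge0// ltW.
pose m := (M + Num.bound (c / eps))%N.
have mM : (M <= 2 ^ m)%N by rewrite (leq_trans (leq_addr (Num.bound (c / eps)) M))// ltnW// ltn_expl.
rewrite (le_trans (H m mM))// lerD2l mulrC ler_pdivrMr ?exprn_gt0//.
rewrite -ler_pdivrMl// mulrC (le_trans (ltW (archi_boundP ce)))//.
by rewrite -natrX ler_nat (leq_trans (leq_addl M _))// ltnW// ltn_expl.
Qed.

Section ModalTail.
Variables (e e' : nat -> R -> R) (h : R -> R -> R).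
Hypotheses (ce : forall n, continuous (e n)) (ce' : forall n, continuous (e' n)).
Hypothesis e_ortho : forall n m, ip 0 1 (e n) (e m) = (n == m)%:R / 2.
Hypothesis e'_ortho : forall n m, ip 0 1 (e' n) (e' m) = (n == m)%:R / 2.
Hypothesis L2h : forall x, 0 < x < 1 -> L2 0 1 (h x).
Hypothesis he : forall x n, 0 < x < 1 -> ip 0 1 (h x) (e n) = e' n x / lam n.
Hypothesis ihh : itg 0 1 (fun x => ip 0 1 (h x) (h x)).
Hypothesis hh : \int[mu]_(x in `]0, 1[) ip 0 1 (h x) (h x) = 2^-1.

(** The Hilbert-Schmidt estimate is applied with [2 ^ m] modes and [m] tends to infinity, which
    removes its remainder. The modes from [M] on have [lam i >= lam M], and Bessel's inequality
    bounds their total by the last term. *)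
Lemma modal_tail w M : L2 0 1 w ->
  L2 0 1 (fun x => ip 0 1 w (h x)) ->
  (forall n, ip 0 1 (fun x => ip 0 1 w (h x)) (e' n) = ip 0 1 w (e n) / lam n) ->
  ip 0 1 (fun x => ip 0 1 w (h x)) (fun x => ip 0 1 w (h x)) <=
  2 * \sum_(i < M) (ip 0 1 w (e i) / lam i) ^+ 2 + ip 0 1 w w / lam M ^+ 2.
Proof.
move=> hw hV Ve; apply: (@le_exp2_eps _ _ (ip 0 1 w w) M); first exact: ip_ge0.
move=> m mM.
have L2e n : L2 0 1 (e n) by exact: L2_cont.
rewrite (le_trans (hilbert_schmidt_tail ce ce' e_ortho e'_ortho L2h he ihh hh (2 ^ m) hw hV Ve))//.
apply: lerD; last by apply: ler_wpM2r; [exact: ip_ge0|exact: basel_tail].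
rewrite -(big_mkord xpredT (fun i => (ip 0 1 w (e i) / lam i) ^+ 2)).
rewrite (big_cat_nat (leq0n M) mM)//= mulrDr big_mkord lerD2l.
have B := bessel L2e e_ortho (2 ^ m) hw.
rewrite ler_pdivlMr ?exprn_gt0 ?lam_gt0// (le_trans _ B)// -mulrA ler_pM2l// mulr_suml.
rewrite -[leRHS](big_mkord xpredT (fun i => ip 0 1 w (e i) ^+ 2)).
rewrite (big_cat_nat (leq0n M) mM)//= [leRHS]addrC -[leLHS]addr0; apply: lerD; last first.
  by apply: sumr_ge0 => i _; rewrite sqr_ge0.
rewrite big_nat_cond [leRHS]big_nat_cond; apply: ler_sum => i /andP[/andP[Mi _] _].
rewrite exprMn exprVn -mulrA ler_piMr ?sqr_ge0//.
rewrite mulrC ler_pdivrMr ?exprn_gt0 ?lam_gt0// mul1r.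
by rewrite lerXn2r ?nnegrE ?lam_mono// ltW ?lam_gt0.
Qed.

End ModalTail.

Lemma L2_prim c d f : c < d -> itg c d f ->
  L2 c d (fun x => \int[mu]_(y in `]c, x[) f y).
Proof.
move=> cd hf.
apply: (@L2_bounded _ _ _ _ (\int[mu]_(y in `]c, d[) `|f y|)).
  apply: (@measurable_funS _ _ _ _ `[c, d]%classic).
  - exact: measurable_itv.
  - exact: subset_itv_oo_cc.
  - apply: subspace_continuous_measurable_fun; first exact: measurable_itv.
    exact: prim_continuous.
by move=> x /andP[cx xd]; apply: prim_bounded => //; exact: ltW.
Qed.

Lemma L2_ext c d u v : (forall x, c < x < d -> u x = v x) -> L2 c d u -> L2 c d v.
Proof.
move=> uv /L2P[m i]; apply/L2P; split.
  by apply: eq_measurable_fun m => x; rewrite inE/= in_itv/= => /uv.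
by apply: eq_integrable i; [exact: measurable_oo|move=> x; rewrite inE/= in_itv/= => /uv ->].
Qed.

Lemma eq_int c d u v : (forall x, c < x < d -> u x = v x) ->
  \int[mu]_(x in `]c, d[) u x = \int[mu]_(x in `]c, d[) v x.
Proof. by move=> uv; apply: eq_Rintegral => x; rewrite inE/= in_itv/= => /uv. Qed.

Lemma eq_itg c d u v : (forall x, c < x < d -> u x = v x) -> itg c d u -> itg c d v.
Proof.
move=> uv; apply: eq_integrable; first exact: measurable_oo.
by move=> x; rewrite inE/= in_itv/= => /uv ->.
Qed.

Lemma int_coprim c d x f : c <= x <= d -> itg c d f ->
  \int[mu]_(y in `]x, d[) f y = \int[mu]_(y in `]c, d[) f y - \int[mu]_(y in `]c, x[) f y.
Proof. by move=> /andP[cx xd] hf; rewrite (int_split cx xd hf) addrAC subrr add0r. Qed.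

Lemma L2_coprim c d f : c < d -> itg c d f ->
  L2 c d (fun x => \int[mu]_(y in `]x, d[) f y).
Proof.
move=> cd hf.
apply: (@L2_ext _ _ (fun x => \int[mu]_(y in `]c, d[) f y - \int[mu]_(y in `]c, x[) f y)).
  by move=> x /andP[cx xd]; rewrite -int_coprim// !ltW.
by apply: L2B; [exact: L2_cst|exact: L2_prim].
Qed.

(** Kernel of the operator [coprim], as [before] is that of [prim]; it also expresses the jump of
    the strain at [a]. *)
Definition after x y : R := (x < y)%R%:R.
Definition before x y : R := (y < x)%R%:R.

Lemma L2_after c d x : L2 c d (after x).
Proof.
apply: (@L2_bounded _ _ _ _ 1).
  apply: (@measurable_funS _ _ _ _ setT) => //.
  rewrite (_ : after x = fun y => if x < y then 1 else 0); last first.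
    by apply/funext => y; rewrite /after; case: ifP.
  by apply: measurable_fun_ifT => //; apply: measurable_fun_ltr.
by move=> y _; rewrite /after; case: (x < y); rewrite ?normr1 ?normr0.
Qed.

Lemma L2_before c d x : L2 c d (before x).
Proof.
apply: (@L2_bounded _ _ _ _ 1).
  apply: (@measurable_funS _ _ _ _ setT) => //.
  rewrite (_ : before x = fun y => if y < x then 1 else 0); last first.
    by apply/funext => y; rewrite /before; case: ifP.
  by apply: measurable_fun_ifT => //; apply: measurable_fun_ltr.
by move=> y _; rewrite /before; case: (y < x); rewrite ?normr1 ?normr0.
Qed.

Lemma ip_after c d x f : c <= x <= d -> L2 c d f ->
  ip c d f (after x) = \int[mu]_(y in `]x, d[) f y.
Proof.
move=> /andP[cx xd] hf; rewrite /ip (int_split cx xd); last first.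
  exact: L2_mul (L2_after c d x).
rewrite [X in X + _](_ : _ = 0) ?add0r; last first.
  transitivity (\int[mu]_(y in `]c, x[) (0 : R)); last by rewrite int_cst// mul0r.
  by apply: eq_int => y /andP[_ yx]; rewrite /after ltNge ltW// mulr0.
by apply: eq_int => y /andP[xy _]; rewrite /after xy mulr1.
Qed.

Lemma ip_before c d x f : c <= x <= d -> L2 c d f ->
  ip c d f (before x) = \int[mu]_(y in `]c, x[) f y.
Proof.
move=> /andP[cx xd] hf; rewrite /ip (int_split cx xd); last first.
  exact: L2_mul (L2_before c d x).
rewrite [X in _ + X](_ : _ = 0) ?addr0; last first.
  transitivity (\int[mu]_(y in `]x, d[) (0 : R)); last by rewrite int_cst// mul0r.
  by apply: eq_int => y /andP[xy _]; rewrite /before ltNge ltW// mulr0.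
by apply: eq_int => y /andP[_ xy]; rewrite /before xy mulr1.
Qed.

Lemma int_onem (c d : R) : c <= d -> \int[mu]_(x in `]c, d[) (d - x) = (d - c) ^+ 2 / 2.
Proof.
move=> cd.
have dF x : is_derive x 1 (fun x => d * x - 2^-1 * x ^+ 2) (d - x).
  by apply: is_derive_eq; rewrite /GRing.scale/=; field.
have cF : continuous (fun x : R => d - x).
  by move=> x; apply: continuousB; [exact: cvg_cst|exact: cvg_id].
by rewrite (int_FTC cd dF cF); field.
Qed.

Lemma int_id (d : R) : 0 <= d -> \int[mu]_(x in `]0, d[) x = d ^+ 2 / 2.
Proof.
move=> cd.
have dF x : is_derive x 1 (fun x : R => 2^-1 * x ^+ 2) x.
  by apply: is_derive_eq; rewrite /GRing.scale/=; field.
by rewrite (int_FTC cd dF (fun x => cvg_id)); field.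
Qed.

Lemma ip_coprim c d w g : itg c d w -> itg c d g ->
  ip c d (fun x => \int[mu]_(y in `]x, d[) w y) g =
  \int[mu]_(y in `]c, d[) (w y * \int[mu]_(x in `]c, y[) g x).
Proof.
move=> hw hg; rewrite /ip.
under eq_Rintegral do rewrite mulrC.
rewrite -(iterated_integral hg hw).
by apply: eq_Rintegral => x _; rewrite mulrC.
Qed.

Definition prim c w x := \int[mu]_(y in `]c, x[) w y.

Definition coprim d w x := \int[mu]_(y in `]x, d[) w y.

(** [coprim 1] maps [sin (lam n x)] to [cos (lam n x) / lam n], as [cos (lam n) = 0], and its kernel
    [after x] has squared norm [1 - x], of integral 1/2. *)
Lemma sine_tail w M : L2 0 1 w ->
  ip 0 1 (coprim 1 w) (coprim 1 w) <=
  2 * \sum_(i < M) (ip 0 1 w (fun x => sin (lam i * x)) / lam i) ^+ 2 + ip 0 1 w w / lam M ^+ 2.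
Proof.
move=> hw; set W := coprim 1 w.
have iw := L2_itg hw.
have E x : 0 < x < 1 -> ip 0 1 w (after x) = W x.
  by move=> /andP[x0 x1]; rewrite ip_after// !ltW.
have E1 x : 0 < x < 1 -> ip 0 1 (after x) (after x) = 1 - x.
  move=> /andP[x0 x1]; rewrite ip_after; [|by rewrite !ltW|exact: L2_after].
  rewrite -[RHS]mul1r -int_cst ?ltW//; apply: eq_int => y /andP[xy _].
  by rewrite /after xy.
have cid : continuous (fun x : R => 1 - x).
  by move=> x; apply: continuousB; [exact: cvg_cst|exact: cvg_id].
have LW : L2 0 1 W by exact: L2_coprim.
have -> : ip 0 1 W W = ip 0 1 (fun x => ip 0 1 w (after x)) (fun x => ip 0 1 w (after x)).
  by apply: eq_int => x x01; rewrite E.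
apply: (modal_tail (e := fun n x => sin (lam n * x)) (e' := fun n x => cos (lam n * x))) => //.
- by move=> n; exact: continuous_sinM.
- by move=> n; exact: continuous_cosM.
- exact: sin_ortho.
- exact: cos_ortho.
- by move=> x _; exact: L2_after.
- move=> x n /andP[x0 x1]; rewrite ipC ip_after.
  + by rewrite int_sinM ?lam_neq0 ?ltW// mulr1 cos_lam subr0.
  + by rewrite !ltW.
  + exact: L2_sinM.
- apply: (@eq_itg _ _ (fun x => 1 - x)); last exact: itg_cont.
  by move=> x /E1 ->.
- by rewrite (eq_int E1) int_onem// subr0 expr1n mul1r.
- by apply: (L2_ext _ LW) => x x01; rewrite E.
- move=> n.
  have -> : ip 0 1 (fun x => ip 0 1 w (after x)) (fun x => cos (lam n * x)) =
    ip 0 1 W (fun x => cos (lam n * x)) by apply: eq_int => x x01; rewrite E.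
  rewrite ip_coprim//; last by apply: itg_cont; exact: continuous_cosM.
  rewrite mulrC -intZ; last by apply: L2_mul => //; apply: L2_cont; exact: continuous_sinM.
  apply: eq_int => y /andP[y0 y1].
  by rewrite int_cosM ?lam_neq0 ?ltW// mulr0 sin0 subr0; field; exact: lam_neq0.
Qed.

(** The mirror case: [prim 0] maps [cos (lam n x)] to [sin (lam n x) / lam n], and [before x] has
    squared norm [x]. *)
Lemma cosine_tail w M : L2 0 1 w ->
  ip 0 1 (prim 0 w) (prim 0 w) <=
  2 * \sum_(i < M) (ip 0 1 w (fun x => cos (lam i * x)) / lam i) ^+ 2 + ip 0 1 w w / lam M ^+ 2.
Proof.
move=> hw; set W := prim 0 w.
have iw := L2_itg hw.
have E x : 0 < x < 1 -> ip 0 1 w (before x) = W x.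
  by move=> /andP[x0 x1]; rewrite ip_before// !ltW.
have E1 x : 0 < x < 1 -> ip 0 1 (before x) (before x) = x.
  move=> /andP[x0 x1]; rewrite ip_before; [|by rewrite !ltW|exact: L2_before].
  rewrite -[RHS]subr0 -[RHS]mul1r -int_cst ?ltW//; apply: eq_int => y /andP[_ xy].
  by rewrite /before xy.
have LW : L2 0 1 W by exact: L2_prim.
have -> : ip 0 1 W W = ip 0 1 (fun x => ip 0 1 w (before x)) (fun x => ip 0 1 w (before x)).
  by apply: eq_int => x x01; rewrite E.
apply: (modal_tail (e := fun n x => cos (lam n * x)) (e' := fun n x => sin (lam n * x))) => //.
- by move=> n; exact: continuous_cosM.
- by move=> n; exact: continuous_sinM.
- exact: cos_ortho.
- exact: sin_ortho.
- by move=> x _; exact: L2_before.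
- move=> x n /andP[x0 x1]; rewrite ipC ip_before.
  + by rewrite int_cosM ?lam_neq0 ?ltW// mulr0 sin0 subr0.
  + by rewrite !ltW.
  + exact: L2_cosM.
- apply: (@eq_itg _ _ (fun x => x)); last by apply: itg_cont => x; exact: cvg_id.
  by move=> x /E1 ->.
- by rewrite (eq_int E1) int_id// expr1n mul1r.
- by apply: (L2_ext _ LW) => x x01; rewrite E.
- move=> n.
  have -> : ip 0 1 (fun x => ip 0 1 w (before x)) (fun x => sin (lam n * x)) =
    ip 0 1 W (fun x => sin (lam n * x)) by apply: eq_int => x x01; rewrite E.
  rewrite /ip iterated_integral//; last by apply: itg_cont; exact: continuous_sinM.
  rewrite mulrC -intZ; last by apply: L2_mul => //; apply: L2_cont; exact: continuous_cosM.
  apply: eq_int => y /andP[y0 y1].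
  by rewrite int_sinM ?lam_neq0 ?ltW// mulr1 cos_lam subr0; field; exact: lam_neq0.
Qed.

End Tail.

(** * Test functions and one-dimensional Sobolev spaces *)

Section TestFunctions.
Variable R : realType.
Notation mu := (@lebesgue_measure R).
Implicit Types (c d x y : R) (f g h u v w : R -> R) (P : {poly R}).

Lemma is_derive_eps f (t df : R) :
  (forall eta, 0 < eta -> exists2 de, 0 < de &
    forall e, `|e| < de -> `|f (t + e) - f t - e * df| <= eta * `|e|) ->
  is_derive t 1 f df.
Proof.
move=> H.
have Hc : h^-1 *: ((f \o shift t) (h *: 1) - f t) @[h --> 0^'] --> df.
  apply/cvgrPdist_le => eps e0.
  have [de de0 Hd] := H eps e0.
  near=> h.
  have h0 : h != 0 by near: h; exact: nbhs_dnbhs_neq.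
  have hr : `|h| < de by near: h; exact: dnbhs0_lt.
  rewrite /= /GRing.scale/= mulr1 (addrC h t).
  have -> : df - h^-1 * (f (t + h) - f t) = - (h^-1 * (f (t + h) - f t - h * df)).
    by field.
  rewrite normrN normrM normfV ler_pdivrMl ?normr_gt0// [leRHS]mulrC.
  exact: Hd.
apply: DeriveDef; first by apply/cvg_ex; exists df.
exact/cvg_lim.
Unshelve. all: by end_near. Qed.

Lemma is_derive_quadratic f x (df B r : R) : 0 < r ->
  (forall e : R, `|e| < r -> `|f (x + e) - f x - e * df| <= B * e ^+ 2) ->
  is_derive x 1 f df.
Proof.
move=> r0 H; apply: is_derive_eps => eps e0.
have B0 : 0 < `|B| + 1 by rewrite ltr_wpDl.
exists (Num.min r (eps / (`|B| + 1))); first by rewrite lt_min r0 divr_gt0.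
move=> h; rewrite lt_min => /andP[hr /ltW he].
rewrite (le_trans (H h hr))// -real_normK ?num_real// expr2 mulrA ler_wpM2r//.
rewrite ler_pdivlMr// in he; apply: le_trans he; rewrite mulrC ler_wpM2l//.
by rewrite (le_trans (ler_norm B))// lerDl.
Qed.

Lemma near_cst_is_derive f x (k : R) : (\forall z \near x, f z = k) ->
  is_derive x 1 f (0 : R).
Proof.
move=> fk; have h0 : is_derive x 1 (fun=> k : R) (0 : R) by apply: is_derive_eq.
by apply: (near_eq_is_derive _ h0); apply: filterS fk => z ->.
Qed.

(** These functions form a class stable under derivation, see [dflat]. *)
Definition flat P x : R := if 0 < x then P.[x^-1] * expR (- x^-1) else 0.

Lemma poly_expR_bounded P : exists C : R, forall y, 0 <= y -> `|P.[y]| * expR (- y) <= C.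
Proof.
exists (\sum_(i < size P) `|P`_i| * i`!%:R) => y y0.
rewrite horner_coef.
rewrite (le_trans (ler_wpM2r (expR_ge0 _) (ler_norm_sum _ _ _)))// mulr_suml.
apply: ler_sum => i _; rewrite normrM -mulrA ler_wpM2l//.
rewrite ger0_norm ?exprn_ge0// expRN ler_pdivrMr ?expR_gt0//.
case: i => -[|i] _ /=.
  by rewrite expr0 fact0 mul1r (le_trans _ (expR_ge1Dx y))// lerDl.
rewrite mulrC -ler_pdivrMr ?ltr0n ?fact_gt0//.
by rewrite (le_trans _ (expR_ge1Dxn i y0))// lerDr.
Qed.

(** Chain rule with [y = 1 / x]: the derivative in [x] of [P(y) exp(-y)] is
    [y^2 (P - P')(y) exp(-y)]. *)
Definition dflat P : {poly R} := (P - P^`()) * 'X^2.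

Lemma is_derive_flat P x : is_derive x 1 (flat P) (flat (dflat P) x).
Proof.
have [x0|x0|->] := ltgtP x 0.
- rewrite /flat ltNge (ltW x0)/=.
  have h0 : is_derive x 1 (fun=> 0 : R) (0 : R) by apply: is_derive_eq.
  apply: (near_eq_is_derive _ h0).
  near=> y; rewrite /flat ltNge (_ : y <= 0)//.
  by apply/ltW; near: y; exact: lt_nbhsl.
- rewrite {2}/flat x0.
  apply: (@near_eq_is_derive _ _ _ (fun x => P.[x^-1] * expR (- x^-1))).
    near=> y; rewrite /flat (_ : 0 < y)//.
    by near: y; exact: lt_nbhsr.
  have xn0 : x != 0 by rewrite gt_eqF.
  have dV : is_derive x 1 (fun x : R => x^-1) (- (x^-1) ^+ 2).
    have := @is_deriveV R (fun x : R => x) x 1 1 xn0 (is_derive_id _ _).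
    by move=> h; apply: is_derive_eq; rewrite /GRing.scale/= mulr1 exprVn.
  have dP : is_derive x 1 (fun x : R => P.[x^-1]) (P^`().[x^-1] * - (x^-1) ^+ 2).
    have := @is_derive1_comp _ (horner P) (fun x => x^-1) x _ _ (is_derive_poly P x^-1) dV.
    by move=> h; apply: is_derive_eq; rewrite mulrC.
  have dE : is_derive x 1 (fun x : R => expR (- x^-1)) (expR (- x^-1) * (x^-1) ^+ 2).
    have dN : is_derive x 1 (fun x : R => - x^-1) ((x^-1) ^+ 2).
      by apply: is_derive_eq; rewrite opprK.
    have := @is_derive1_comp _ expR (fun x => - x^-1) x _ _ (is_derive_expR _) dN.
    by move=> h; apply: is_derive_eq; rewrite mulrC.
  apply: is_derive_eq; rewrite /GRing.scale/= /dflat hornerM hornerXn hornerD hornerN.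
  by ring.
(* At 0 the factor ['X^2] turns boundedness into a quadratic bound [C * h ^+ 2] on [flat P h],
   whence a zero derivative. *)
- have [C HC] := poly_expR_bounded (P * 'X^2).
  rewrite {2}/flat ltxx.
  apply: (@is_derive_quadratic _ _ _ C 1) => // h _.
  rewrite add0r mulr0 subr0 {2}/flat ltxx subr0 /flat; case: ifPn => h0; last first.
    have C0 : 0 <= C.
      by apply: le_trans (HC 0 (lexx _)); rewrite mulr_ge0// expR_ge0.
    by rewrite normr0 mulr_ge0// sqr_ge0.
  have := HC h^-1; rewrite invr_ge0 => /(_ (ltW h0)).
  rewrite hornerM hornerXn normrM [`|_ * expR _|]normrM (ger0_norm (expR_ge0 _)).
  have -> : `|h^-1 ^+ 2| = h ^- 2.
    by rewrite exprVn ger0_norm// invr_ge0 exprn_ge0// ltW.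
  by rewrite mulrAC ler_pdivrMr ?exprn_gt0.
Unshelve. all: by end_near. Qed.

Definition smooth f := forall n x, derivable (f^`(n))%classic x 1.

(** Smoothness by coinduction: it suffices to exhibit a class of derivable functions stable under
    derivation, with no formula for the n-th derivative. *)
Lemma smooth_class (C : (R -> R) -> Prop) :
  (forall f, C f -> (forall x, derivable f x 1) /\ C (f^`())%classic) ->
  forall f, C f -> smooth f.
Proof.
move=> H f Cf n; elim: n f Cf => [|n IH] f Cf x; first exact: (H f Cf).1.
by rewrite derive1Sn; apply: IH; exact: (H f Cf).2.
Qed.

Lemma smooth_derive1 f : smooth f -> smooth (f^`())%classic.
Proof. by move=> sf n x; rewrite -derive1Sn; exact: sf. Qed.

Lemma smooth_derivable f x : smooth f -> derivable f x 1.
Proof. by move=> sf; exact: (sf 0%N). Qed.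

Lemma smooth_primitive f g : (forall x, is_derive x 1 f (g x)) -> smooth g -> smooth f.
Proof.
move=> fg sg [|n] x; first by have [] := fg x.
rewrite derive1Sn (_ : f^`()%classic = g); first exact: sg.
by apply/funext => y; rewrite derive1E; have [_ ->] := fg y.
Qed.

Lemma smooth_flat P : smooth (flat P).
Proof.
apply: (smooth_class (C := fun f => exists P, f = flat P)); last by exists P.
move=> _ [Q ->]; split => [x|]; first by have [] := is_derive_flat Q x.
exists (dflat Q); apply/funext => x; rewrite derive1E.
by have [_ ->] := is_derive_flat Q x.
Qed.

(** Closed under sums and products, hence stable under derivation by the product rule; this replaces
    the Leibniz formula for higher derivatives. *)
Inductive smooth_algebra : (R -> R) -> Prop :=
| smooth_algebra_base f : smooth f -> smooth_algebra f
| smooth_algebra_add f g : smooth_algebra f -> smooth_algebra g ->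
    smooth_algebra (fun x => f x + g x)
| smooth_algebra_mul f g : smooth_algebra f -> smooth_algebra g ->
    smooth_algebra (fun x => f x * g x).

Lemma smooth_algebra_smooth f : smooth_algebra f -> smooth f.
Proof.
apply: smooth_class => {}f; elim=> {f} [f sf|f g Cf [df Cf'] Cg [dg Cg']|f g Cf [df Cf'] Cg [dg Cg']].
- by split => [x|]; [exact: smooth_derivable|apply: smooth_algebra_base; exact: smooth_derive1].
- split => [x|]; first exact: derivableD.
  rewrite (_ : _^`()%classic = fun x => f^`()%classic x + g^`()%classic x).
    exact: smooth_algebra_add.
  by apply/funext => x; rewrite !derive1E deriveD.
- split => [x|]; first exact: derivableM.
  rewrite (_ : _^`()%classic = fun x => f x * g^`()%classic x + g x * f^`()%classic x).
    by apply: smooth_algebra_add; exact: smooth_algebra_mul.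
  by apply/funext => x; rewrite !derive1E deriveM.
Qed.

Lemma smooth_cst (k : R) : smooth (cst k).
Proof.
apply: (smooth_class (C := fun f => exists k, f = cst k)); last by exists k.
move=> _ [l ->]; split => [x|]; first exact: derivable_cst.
by exists 0; apply/funext => x; rewrite derive1_cst.
Qed.

Lemma smoothM f g : smooth f -> smooth g -> smooth (fun x => f x * g x).
Proof.
by move=> sf sg; apply: smooth_algebra_smooth; apply: smooth_algebra_mul; exact: smooth_algebra_base.
Qed.

Lemma smoothD f g : smooth f -> smooth g -> smooth (fun x => f x + g x).
Proof.
by move=> sf sg; apply: smooth_algebra_smooth; apply: smooth_algebra_add; exact: smooth_algebra_base.
Qed.

Lemma is_derive_affine (k l x : R) : is_derive x 1 (fun x => k * x + l) k.
Proof. by apply: is_derive_eq; rewrite scaler1 addr0. Qed.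

Lemma smooth_affine f (k l : R) : smooth f -> smooth (fun x => f (k * x + l)).
Proof.
move=> sf.
(* The scalar [r] absorbs the factor [k] released by each derivation. *)
apply: (smooth_class (C := fun g => exists2 f, smooth f & exists r, g = fun x => r * f (k * x + l))).
  move=> _ [g sg [r ->]].
  have dg x : is_derive x 1 (fun x => r * g (k * x + l)) ((r * k) * g^`()%classic (k * x + l)).
    have d1 : is_derive (k * x + l) 1 g (g^`()%classic (k * x + l)).
      by rewrite derive1E; apply: derivableP; exact: smooth_derivable.
    have d2 := is_derive_affine k l x.
    have := @is_derive1_comp _ g (fun x => k * x + l) x _ _ d1 d2.
    by move=> d3; apply: is_derive_eq; rewrite /GRing.scale/=; ring.
  split => [x|]; first by have [] := dg x.
  exists (g^`())%classic; first exact: smooth_derive1.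
  by exists (r * k); apply/funext => x; rewrite derive1E; have [_ ->] := dg x.
by exists f => //; exists 1; apply/funext => x; rewrite mul1r.
Qed.

Lemma smooth_continuous f : smooth f -> continuous f.
Proof.
move=> sf x; apply: differentiable_continuous; apply/derivable1_diffP.
exact: smooth_derivable.
Qed.

(** Tends to the indicator of ]al, be[ as [n] tends to infinity. *)
Definition bumpf (al be : R) (n : R) x : R := flat 1 (n * x + - n * al) * flat 1 (- n * x + n * be).

Lemma smooth_bump al be n : smooth (bumpf al be n).
Proof. by apply: smoothM; apply: smooth_affine; exact: smooth_flat. Qed.

Lemma flat1_ge0 x : 0 <= flat 1 x.
Proof. by rewrite /flat; case: ifP => // _; rewrite hornerC mul1r expR_ge0. Qed.

Lemma flat1_le1 x : flat 1 x <= 1.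
Proof.
rewrite /flat; case: ifP => // x0; rewrite hornerC mul1r.
by rewrite -expR0 ler_expR lerNl oppr0 invr_ge0 ltW.
Qed.

Lemma bump_ge0 al be n x : 0 <= bumpf al be n x.
Proof. by rewrite mulr_ge0// flat1_ge0. Qed.

Lemma bump_le1 al be n x : bumpf al be n x <= 1.
Proof. by rewrite mulr_ile1 ?flat1_ge0 ?flat1_le1. Qed.

Lemma bump_out al be n x : 0 < n -> ~~ (al < x < be) -> bumpf al be n x = 0.
Proof.
move=> n0; rewrite negb_and -!leNgt => /orP[xa|bx]; rewrite /bumpf.
  rewrite [flat 1 (n * x + _)](_ : _ = 0) ?mul0r// /flat ltNge mulNr -mulrBr.
  by rewrite pmulr_rle0// subr_le0 xa.
rewrite [flat 1 (- n * x + _)](_ : _ = 0) ?mulr0// /flat ltNge addrC mulNr -mulrBr.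
by rewrite pmulr_rle0// subr_le0 bx.
Qed.

Lemma flat1_cvg (r : R) : 0 < r -> flat 1 (n.+1%:R * r) @[n --> \oo] --> (1 : R).
Proof.
move=> r0.
have E n : flat 1 (n.+1%:R * r) = expR (- (r^-1 * n.+1%:R^-1)).
  by rewrite /flat mulr_gt0// hornerC mul1r invfM mulrC.
under eq_fun do rewrite E.
have c : - (r^-1 / n.+1%:R) @[n --> \oo] --> (0 : R).
  rewrite -oppr0; apply: cvgN; rewrite -(mulr0 r^-1); apply: cvgM; first exact: cvg_cst.
  exact: cvg_harmonic.
have := cvg_comp _ expR c (@continuous_expR R 0).
by rewrite expR0.
Qed.

Lemma bump_cvg al be x : al < x < be -> bumpf al be n.+1%:R x @[n --> \oo] --> (1 : R).
Proof.
move=> /andP[ax xb].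
have E1 n : n.+1%:R * x + - n.+1%:R * al = n.+1%:R * (x - al) by ring.
have E2 n : - n.+1%:R * x + n.+1%:R * be = n.+1%:R * (be - x) by ring.
have xa0 : 0 < x - al by rewrite subr_gt0.
have bx0 : 0 < be - x by rewrite subr_gt0.
have -> : (fun n : nat => bumpf al be n.+1%:R x) =
    (fun n => flat 1 (n.+1%:R * (x - al)) * flat 1 (n.+1%:R * (be - x))).
  by apply/funext => n; rewrite /bumpf E1 E2.
have : (fun n : nat => flat 1 (n.+1%:R * (x - al)) * flat 1 (n.+1%:R * (be - x)))
    @ \oo --> (1 * 1 : R) by apply: cvgM; exact: flat1_cvg.
by rewrite mulr1.
Qed.

Lemma measurable_bump al be n (D : set (measurableTypeR R)) : measurable D ->
  measurable_fun D (bumpf al be n).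
Proof. by move=> mD; apply: meas_cont => //; apply: smooth_continuous; exact: smooth_bump. Qed.

Lemma bump_int_cvg c d al be h : c <= al -> al <= be -> be <= d -> itg c d h ->
  \int[mu]_(x in `]c, d[) (h x * bumpf al be n.+1%:R x) @[n --> \oo] -->
  \int[mu]_(x in `]al, be[) h x.
Proof.
move=> ca ab bd hh.
have mh := itg_meas hh.
pose q x : R := after al x * before be x.
have mq : measurable_fun `]c, d[ q.
  by apply: measurable_funM; apply: L2_meas; [exact: L2_after|exact: L2_before].
have -> : \int[mu]_(x in `]al, be[) h x = \int[mu]_(x in `]c, d[) (h x * q x).
  have iq : itg c d (fun x => h x * q x).
    apply: (itg_dom _ hh) => [|x _]; first exact: measurable_funM.
    rewrite normrM ler_piMr// /q /after /before.
    by case: (al < x); case: (x < be); rewrite ?mulr0 ?mul0r ?mulr1 ?normr0 ?normr1.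
  rewrite (int_split ca (le_trans ab bd) iq) (int_split ab bd (itg_sub ca (lexx d) iq)).
  rewrite [X in _ = X + _](_ : _ = 0) ?add0r; last first.
    transitivity (\int[mu]_(y in `]c, al[) (0 : R)); last by rewrite int_cst// mul0r.
    by apply: eq_int => y /andP[_ yx]; rewrite /q /after ltNge ltW// mul0r mulr0.
  rewrite [X in _ = _ + X](_ : _ = 0) ?addr0; last first.
    transitivity (\int[mu]_(y in `]be, d[) (0 : R)); last by rewrite int_cst// mul0r.
    by apply: eq_int => y /andP[yx _]; rewrite /q /before ltNge ltW// !mulr0.
  by apply: eq_int => y /andP[ay yb]; rewrite /q /after /before ay yb !mulr1.
have [|||||i0 _ Hc] := @dominated_convergence _ (measurableTypeR R) R mu `]c, d[%classic (measurable_oo c d)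
  (fun n x => (h x * bumpf al be n.+1%:R x)%:E) (fun x => (h x * q x)%:E)
  (fun x => `|h x|%:E).
- move=> n; apply/measurable_EFinP; apply: measurable_funM => //.
  by apply: measurable_bump; exact: measurable_oo.
- by apply/measurable_EFinP; exact: measurable_funM.
- apply: aeW => x _; apply: cvg_EFin; first exact: nearW.
  rewrite /=.
  have [xab|xab] := boolP (al < x < be).
    have : h x * bumpf al be n.+1%:R x @[n --> \oo] --> h x * (1 : R).
      by apply: cvgM; [exact: cvg_cst|exact: bump_cvg].
    by rewrite /q /after /before; case/andP : xab => -> ->; rewrite mul1r.
  have -> : h x * q x = 0.
    by rewrite /q /after /before; move: xab; case: (al < x); case: (x < be) => //= _; rewrite ?mulr0 ?mul0r ?mulr0.
  apply: (@cvg_trans _ (cst (0 : R) @ \oo)); last exact: cvg_cst.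
  by apply: near_eq_cvg; apply: nearW => n /=; rewrite bump_out// mulr0.
- exact: itg_norm.
- apply: aeW => x n _ /=; rewrite lee_fin normrM ler_piMr//.
  by rewrite ger0_norm ?bump_ge0// bump_le1.
have := Hc.
rewrite -[X in _ --> X]fineK; last by apply: integrable_fin_num => //; exact: measurable_oo.
by move/fine_cvg.
Qed.

Lemma closure_support f al be : (forall x, f x != 0 -> al <= x <= be) ->
  closure [set x | f x != 0] `<=` `[al, be].
Proof.
move=> H; apply: (@subset_trans _ (closure `[al, be]%classic)).
  by apply: closureS => x /= /H; rewrite in_itv.
rewrite -(closure_id _).1//; exact: interval_closed.
Qed.

Lemma test_function_support c d al be f : c < al -> be < d -> smooth f ->
  (forall x, f x != 0 -> al <= x <= be) -> test_function c d f.
Proof.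
move=> ca bd sf H; split => //; apply: (subset_trans (closure_support H)).
by move=> x /=; rewrite !in_itv/= => /andP[ax xb]; rewrite (lt_le_trans ca ax) (le_lt_trans xb bd).
Qed.

Lemma test_function_bump c d al be n : 0 < n -> c < al -> be < d ->
  test_function c d (bumpf al be n).
Proof.
move=> n0 ca bd; apply: (test_function_support ca bd); first exact: smooth_bump.
by move=> x; apply: contraNT => xab; rewrite bump_out//; apply: contra xab => /andP[? ?]; rewrite !ltW.
Qed.

Lemma test_function_derive1 c d f : test_function c d f -> test_function c d (f^`())%classic.
Proof.
move=> [sf cf]; split; first exact: smooth_derive1.
apply: (subset_trans _ cf).
rewrite [X in _ `<=` X](closure_id _).1; last exact: closed_closure.
apply: closureS => y /= fy0 B nB; apply: contrapT => yB.
have : \forall z \near y, f z = 0.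
  apply: filterS nB => z Bz; apply: contrapT => /eqP fz.
  by apply: yB; exists z.
move=> fz; move: fy0; rewrite derive1E.
by have [_ ->] := near_cst_is_derive fz; rewrite eqxx.
Qed.

Lemma test_function_zero c d f x : test_function c d f -> ~~ (c < x < d) -> f x = 0.
Proof.
move=> [_ cf] xcd; apply/eqP; apply/negPn/negP => fx.
by move/negP : xcd; apply; have := cf x (@subset_closure _ [set x | f x != 0] x fx); rewrite /= in_itv.
Qed.

Lemma smooth_is_derive f x : smooth f -> is_derive x 1 f (f^`()%classic x).
Proof. by move=> sf; rewrite derive1E; apply: derivableP; exact: smooth_derivable. Qed.

(** The zero mean makes the primitive vanish to the right of the support as well as to its left. *)
Lemma test_function_prim c d al be g : c < al -> be < d -> al <= be -> smooth g ->
  (forall x, ~~ (al < x < be) -> g x = 0) -> \int[mu]_(x in `]c, d[) g x = 0 ->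
  exists2 phi, test_function c d phi & (phi^`())%classic = g.
Proof.
move=> ca bd ab sg gz g0.
have cg := smooth_continuous sg.
pose phi := prim c g.
have phi0 x : x <= al -> phi x = 0.
  move=> xa; transitivity (\int[mu]_(y in `]c, x[) (0 : R)).
    by apply: eq_int => y /andP[_ yx]; rewrite gz// negb_and -!leNgt (le_trans (ltW yx) xa).
  by have [cx|xc] := leP c x; [rewrite int_cst// mul0r|rewrite int_itv0// ltW].
have phi1 x : be <= x -> phi x = 0.
  move=> bx; rewrite -g0 /phi /prim.
  have cb : c <= be by rewrite (le_trans (ltW ca)).
  have z y z : be <= y -> y <= z -> \int[mu]_(t in `]y, z[) g t = 0.
    move=> byy yz; transitivity (\int[mu]_(t in `]y, z[) (0 : R)); last by rewrite int_cst// mul0r.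
    by apply: eq_int => t /andP[yt _]; rewrite gz// negb_and -!leNgt (le_trans byy (ltW yt)) orbT.
  rewrite (int_split cb bx); last exact: itg_cont.
  rewrite (int_split cb (ltW bd)); last exact: itg_cont.
  by rewrite (z be x)// (z be d)// ltW.
have dphi x : is_derive x 1 phi (g x).
  have [xa|ax] := ltP x al.
    rewrite gz; last by rewrite negb_and -!leNgt (ltW xa).
    apply: (@near_cst_is_derive _ _ 0).
    by near=> y; rewrite phi0//; apply/ltW; near: y; exact: lt_nbhsl.
  have cx : c < x by exact: lt_le_trans ax.
  have iu : mu.-integrable `]c, x + 1] (EFin \o g).
    have iu' : mu.-integrable `[c, x + 1] (EFin \o g).
      by apply: continuous_compact_integrable; [exact: segment_compact|exact: continuous_subspaceT].
    by apply: integrableS iu' => //; exact: subset_itv_oc_cc.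
  have x1 : x < x + 1 by rewrite ltrDl.
  have bx : (BRight c < BRight x)%O by rewrite bnd_simp.
  have [D1 D2] := @continuous_FTC1 R g (BRight c) x (x + 1) x1 iu bx (cg x).
  have -> : phi = (fun y => \int[mu]_(t in [set` Interval (BRight c) (BRight y)]) g t).
    by apply/funext => y; rewrite /phi /prim -int_oc//; exact: itg_cont.
  by apply: DeriveDef; [exact: D1|rewrite -derive1E D2].
exists phi; last by apply/funext => x; rewrite derive1E; have [_ ->] := dphi x.
apply: (test_function_support ca bd); first exact: smooth_primitive dphi sg.
move=> x; apply: contraNT; rewrite negb_and -!ltNge => /orP[xa|bx]; first by rewrite phi0// ltW.
by rewrite phi1// ltW.
Unshelve. all: by end_near. Qed.

Lemma bump_int_gt0 c d al be : c <= al -> al < be -> be <= d ->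
  0 < \int[mu]_(x in `]c, d[) bumpf al be 1 x.
Proof.
move=> ca ab bd.
have cb := smooth_continuous (@smooth_bump al be 1).
(* The middle half of []al, be[]: there both factors of the bump have arguments at least a quarter
   of the length, hence a common positive lower bound. *)
pose al' := (3 * al + be) / 4; pose be' := (al + 3 * be) / 4.
have [e e0 He] : exists2 e : R, 0 < e & forall x, al' < x < be' -> e <= bumpf al be 1 x.
  pose r := (be - al) / 4.
  have r0 : 0 < r by rewrite divr_gt0 ?subr_gt0.
  exists (expR (- r^-1) * expR (- r^-1)); first by rewrite mulr_gt0 ?expR_gt0.
  move=> x /andP[ax xb].
  have h1 : r <= 1 * x + - 1 * al by rewrite /r; move: ax; rewrite /al'; lra.
  have h2 : r <= - 1 * x + 1 * be by rewrite /r; move: xb; rewrite /be'; lra.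
  have fl y : r <= y -> expR (- r^-1) <= flat 1 y.
    move=> ry; have y0 := lt_le_trans r0 ry.
    by rewrite /flat y0 hornerC mul1r ler_expR lerN2 lef_pV2 ?posrE.
  by rewrite /bumpf; apply: ler_pM; rewrite ?expR_ge0//; exact: fl.
have aa : al <= al' by rewrite /al'; lra.
have ab' : al' < be' by rewrite /al' /be'; lra.
have bb : be' <= be by rewrite /be'; lra.
have ib := itg_cont _ _ cb.
rewrite (int_split (le_trans ca aa) (ltW (lt_le_trans ab' (le_trans bb bd))) (ib _ _)).
rewrite (int_split (ltW ab') (le_trans bb bd) (ib _ _)).
rewrite ltr_wpDl//; first by apply: Rintegral_ge0 => x _; exact: bump_ge0.
rewrite ltr_pwDl//; last by apply: Rintegral_ge0 => x _; exact: bump_ge0.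
apply: (@lt_le_trans _ _ (\int[mu]_(x in `]al', be'[) e)).
  by rewrite int_cst ?ltW// mulr_gt0// subr_gt0.
by apply: le_int => //; exact: itg_cst.
Qed.

(** By Lebesgue differentiation [f] is almost everywhere the derivative of its primitive, which is
    locally constant by hypothesis. *)
Lemma ae_zero_of_intervals c d f : itg c d f ->
  (forall al be, c < al -> al < be -> be < d -> \int[mu]_(x in `]al, be[) f x = 0) ->
  {ae mu, forall x, x \in `]c, d[ -> f x = 0}.
Proof.
move=> hf H.
pose g := f \_ `]c, d[.
have ig : mu.-integrable setT (EFin \o g).
  by rewrite -restrict_EFin; apply/(integrable_mkcond _ (measurable_oo c d)).
have ig' (D : set (measurableTypeR R)) : measurable D -> mu.-integrable D (EFin \o g).
  by move=> mD; apply: integrableS ig.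
have lg : locally_integrable [set: R] g.
  exact: open_integrable_locally openT ig.
have := FTC1 (a := BRight c) (fun y => ig' _ (measurable_itv _)) lg.
apply: aeS => x + xcd.
move: (xcd); rewrite in_itv/= => /andP[cx xd].
rewrite lte_fin => /(_ cx) [_ Dx].
have gx : g x = f x by rewrite /g patch_oo cx xd.
rewrite -gx -Dx derive1E.
set G := fun z : R => \int[mu]_(t in `]c, z]) g t.
suff : \forall z \near x, G z = G x by move/near_cst_is_derive => [_ ->].
rewrite /G.
have F y z : c < y -> y < z -> z < d ->
    \int[mu]_(t in `]c, z]) g t = \int[mu]_(t in `]c, y]) g t.
  move=> cy yz zd; rewrite !int_oc; [|exact: ig' (measurable_oo _ _)..].
  rewrite (int_split (ltW cy) (ltW yz)); last exact: ig' (measurable_oo _ _).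
  rewrite [X in _ + X](_ : _ = 0) ?addr0// -(H y z cy yz zd).
  by apply: eq_int => t /andP[yt tz]; rewrite /g patch_oo (lt_trans cy yt) (lt_trans tz zd).
near=> y.
have cy : c < y by near: y; exact: lt_nbhsr.
have yd : y < d by near: y; exact: lt_nbhsl.
by have [xy|yx|->//] := ltgtP x y; [rewrite (F x y)|rewrite (F y x)].
Unshelve. all: by end_near. Qed.

(** A bump minus the right multiple of a fixed bump [rho] has zero mean, so it is the derivative of
    a test function. Hence [h - C0], with [C0] the mean of [h] weighted by [rho], is orthogonal to
    every bump supported inside, and bumps converge to indicators of intervals. *)
Lemma du_bois_reymond c d h : c < d -> itg c d h ->
  (forall phi, test_function c d phi ->
    \int[mu]_(x in `]c, d[) (h x * (phi^`())%classic x) = 0) ->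
  exists C : R, {ae mu, forall x, x \in `]c, d[ -> h x = C}.
Proof.
move=> cd hh H.
pose al0 := (2 * c + d) / 3; pose be0 := (c + 2 * d) / 3.
have ca0 : c < al0 by rewrite /al0; lra.
have ab0 : al0 < be0 by rewrite /al0 /be0; lra.
have bd0 : be0 < d by rewrite /be0; lra.
pose rho := bumpf al0 be0 1.
pose I0 := \int[mu]_(x in `]c, d[) rho x.
have I0gt : 0 < I0 by apply: bump_int_gt0 => //; exact: ltW.
have hb al be n : itg c d (fun x => h x * bumpf al be n x).
  apply: (itg_dom _ hh) => [|x _].
    by apply: measurable_funM; [exact: itg_meas|apply: measurable_bump; exact: measurable_oo].
  by rewrite normrM ler_piMr// ger0_norm ?bump_ge0// bump_le1.
have ib al be n : itg c d (bumpf al be n).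
  by apply: itg_cont; apply: smooth_continuous; exact: smooth_bump.
pose C0 := (\int[mu]_(x in `]c, d[) (h x * rho x)) / I0.
exists C0.
have ihC : itg c d (fun x => h x - C0) by apply: itgB => //; exact: itg_cst.
suff HC al be : c < al -> al < be -> be < d -> \int[mu]_(x in `]al, be[) (h x - C0) = 0.
  by apply: aeS (ae_zero_of_intervals ihC HC) => x + xcd => /(_ xcd) /eqP; rewrite subr_eq0 => /eqP.
move=> ca ab bd.
have key n : 0 < n -> \int[mu]_(x in `]c, d[) ((h x - C0) * bumpf al be n x) = 0.
  move=> n0; pose psi := bumpf al be n.
  pose k := (\int[mu]_(x in `]c, d[) psi x) / I0.
  pose g x := psi x + (- k) * rho x.
  have sg : smooth g.
    apply: smoothD; first exact: smooth_bump.
    by apply: smoothM; [exact: smooth_cst|exact: smooth_bump].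
  have g0 : \int[mu]_(x in `]c, d[) g x = 0.
    rewrite /g intD; [|exact: ib|by apply: itgZ; exact: ib].
    rewrite intZ; last exact: ib.
    by rewrite mulNr /k divfK ?subrr// gt_eqF.
  (* An interval containing the supports of both bumps. *)
  pose A := Num.min al al0; pose B := Num.max be be0.
  have [||||phi tphi phig] := @test_function_prim c d A B g _ _ _ sg _ g0.
  - by rewrite /A lt_min ca ca0.
  - by rewrite /B gt_max bd bd0.
  - by rewrite /A /B ge_min le_max (ltW ab) .
  - move=> x; rewrite /A /B negb_and -!leNgt le_min ge_max => xAB.
    rewrite /g /psi /rho !bump_out ?mulr0 ?addr0// negb_and -!leNgt.
      by case/orP : xAB => /andP[h1 h2]; rewrite ?h1 ?h2 ?orbT.
    by case/orP : xAB => /andP[h1 h2]; rewrite ?h1 ?h2 ?orbT.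
  have := H phi tphi; rewrite phig /g.
  have -> : \int[mu]_(x in `]c, d[) (h x * (psi x + - k * rho x)) =
     \int[mu]_(x in `]c, d[) (h x * psi x) + (- k) * \int[mu]_(x in `]c, d[) (h x * rho x).
    rewrite -intZ; last exact: hb.
    rewrite -intD; [|exact: hb|by apply: itgZ; exact: hb].
    by apply: eq_int => x _; ring.
  have -> : \int[mu]_(x in `]c, d[) ((h x - C0) * bumpf al be n x) =
     \int[mu]_(x in `]c, d[) (h x * psi x) + (- C0) * \int[mu]_(x in `]c, d[) psi x.
    rewrite -intZ; last exact: ib.
    rewrite -intD; [|exact: hb|by apply: itgZ; exact: ib].
    by apply: eq_int => x _; rewrite /psi; ring.
  rewrite /C0 /k => {1}<-.
  by congr (_ + _); field; rewrite gt_eqF.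
have := bump_int_cvg (ltW ca) (ltW ab) (ltW bd) ihC.
under eq_fun do rewrite key//.
by move/(cvg_lim (@Rhausdorff R)); rewrite lim_cst// => <-.
Qed.

End TestFunctions.

(** * Weak derivatives and traces on an interval *)

Section Sobolev.
Variable R : realType.
Notation mu := (@lebesgue_measure R).
Implicit Types (c d x y : R) (f g h u v w phi : R -> R).

Lemma smooth_L2 c d f : smooth f -> L2 c d f.
Proof. by move=> sf; apply: L2_cont; exact: smooth_continuous. Qed.

Lemma test_function_smooth c d phi : test_function c d phi -> smooth phi.
Proof. by case. Qed.

Lemma test_function_L2 c d c' d' phi : test_function c d phi -> L2 c' d' phi.
Proof. by move=> /test_function_smooth; exact: smooth_L2. Qed.

Lemma test_function_sub c d c' d' phi : c <= c' -> d' <= d ->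
  test_function c' d' phi -> test_function c d phi.
Proof.
move=> cc dd [sp cp]; split => //; apply: (subset_trans cp).
exact: subset_itvW.
Qed.

Lemma int_derive1 c d phi : c <= d -> smooth phi ->
  \int[mu]_(x in `]c, d[) (phi^`())%classic x = phi d - phi c.
Proof.
move=> cd sp; apply: int_FTC => //.
- by move=> x; exact: smooth_is_derive.
- by apply: smooth_continuous; exact: smooth_derive1.
Qed.

Lemma int_prim_derive1 c d g phi : c <= d -> itg c d g -> smooth phi ->
  \int[mu]_(x in `]c, d[) (prim c g x * (phi^`())%classic x) =
  phi d * prim c g d - \int[mu]_(x in `]c, d[) (g x * phi x).
Proof.
move=> cd hg sp.
have sp' : itg c d (phi^`())%classic.
  by apply: L2_itg; apply: smooth_L2; exact: smooth_derive1.
rewrite iterated_integral//.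
have ig : itg c d (fun x => g x * phi x).
  have [M HM] := cont_bounded c d (smooth_continuous sp).
  apply: (@itg_dom _ c d _ (fun x => M * g x)).
  - by apply: measurable_funM; [exact: itg_meas|apply: L2_meas; exact: smooth_L2].
  - exact: itgZ.
  - move=> x /HM h; rewrite !normrM mulrC ler_wpM2r//.
    exact: le_trans (ler_norm M).
rewrite /prim -intZ// -intB//; last exact: itgZ.
by apply: eq_int => y /andP[cy yd]; rewrite int_derive1 ?ltW//; ring.
Qed.

Lemma weak_zero c d f : itg c d f ->
  (forall phi, test_function c d phi -> \int[mu]_(x in `]c, d[) (f x * phi x) = 0) ->
  {ae mu, forall x, x \in `]c, d[ -> f x = 0}.
Proof.
move=> hf H; apply: ae_zero_of_intervals => // al be ca ab bd.
have := bump_int_cvg (ltW ca) (ltW ab) (ltW bd) hf.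
have E n : \int[mu]_(x in `]c, d[) (f x * bumpf al be n.+1%:R x) = 0.
  by apply: H; apply: test_function_bump.
under eq_fun do rewrite E.
by move/(cvg_lim (@Rhausdorff R)); rewrite lim_cst// => <-.
Qed.

Lemma wderivP c d u : H1 c d u -> L2 c d (wderiv c d u) /\ is_wderiv c d u (wderiv c d u).
Proof.
move=> [_ [g hg wg]].
exact: (@xgetPex _ (cst 0) [set g | L2 c d g /\ is_wderiv c d u g] (ex_intro _ g (conj hg wg))).
Qed.

Lemma is_wderiv_unique c d u g1 g2 : L2 c d g1 -> L2 c d g2 ->
  is_wderiv c d u g1 -> is_wderiv c d u g2 ->
  {ae mu, forall x, x \in `]c, d[ -> g1 x = g2 x}.
Proof.
move=> h1 h2 w1 w2.
have h12 := L2B h1 h2.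
suff : {ae mu, forall x, x \in `]c, d[ -> g1 x - g2 x = 0}.
  by apply: aeS => x + xcd => /(_ xcd) /eqP; rewrite subr_eq0 => /eqP.
apply: (weak_zero (L2_itg h12)) => phi tphi.
have lp := test_function_L2 c d tphi.
have := w1 phi tphi; rewrite (w2 phi tphi) => /oppr_inj E.
transitivity (\int[mu]_(x in `]c, d[) (g1 x * phi x) - \int[mu]_(x in `]c, d[) (g2 x * phi x)).
  rewrite -intB; [|exact: L2_mul|exact: L2_mul].
  by apply: eq_int => x _; rewrite mulrBl.
by rewrite E subrr.
Qed.

Lemma wderiv_ae c d u g : L2 c d u -> L2 c d g -> is_wderiv c d u g ->
  {ae mu, forall x, x \in `]c, d[ -> wderiv c d u x = g x}.
Proof.
move=> hu hg wg; have [h1 h2] : _ /\ _ := wderivP (conj hu (ex_intro2 _ _ g hg wg)).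
exact: is_wderiv_unique h2 wg.
Qed.

(** The difference between [u] and the primitive of [g] has zero weak derivative, so the du
    Bois-Reymond lemma applies. *)
Lemma H1_prim c d u g : c < d -> L2 c d u -> L2 c d g -> is_wderiv c d u g ->
  exists k : R, {ae mu, forall x, x \in `]c, d[ -> u x = k + prim c g x}.
Proof.
move=> cd hu hg wg.
have hp : L2 c d (prim c g) by apply: L2_prim => //; exact: L2_itg.
have [|k Hk] := @du_bois_reymond R c d (fun x => u x - prim c g x) cd (L2_itg (L2B hu hp)).
  move=> phi tphi; have sp := test_function_smooth tphi.
  have lp : L2 c d (phi^`())%classic by apply: smooth_L2; exact: smooth_derive1.
  transitivity (\int[mu]_(x in `]c, d[) (u x * (phi^`())%classic x) -
      \int[mu]_(x in `]c, d[) (prim c g x * (phi^`())%classic x)).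
    rewrite -intB; [|exact: L2_mul|exact: L2_mul].
    by apply: eq_int => x _; rewrite mulrBl.
  rewrite (wg phi tphi) int_prim_derive1 ?ltW//; last exact: L2_itg.
  by rewrite (test_function_zero tphi) ?ltxx ?andbF// mul0r sub0r subrr.
by exists k; apply: aeS Hk => x + xcd => /(_ xcd) <-; rewrite subrK.
Qed.

Lemma is_wderiv_sub c d c' d' u g : c <= c' -> c' <= d' -> d' <= d -> L2 c d u -> L2 c d g ->
  is_wderiv c d u g -> is_wderiv c' d' u g.
Proof.
move=> cc cd' dd hu hg wg phi tphi.
have cd : c' <= d by exact: le_trans dd.
have := wg phi (test_function_sub cc dd tphi).
have sub f psi : L2 c d f -> test_function c' d' psi ->
   \int[mu]_(x in `]c, d[) (f x * psi x) = \int[mu]_(x in `]c', d'[) (f x * psi x).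
  move=> hf tpsi.
  have hm : itg c d (fun x => f x * psi x) by apply: L2_mul => //; exact: test_function_L2 tpsi.
  rewrite (int_split cc cd hm) (int_split cd' dd (itg_sub cc (lexx d) hm)).
  rewrite [X in X + _](_ : _ = 0) ?add0r; last first.
    transitivity (\int[mu]_(y in `]c, c'[) (0 : R)); last by rewrite int_cst// mul0r.
    apply: eq_int => y /andP[_ yc]; rewrite (test_function_zero tpsi) ?mulr0//.
    by rewrite negb_and -!leNgt (ltW yc).
  rewrite [X in _ + X](_ : _ = 0) ?addr0//.
  transitivity (\int[mu]_(y in `]d', d[) (0 : R)); last by rewrite int_cst// mul0r.
  apply: eq_int => y /andP[dy _]; rewrite (test_function_zero tpsi) ?mulr0//.
  by rewrite negb_and -!leNgt (ltW dy) orbT.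
rewrite sub//; last exact: test_function_derive1.
by rewrite sub.
Qed.

Lemma is_wderiv_lin c d k u1 u2 g1 g2 : L2 c d u1 -> L2 c d u2 -> L2 c d g1 -> L2 c d g2 ->
  is_wderiv c d u1 g1 -> is_wderiv c d u2 g2 ->
  is_wderiv c d (fun x => k * u1 x + u2 x) (fun x => k * g1 x + g2 x).
Proof.
move=> hu1 hu2 hg1 hg2 w1 w2 phi tphi.
have lp := test_function_L2 c d tphi.
have lp' := test_function_L2 c d (test_function_derive1 tphi).
have -> : \int[mu]_(x in `]c, d[) ((k * u1 x + u2 x) * phi^`()%classic x) =
    ip c d (fun x => k * u1 x + u2 x) (phi^`())%classic by [].
have -> : \int[mu]_(x in `]c, d[) ((k * g1 x + g2 x) * phi x) =
    ip c d (fun x => k * g1 x + g2 x) phi by [].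
rewrite !ipDl ?ipZl//; try exact: L2Z.
by rewrite /ip (w1 phi tphi) (w2 phi tphi); ring.
Qed.

Lemma ae_exists (P : R -> Prop) c d : c < d -> {ae mu, forall x, P x} ->
  exists x, c < x < d /\ P x.
Proof.
move=> cd aeP; apply: contrapT => H.
have : mu.-negligible (`]c, d[ : set R).
  move: aeP; apply: negligibleS => x /=; rewrite in_itv/= => xcd Px.
  by apply: H; exists x.
move=> /(@negligibleP _ _ _ mu _ (measurable_oo c d)).
have := mu_oo (ltW cd) => /= -> /eqP; rewrite eqe subr_eq0 => /eqP dc.
by move: cd; rewrite dc ltxx.
Qed.

Lemma within_continuousP c d f x : {within `[c, d], continuous f} -> c <= x <= d ->
  forall e : R, 0 < e -> exists2 r : R, 0 < r & forall y, c <= y <= d -> `|x - y| < r -> `|f x - f y| < e.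
Proof.
move=> cf xcd e e0.
have /subspace_continuousP/(_ x) := cf.
move=> /(_ (xcd : (`[c, d]%classic x))) /cvgrPdist_lt /(_ e e0).
rewrite /prop_near1 /within/= => -[r /= r0 H]; exists r => // y ycd xy.
by apply: H.
Qed.

(** An interval is not negligible, so every point of [[c, d]] is a limit of points where [f] and [g]
    agree. This is what makes [trace], defined by choice, computable from any continuous
    representative. *)
Lemma ae_eq_continuous c d f g : c < d ->
  {within `[c, d], continuous f} -> {within `[c, d], continuous g} ->
  {ae mu, forall x, x \in `]c, d[ -> f x = g x} ->
  forall x, c <= x <= d -> f x = g x.
Proof.
move=> cd cf cg fg x xcd; apply/eqP; rewrite -subr_eq0 -normr_le0.
apply/ler_addgt0Pr => e e0; rewrite add0r.
have e2 : 0 < e / 2 by rewrite divr_gt0.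
have [r r0 Hr] := within_continuousP cf xcd e2.
have [s s0 Hs] := within_continuousP cg xcd e2.
pose t := Num.min r s.
have t0 : 0 < t by rewrite lt_min r0.
case/andP : (xcd) => cx xd.
have lt1 : Num.max c (x - t) < Num.min d (x + t).
  by rewrite lt_min !gt_max; apply/andP; split; apply/andP; split; lra.
have [y [/andP[]]] := ae_exists lt1 fg.
rewrite gt_max lt_min => /andP[cy yl] /andP[yd yr] fgy.
have ycd : c <= y <= d by rewrite !ltW.
have xyt : `|x - y| < t by rewrite ltr_norml; apply/andP; split; lra.
have h1 : `|f x - f y| < e / 2.
  by apply: Hr => //; apply: (lt_le_trans xyt); rewrite ge_min lexx.
have h2 : `|g x - g y| < e / 2.
  by apply: Hs => //; apply: (lt_le_trans xyt); rewrite ge_min lexx orbT.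
have fgy' : f y = g y by apply: fgy; rewrite in_itv/= cy yd.
rewrite (_ : f x - g x = (f x - f y) - (g x - g y)); last by rewrite fgy'; ring.
rewrite (le_trans (ler_normB _ _))// ltW// (splitr e).
exact: ltrD.
Qed.

Lemma trace_eq c d u F x : c < d -> {within `[c, d], continuous F} ->
  {ae mu, forall y, y \in `]c, d[ -> u y = F y} -> c <= x <= d -> trace c d u x = F x.
Proof.
move=> cd cF uF xcd; rewrite /trace.
have := @xgetPex _ (cst 0) [set g | {within `[c, d], continuous g} /\
                        {ae mu, forall y, y \in `]c, d[ -> u y = g y}] (ex_intro _ F (conj cF uF)).
set G := xget _ _ => -[cG uG].
apply: (ae_eq_continuous cd cG cF _ xcd).
by apply: aeS (aeI uF uG) => y [h1 h2] ycd; rewrite -h2// h1.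
Qed.

Lemma prim_within_continuous c d g (k : R) : c < d -> itg c d g ->
  {within `[c, d], continuous (fun x => k + prim c g x)}.
Proof.
move=> cd hg x; apply: cvgD; first exact: cvg_cst.
exact: prim_continuous.
Qed.

Lemma H1_trace c d u : c < d -> H1 c d u ->
  {ae mu, forall x, x \in `]c, d[ -> u x = trace c d u c + prim c (wderiv c d u) x} /\
  forall x, c <= x <= d -> trace c d u x = trace c d u c + prim c (wderiv c d u) x.
Proof.
move=> cd hu; have [hg wg] := wderivP hu.
have [k Hk] := H1_prim cd hu.1 hg wg.
have ig := L2_itg hg.
have T x : c <= x <= d -> trace c d u x = k + prim c (wderiv c d u) x.
  exact: (trace_eq cd (prim_within_continuous (k := k) cd ig) Hk).
have Tc : trace c d u c = k by rewrite T ?lexx ?ltW// /prim int_itv0// addr0.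
by rewrite Tc.
Qed.

Lemma L2_lin c d k u v : L2 c d u -> L2 c d v -> L2 c d (fun x => k * u x + v x).
Proof. by move=> hu hv; apply: L2D => //; exact: L2Z. Qed.

Lemma H1_lin c d k u v : H1 c d u -> H1 c d v -> H1 c d (fun x => k * u x + v x).
Proof.
move=> hu hv; have [hg wg] := wderivP hu; have [hg' wg'] := wderivP hv.
case: hu => hu _; case: hv => hv _.
split; first exact: L2_lin.
by exists (fun x => k * wderiv c d u x + wderiv c d v x); [exact: L2_lin|exact: is_wderiv_lin].
Qed.

Lemma wderiv_lin c d k u v : H1 c d u -> H1 c d v ->
  {ae mu, forall x, x \in `]c, d[ ->
    wderiv c d (fun x => k * u x + v x) x = k * wderiv c d u x + wderiv c d v x}.
Proof.
move=> hu hv; have [hg wg] := wderivP hu; have [hg' wg'] := wderivP hv.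
case: hu => hu _; case: hv => hv _.
by apply: wderiv_ae; [exact: L2_lin|exact: L2_lin|exact: is_wderiv_lin].
Qed.

Lemma wderiv_ae_eq c d u v : L2 c d u -> H1 c d v ->
  {ae mu, forall x, x \in `]c, d[ -> u x = v x} ->
  {ae mu, forall x, x \in `]c, d[ -> wderiv c d u x = wderiv c d v x}.
Proof.
move=> hu hv uv; have [hg wg] := wderivP hv.
apply: wderiv_ae => // phi tphi.
rewrite -(wg phi tphi); apply: ae_int.
- by apply: L2_mul => //; exact: test_function_L2 (test_function_derive1 tphi).
- by apply: measurable_funM; apply: L2_meas; [exact: hv.1|exact: test_function_L2 (test_function_derive1 tphi)].
- by apply: aeS uv => x + xcd => /(_ xcd) ->.
Qed.

End Sobolev.

(** * The generator and the dissipation law *)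

Section States.
Variable R : realType.
Notation mu := (@lebesgue_measure R).
Implicit Types (c d x y a : R) (f g h u v w phi : R -> R) (U W Z : state R).

Definition ip2 g1 g2 h1 h2 : R := ip 0 1 g1 h1 + ip 0 1 g2 h2.

Lemma ip2C g1 g2 h1 h2 : ip2 g1 g2 h1 h2 = ip2 h1 h2 g1 g2.
Proof. by rewrite /ip2 ipC (ipC _ _ g2). Qed.

Lemma ip2_ge0 g1 g2 : 0 <= ip2 g1 g2 g1 g2.
Proof. by rewrite addr_ge0 ?ip_ge0. Qed.

Lemma ip_lin c d k u v w : L2 c d u -> L2 c d v -> L2 c d w ->
  ip c d (fun x => k * u x + v x) w = k * ip c d u w + ip c d v w.
Proof. by move=> hu hv hw; rewrite ipDl ?ipZl//; exact: L2Z. Qed.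

Lemma ip2_lin k g1 g2 h1 h2 f1 f2 : L2 0 1 g1 -> L2 0 1 g2 -> L2 0 1 h1 -> L2 0 1 h2 ->
  L2 0 1 f1 -> L2 0 1 f2 ->
  ip2 (fun x => k * g1 x + h1 x) (fun x => k * g2 x + h2 x) f1 f2 =
  k * ip2 g1 g2 f1 f2 + ip2 h1 h2 f1 f2.
Proof. by move=> *; rewrite /ip2 !ip_lin//; ring. Qed.

Lemma ip2_CS g1 g2 h1 h2 : L2 0 1 g1 -> L2 0 1 g2 -> L2 0 1 h1 -> L2 0 1 h2 ->
  ip2 g1 g2 h1 h2 ^+ 2 <= ip2 g1 g2 g1 g2 * ip2 h1 h2 h1 h2.
Proof.
move=> lg1 lg2 lh1 lh2; apply: psd_CS; [exact: ip2_ge0|exact: ip2_ge0|] => k l.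
have lh1' := L2Z l lh1; have lh2' := L2Z l lh2.
have := ip2_ge0 (fun x => k * g1 x + l * h1 x) (fun x => k * g2 x + l * h2 x).
have s1 := L2_lin k lg1 lh1'; have s2 := L2_lin k lg2 lh2'.
rewrite (@ip2_lin k g1 g2 (fun x => l * h1 x) (fun x => l * h2 x))//.
rewrite ![ip2 _ _ (fun x => k * g1 x + l * h1 x) _]ip2C.
rewrite !(@ip2_lin k g1 g2 (fun x => l * h1 x) (fun x => l * h2 x))//.
have z f1 f2 : L2 0 1 f1 -> L2 0 1 f2 -> ip2 (fun x => l * h1 x) (fun x => l * h2 x) f1 f2 = l * ip2 h1 h2 f1 f2.
  by move=> lf1 lf2; rewrite /ip2 !ipZl// mulrDr.
rewrite [ip2 g1 g2 (fun x => l * h1 x) _]ip2C !z// [ip2 h1 h2 (fun x => l * h1 x) _]ip2C z//.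
by rewrite (ip2C h1 h2 g1 g2) => h; nra.
Qed.

Definition der U := wderiv 0 1 U.1.

(** [X2] without the condition at 0: the inner product only involves [der U] and [U.2], so the
    algebra of [ipX] holds at this level. *)
Definition HX U := H1 0 1 U.1 /\ L2 0 1 U.2.

Definition ipX U W := ip2 (der U) U.2 (der W) W.2.

Lemma der_L2 U : HX U -> L2 0 1 (der U).
Proof. by move=> [/wderivP[]]. Qed.

Lemma X2_HX U : X2 U -> HX U.
Proof. by move=> [[h _] h']. Qed.

Lemma state_lin k U W : k *: U + W =
  ((fun x => k * U.1 x + W.1 x), (fun x => k * U.2 x + W.2 x)) :> state R.
Proof. by []. Qed.

Lemma HX_lin k U W : HX U -> HX W -> HX (k *: U + W).
Proof.
move=> [hU hU'] [hW hW']; rewrite state_lin; split => /=; first exact: H1_lin.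
exact: L2_lin.
Qed.

(** [wderiv] is a chosen representative, linear only almost everywhere; pairing it with a square
    integrable function restores exact linearity. *)
Lemma ipX_lin k U W g1 g2 : HX U -> HX W -> L2 0 1 g1 -> L2 0 1 g2 ->
  ip2 (der (k *: U + W)) (k *: U + W).2 g1 g2 =
  k * ip2 (der U) U.2 g1 g2 + ip2 (der W) W.2 g1 g2.
Proof.
move=> hU hW l1 l2; have lU := der_L2 hU; have lW := der_L2 hW.
have hs := HX_lin k hU hW.
have lS := der_L2 hs.
case: hU => hU hU'; case: hW => hW hW'.
rewrite -ip2_lin//; congr (_ + _).
apply: ip_ae => //; try exact: L2_meas.
- by apply: L2_meas; exact: L2_lin.
- exact: wderiv_lin.
- exact: aeW.
Qed.

Lemma ipXl k U W Z : HX U -> HX W -> HX Z ->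
  ipX (k *: U + W) Z = k * ipX U Z + ipX W Z.
Proof. by move=> hU hW hZ; rewrite /ipX ipX_lin//; [exact: der_L2|case: hZ]. Qed.

Lemma ipXC U W : ipX U W = ipX W U. Proof. exact: ip2C. Qed.

Lemma ipX_ge0 U : 0 <= ipX U U. Proof. exact: ip2_ge0. Qed.

Lemma ipX_CS U W : HX U -> HX W -> ipX U W ^+ 2 <= ipX U U * ipX W W.
Proof. by move=> hU hW; apply: ip2_CS; [exact: der_L2|case: hU|exact: der_L2|case: hW]. Qed.

Lemma normX2_sq U : HX U -> normX2 U ^+ 2 = ipX U U.
Proof.
move=> hU; rewrite /normX2 sqr_sqrtr ?addr_ge0 ?sqr_ge0// /normV2.
by rewrite !normL2_ip//; [case: hU|exact: der_L2].
Qed.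

Lemma normX2_ge0 U : 0 <= normX2 U.
Proof. exact: sqrtr_ge0. Qed.

Lemma normX2_triangle k U W : HX U -> HX W ->
  normX2 (k *: U + W) <= `|k| * normX2 U + normX2 W.
Proof.
move=> hU hW; have hs := HX_lin k hU hW.
rewrite -(@ler_pXn2r _ 2)// ?nnegrE ?addr_ge0 ?mulr_ge0 ?normX2_ge0//.
rewrite normX2_sq// ipXl// ![ipX _ (k *: U + W)]ipXC !ipXl// (ipXC W U).
rewrite sqrrD exprMn real_normK ?num_real// !normX2_sq//.
have h : k * ipX U W <= `|k| * normX2 U * normX2 W.
  rewrite (le_trans (ler_norm _))// normrM -mulrA ler_wpM2l//.
  rewrite -(@ler_pXn2r _ 2)// ?nnegrE ?mulr_ge0 ?normX2_ge0//.
  by rewrite exprMn !normX2_sq// real_normK ?num_real// ipX_CS.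
by rewrite mulr2n; lra.
Qed.

Lemma int_test_prim c d w phi : c <= d -> L2 c d w -> test_function c d phi ->
  \int[mu]_(x in `]c, d[) (prim c w x * (phi^`())%classic x) =
  - \int[mu]_(x in `]c, d[) (w x * phi x).
Proof.
move=> cd hw tphi; rewrite int_prim_derive1//; [|exact: L2_itg|exact: test_function_smooth tphi].
by rewrite (test_function_zero tphi) ?ltxx ?andbF// mul0r sub0r.
Qed.

Lemma ip_test_second u phi : H1 0 1 u -> test_function 0 1 phi ->
  \int[mu]_(x in `]0, 1[) (u x * (phi^`(2))%classic x) =
  - ip 0 1 (wderiv 0 1 u) (phi^`())%classic.
Proof. by move=> /wderivP[_ wg] tphi; exact: (wg _ (test_function_derive1 tphi)). Qed.

(** The weak form of [u_xx = w + f delta_a] says that [u_x - prim 0 w - f * after a] is orthogonal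
    to all derivatives of test functions, hence constant. *)
Lemma graph_structure a U W : 0 < a -> a < 1 -> graph_A2 a U W ->
  let f := trace 0 1 U.2 a in
  [/\ f = prim 0 (wderiv 0 1 U.2) a,
      {ae mu, forall x, x \in `]0, 1[ -> U.2 x = prim 0 (wderiv 0 1 U.2) x} &
      {ae mu, forall x, x \in `]0, 1[ ->
        der U x = - coprim 1 W.2 x - f * (1 - after a x)}].
Proof.
move=> a0 a1 [[[[hu _] _ _ tr1 [hv tr0]] _] _ lw HD]; set f := trace 0 1 U.2 a => /=.
have [ae_v tr_v] := H1_trace (@ltr01 R) hv.
have a01 : 0 <= a <= 1 by rewrite !ltW.
split.
- by rewrite /f tr_v// tr0 add0r.
- by apply: aeS ae_v => x + xcd => /(_ xcd) ->; rewrite tr0 add0r.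
have [lG wG] := wderivP hu.
have lpw : L2 0 1 (prim 0 W.2) by apply: L2_prim => //; exact: L2_itg.
have la := L2_after 0 1 a.
have lfa : L2 0 1 (fun x => f * after a x) by exact: L2Z.
have lS : L2 0 1 (fun x => der U x - (prim 0 W.2 x + f * after a x)).
  by apply: L2B => //; exact: L2D.
have [|k Hk] := du_bois_reymond (@ltr01 R) (L2_itg lS).
  move=> phi tphi.
  have lp' := test_function_L2 0 1 (test_function_derive1 tphi).
  have E1 := HD phi tphi; rewrite ip_test_second// in E1.
  have E2 : ip 0 1 (after a) (phi^`())%classic = - phi a.
    rewrite ipC ip_after//= int_derive1 ?ltW//; last exact: test_function_smooth tphi.
    by rewrite (test_function_zero tphi) ?ltxx ?andbF// sub0r.
  have E3 := int_test_prim ler01 lw tphi.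
  rewrite -[LHS]/(ip 0 1 (fun x => der U x - (prim 0 W.2 x + f * after a x)) (phi^`())%classic).
  rewrite (_ : (fun x => der U x - (prim 0 W.2 x + f * after a x)) =
     (fun x => der U x + (-1) * (prim 0 W.2 x + f * after a x))); last first.
    by apply/funext => x; rewrite mulN1r.
  rewrite ipDl//; [|by apply: L2Z; exact: L2D].
  rewrite ipZl//; last exact: L2D.
  rewrite ipDl// ipZl// E2 {1}/ip -/(der U).
  have -> : ip 0 1 (prim 0 W.2) (phi^`())%classic = - \int[mu]_(x in `]0, 1[) (W.2 x * phi x) by [].
  by rewrite -E1 /ip -/(der U) -/f; ring.
have aeG : {ae mu, forall x, x \in `]0, 1[ -> der U x = k + prim 0 W.2 x + f * after a x}.
  by apply: aeS Hk => x + xcd => /(_ xcd) <-; ring.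
have lw1 : L2 a 1 W.2 by apply: L2_sub lw => //; exact: ltW.
have iw1 := L2_itg lw1.
have lu1 : L2 a 1 U.1 by apply: L2_sub hu.1 => //; exact: ltW.
have lG1 : L2 a 1 (der U) by apply: L2_sub lG => //; exact: ltW.
have wG1 : is_wderiv a 1 U.1 (der U).
  by apply: is_wderiv_sub wG => //; [exact: ltW|exact: ltW|exact: hu.1].
have aeG1 := wderiv_ae lu1 lG1 wG1.
have E x : a <= x <= 1 -> prim 0 W.2 x = prim 0 W.2 a + prim a W.2 x.
  move=> /andP[ax x1]; rewrite /prim (int_split (ltW a0) ax)//.
  by apply: itg_sub (L2_itg lw).
have ae1 : {ae mu, forall x, x \in `]a, 1[ ->
    wderiv a 1 U.1 x = (k + prim 0 W.2 a + f) + prim a W.2 x}.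
  apply: aeS (aeI aeG aeG1) => x [h1 h2] xcd; rewrite h2//.
  move: (xcd); rewrite in_itv/= => /andP[ax x1].
  have x01 : x \in `]0, 1[ by rewrite in_itv/= (lt_trans a0 ax).
  have axx : a <= x <= 1 by rewrite !ltW.
  by rewrite (h1 x01) (E x axx) /after ax mulr1; ring.
have := trace_eq a1 (prim_within_continuous (k := k + prim 0 W.2 a + f) a1 iw1) ae1.
move=> /(_ 1); rewrite lexx ltW// => /(_ isT); rewrite tr1 => E1.
(* At 1 the trace of [u_x] is [k + prim 0 W.2 1 + f], and the Neumann condition makes it 0. *)
have kE : k = - prim 0 W.2 1 - f.
  by rewrite (E 1) ?lexx ?ltW//; move: E1; lra.
apply: aeS aeG => x + xcd => /(_ xcd) ->.
move: xcd; rewrite in_itv/= => /andP[x0 x1].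
have -> : coprim 1 W.2 x = prim 0 W.2 1 - prim 0 W.2 x.
  by rewrite /coprim (@int_coprim _ 0) ?ltW//; exact: L2_itg.
by rewrite kE; ring.
Qed.

Definition gluef a g1 g2 x : R := if x < a then g1 x else g2 x.

Lemma itg_glue a g1 g2 : 0 < a -> a < 1 -> itg 0 a g1 -> itg a 1 g2 -> itg 0 1 (gluef a g1 g2).
Proof.
move=> a0 a1 h1 h2.
have e1 : itg 0 a (gluef a g1 g2) by apply: eq_itg h1 => x /andP[_ xa]; rewrite /gluef xa.
have e2 : itg a 1 (gluef a g1 g2).
  by apply: eq_itg h2 => x /andP[ax _]; rewrite /gluef ltNge (ltW ax).
(* [gluef] takes the right branch at [a], so the pieces partitioning the interval are []0, a[] and
   [[a, 1[]. *)
have e3 : mu.-integrable `[a, 1[ (EFin \o gluef a g1 g2).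
  move/integrableP : (e2) => [m1 i1]; apply/integrableP; split.
    exact/emeasurable_fun_itv_obnd_cbndP.
  rewrite -integral_itv_obnd_cbnd//; exact: measurableT_comp.
have mco : measurable (`[a, 1[%classic : set (measurableTypeR R)) := measurable_itv _.
have i1 := (integrable_mkcond _ (measurable_oo 0 a)).1 e1.
have i2 := (integrable_mkcond _ mco).1 e3.
have : mu.-integrable setT ((EFin \o gluef a g1 g2) \_ `]0, 1[).
  apply: eq_integrable (integrableD measurableT i1 i2) => // x _.
  rewrite /= !patchE !mem_setE !in_itv/=.
  have [xa|ax] := ltP x a; first by rewrite (lt_trans xa a1) !andbT/=; case: ifP => // _; rewrite ?adde0.
  by rewrite (lt_le_trans a0 ax)/=; case: ifP => // _; rewrite ?add0e.
by move/(integrable_mkcond _ (measurable_oo 0 1)).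
Qed.

Lemma L2_glue a g1 g2 : 0 < a -> a < 1 -> L2 0 a g1 -> L2 a 1 g2 -> L2 0 1 (gluef a g1 g2).
Proof.
move=> a0 a1 h1 h2; apply/L2P; split.
  exact: itg_meas (itg_glue a0 a1 (L2_itg h1) (L2_itg h2)).
have := itg_glue a0 a1 (L2_sq h1) (L2_sq h2).
by apply: eq_itg => x _; rewrite /gluef; case: ifP.
Qed.

Lemma ip_glue a g1 g2 h : 0 < a -> a < 1 -> L2 0 a g1 -> L2 a 1 g2 -> L2 0 1 h ->
  ip 0 1 (gluef a g1 g2) h = ip 0 a g1 h + ip a 1 g2 h.
Proof.
move=> a0 a1 h1 h2 hh.
rewrite /ip (int_split (ltW a0) (ltW a1)); last by apply: L2_mul => //; exact: L2_glue.
congr (_ + _); apply: eq_int => x /andP[xl xr]; rewrite /gluef.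
  by rewrite xr.
by rewrite ltNge (ltW xl).
Qed.

Lemma ip_flux c d u phi : c < d -> H2 c d u -> smooth phi ->
  ip c d (wderiv c d u) (phi^`())%classic =
  trace c d (wderiv c d u) d * phi d - trace c d (wderiv c d u) c * phi c -
  ip c d (wderiv c d (wderiv c d u)) phi.
Proof.
move=> cd h2 sp; have [h1 hg] := h2.
have [lG _] := wderivP h1; have [lg _] := wderivP hg.
have lp : L2 c d (phi^`())%classic by apply: smooth_L2; exact: smooth_derive1.
have [aeG trG] := H1_trace cd hg.
set g := wderiv c d (wderiv c d u) in lg aeG trG *; set k := trace _ _ _ c in aeG trG *.
have lpg : L2 c d (prim c g) by apply: L2_prim => //; exact: L2_itg.
have ls : L2 c d (fun x => k + prim c g x) by apply: L2D => //; exact: L2_cst.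
rewrite (ip_ae lG lp (L2_meas ls) (L2_meas lp) aeG); last exact: aeW.
rewrite ipDl//; last exact: L2_cst.
rewrite {1}/ip intZ; last exact: L2_itg.
rewrite int_derive1 ?ltW// {1}/ip int_prim_derive1 ?ltW//; last exact: L2_itg.
by rewrite (trG d) ?lexx ?ltW// /ip; ring.
Qed.

Lemma int_ae_sub c d c' d' (P : R -> Prop) : c <= c' -> d' <= d ->
  {ae mu, forall x, x \in `]c, d[ -> P x} -> {ae mu, forall x, x \in `]c', d'[ -> P x}.
Proof.
move=> cc dd; apply: aeS => x + xcd; apply.
by move: xcd; rewrite !in_itv/= => /andP[cx xd]; rewrite (le_lt_trans cc cx) (lt_le_trans xd dd).
Qed.

Lemma ip_split c d x u v : c <= x -> x <= d -> L2 c d u -> L2 c d v ->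
  ip c d u v = ip c x u v + ip x d u v.
Proof. by move=> cx xd hu hv; apply: int_split => //; exact: L2_mul. Qed.

Lemma wderiv_restrict c d c' d' u : c <= c' -> c' <= d' -> d' <= d -> H1 c d u ->
  {ae mu, forall x, x \in `]c', d'[ -> wderiv c' d' u x = wderiv c d u x}.
Proof.
move=> cc cd dd hu; have [lG wG] := wderivP hu.
apply: wderiv_ae; [exact: L2_sub hu.1|exact: L2_sub lG|].
exact: is_wderiv_sub hu.1 lG wG.
Qed.

Lemma ip_ae1 c d u u' v : L2 c d u -> L2 c d u' -> L2 c d v ->
  {ae mu, forall x, x \in `]c, d[ -> u x = u' x} -> ip c d u v = ip c d u' v.
Proof.
move=> hu hu' hv uu.
by apply: (ip_ae hu hv (L2_meas hu') (L2_meas hv) uu); exact: aeW.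
Qed.

Lemma ip_der_split a u h : 0 < a -> a < 1 -> H1 0 1 u -> H1 0 a u -> H1 a 1 u -> L2 0 1 h ->
  ip 0 1 (wderiv 0 1 u) h = ip 0 a (wderiv 0 a u) h + ip a 1 (wderiv a 1 u) h.
Proof.
move=> a0 a1 hu h1 h2 lh; have [lG _] := wderivP hu.
have [lG1 _] := wderivP h1; have [lG2 _] := wderivP h2.
rewrite (ip_split (ltW a0) (ltW a1) lG lh).
have r1 := wderiv_restrict (lexx 0) (ltW a0) (ltW a1) hu.
have r2 := wderiv_restrict (ltW a0) (ltW a1) (lexx 1) hu.
rewrite (ip_ae1 lG1 (L2_sub (lexx 0) (ltW a1) lG) (L2_sub (lexx 0) (ltW a1) lh) r1).
by rewrite (ip_ae1 lG2 (L2_sub (ltW a0) (lexx 1) lG) (L2_sub (ltW a0) (lexx 1) lh) r2).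
Qed.

(** This is [u_xx] away from [a]. It is the second component of the generator because the jump of
    [u_x] prescribed in [DA2] cancels [v(a) delta_a]. *)
Definition flux_derivative a U :=
  gluef a (wderiv 0 a (wderiv 0 a U.1)) (wderiv a 1 (wderiv a 1 U.1)).

Lemma graph_exists a U : 0 < a -> a < 1 -> DA2 a U ->
  X2 (U.2, flux_derivative a U) /\ graph_A2 a U (U.2, flux_derivative a U).
Proof.
move=> a0 a1 hD; have [[[hu tru0] h2l h2r tr1 hv] jump] := hD.
have [lg1 _] := wderivP h2l.2; have [lg2 _] := wderivP h2r.2.
have lw : L2 0 1 (flux_derivative a U) by exact: L2_glue.
split; first by split.
split => //=; first exact: aeW.
move=> phi tphi; rewrite ip_test_second//.
have sp := test_function_smooth tphi.
have lp : L2 0 1 phi by exact: smooth_L2.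
have lp' : L2 0 1 (phi^`())%classic by apply: smooth_L2; exact: smooth_derive1.
rewrite (ip_der_split a0 a1 hu h2l.1 h2r.1 lp') !ip_flux//.
have -> : \int[mu]_(x in `]0, 1[) (flux_derivative a U x * phi x) =
  ip 0 a (wderiv 0 a (wderiv 0 a U.1)) phi + ip a 1 (wderiv a 1 (wderiv a 1 U.1)) phi.
  by rewrite -ip_glue.
have p0 : phi 0 = 0 by apply: (test_function_zero tphi); rewrite ltxx.
rewrite -jump tr1 p0.
by move: (trace a 1 _ a) (trace 0 a _ a) (trace 0 a _ 0) (ip 0 a _ _) (ip a 1 _ _) => *; ring.
Qed.

Lemma normDA2_bounds a U : 0 < a -> a < 1 -> DA2 a U ->
  normX2 (U.2, flux_derivative a U) <= normDA2 a U /\ normX2 U <= normDA2 a U.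
Proof.
move=> a0 a1 hD; have [[[hu tru0] h2l h2r tr1 [hv _]] jump] := hD.
have [XW _] := graph_exists a0 a1 hD.
have [lG1 _] := wderivP h2l.1; have [lG2 _] := wderivP h2r.1.
have [lg1 _] := wderivP h2l.2; have [lg2 _] := wderivP h2r.2.
have [lG _] := wderivP hu; have [lp _] := wderivP hv.
have D2 : normDA2 a U ^+ 2 = (normL2 0 a U.1 ^+ 2 + normL2 0 a (wderiv 0 a U.1) ^+ 2
            + normL2 0 a (wderiv 0 a (wderiv 0 a U.1)) ^+ 2) +
   (normL2 a 1 U.1 ^+ 2 + normL2 a 1 (wderiv a 1 U.1) ^+ 2
            + normL2 a 1 (wderiv a 1 (wderiv a 1 U.1)) ^+ 2) +
   (normL2 0 1 U.2 ^+ 2 + normL2 0 1 (wderiv 0 1 U.2) ^+ 2).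
  by rewrite /normDA2 /normH1 /normH2 !sqr_sqrtr ?addr_ge0 ?sqr_ge0.
have D0 : 0 <= normDA2 a U by exact: sqrtr_ge0.
split; rewrite -(@ler_pXn2r _ 2)// ?nnegrE ?normX2_ge0// D2 /normX2 sqr_sqrtr ?addr_ge0 ?sqr_ge0//=.
  have -> : normL2 0 1 (flux_derivative a U) ^+ 2 =
     normL2 0 a (wderiv 0 a (wderiv 0 a U.1)) ^+ 2 + normL2 a 1 (wderiv a 1 (wderiv a 1 U.1)) ^+ 2.
    have lw : L2 0 1 (flux_derivative a U) by exact: L2_glue.
    rewrite !normL2_ip// ip_glue//; congr (_ + _); rewrite ipC; apply: eq_int => x /andP[xl xr].
      by rewrite /flux_derivative /gluef xr.
    by rewrite /flux_derivative /gluef ltNge (ltW xl).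
  rewrite /normV2 /=.
  by have := (sqr_ge0 (normL2 0 a U.1), sqr_ge0 (normL2 0 a (wderiv 0 a U.1)),
    sqr_ge0 (normL2 a 1 U.1), sqr_ge0 (normL2 a 1 (wderiv a 1 U.1)), sqr_ge0 (normL2 0 1 U.2)) => -[[[[? ?] ?] ?] ?]; lra.
have -> : normV2 U.1 ^+ 2 = normL2 0 a (wderiv 0 a U.1) ^+ 2 + normL2 a 1 (wderiv a 1 U.1) ^+ 2.
  rewrite /normV2 (normL2_ip lG) (normL2_ip lG1) (normL2_ip lG2).
  rewrite (ip_der_split a0 a1 hu h2l.1 h2r.1 lG).
  have r1 := wderiv_restrict (lexx 0) (ltW a0) (ltW a1) hu.
  have r2 := wderiv_restrict (ltW a0) (ltW a1) (lexx 1) hu.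
  rewrite [ip 0 a _ (wderiv 0 1 _)]ipC [ip a 1 _ (wderiv 0 1 _)]ipC.
  rewrite -(ip_ae1 lG1 (L2_sub (lexx 0) (ltW a1) lG) lG1 r1).
  by rewrite -(ip_ae1 lG2 (L2_sub (ltW a0) (lexx 1) lG) lG2 r2).
by have := (sqr_ge0 (normL2 0 a U.1), sqr_ge0 (normL2 0 a (wderiv 0 a (wderiv 0 a U.1))),
    sqr_ge0 (normL2 a 1 U.1), sqr_ge0 (normL2 a 1 (wderiv a 1 (wderiv a 1 U.1))), sqr_ge0 (normL2 0 1 (wderiv 0 1 U.2))) => -[[[[? ?] ?] ?] ?]; lra.
Qed.

End States.

(** * Differentiability of trajectories in the seminorm *)

Section Trajectories.
Variable R : realType.
Notation mu := (@lebesgue_measure R).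
Implicit Types (c d x y a t s e : R) (f g u v w phi : R -> R) (U W Z A B C : state R).

Lemma V2_lin k u v : V2 u -> V2 v -> V2 (fun x => k * u x + v x).
Proof.
move=> [hu tu] [hv tv]; split; first exact: H1_lin.
have [au _] := H1_trace (@ltr01 R) hu; have [av _] := H1_trace (@ltr01 R) hv.
have [lu _] := wderivP hu; have [lv _] := wderivP hv.
set p := fun x => k * wderiv 0 1 u x + wderiv 0 1 v x.
have ip_ : itg 0 1 p by apply: L2_itg; exact: L2_lin.
rewrite (@trace_eq _ 0 1 _ (fun x => 0 + prim 0 p x))//.
- by rewrite /prim int_itv0// addr0.
- exact: prim_within_continuous.
- apply: aeS (aeI au av) => x [h1 h2] x01.
  have h1' : u x = prim 0 (wderiv 0 1 u) x by rewrite (h1 x01) tu add0r.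
  have h2' : v x = prim 0 (wderiv 0 1 v) x.
    clear h1'; rewrite (h2 x01) tv add0r; reflexivity.
  rewrite h1' h2' [RHS]add0r.
  move: x01; rewrite in_itv/= => /andP[x0 x1].
  have lux : itg 0 x (wderiv 0 1 u) := itg_sub (lexx 0) (ltW x1) (L2_itg lu).
  have lvx : itg 0 x (wderiv 0 1 v) := itg_sub (lexx 0) (ltW x1) (L2_itg lv).
  by rewrite /prim /p (intD (itgZ k lux) lvx) (intZ k lux).
- by rewrite lexx ler01.
Qed.

Lemma X2_lin k U W : X2 U -> X2 W -> X2 (k *: U + W).
Proof.
move=> [hU hU'] [hW hW']; rewrite state_lin; split => /=; first exact: V2_lin.
exact: L2_lin.
Qed.

Lemma stateB U W : U - W = (-1) *: W + U :> state R.
Proof. by rewrite scaleN1r addrC. Qed.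

Lemma HX_B U W : HX U -> HX W -> HX (U - W).
Proof. by move=> hU hW; rewrite stateB; exact: HX_lin. Qed.

Lemma X2_B U W : X2 U -> X2 W -> X2 (U - W).
Proof. by move=> hU hW; rewrite stateB; exact: X2_lin. Qed.

Lemma normX2D U W : HX U -> HX W -> normX2 (U + W) <= normX2 U + normX2 W.
Proof.
by move=> hU hW; have := normX2_triangle 1 hU hW; rewrite scale1r normr1 mul1r.
Qed.

Lemma HX_Z k U : HX U -> HX (k *: U).
Proof. by move=> hU; have := HX_lin (k - 1) hU hU; rewrite -{2}(scale1r U) -scalerDl subrK. Qed.

Lemma normX2Z k U : HX U -> normX2 (k *: U) = `|k| * normX2 U.
Proof.
move=> hU; have hk := HX_Z k hU.
have E : k *: U = (k - 1) *: U + U by rewrite -{3}(scale1r U) -scalerDl subrK.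
apply/eqP; rewrite -(@eqrXn2 _ 2)// ?normX2_ge0 ?mulr_ge0 ?normX2_ge0//; apply/eqP.
rewrite exprMn real_normK ?num_real// !normX2_sq//.
rewrite {1}E ipXl// ipXC E ipXl//; ring.
Qed.

Lemma normX2N U : HX U -> normX2 (- U) = normX2 U.
Proof. by move=> hU; rewrite -scaleN1r normX2Z// normrN1 mul1r. Qed.

Lemma normX2BC U W : HX U -> HX W -> normX2 (U - W) = normX2 (W - U).
Proof. by move=> hU hW; rewrite -opprB normX2N//; exact: HX_B. Qed.

Lemma normX2_dist A B C : HX A -> HX B -> HX C ->
  normX2 (A - C) <= normX2 (A - B) + normX2 (B - C).
Proof.
move=> hA hB hC; rewrite (_ : A - C = (A - B) + (B - C)); last by rewrite addrA subrK.
by apply: normX2D; exact: HX_B.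
Qed.

Variables (a : R) (S : R -> state R -> state R).
Hypothesis sgS : contraction_semigroup (@X2 R) (@normX2 R) S.
Hypothesis genS : generated_by (@X2 R) (@normX2 R) (graph_A2 a) S.

Lemma semigroup_B t U W : 0 <= t -> X2 U -> X2 W ->
  normX2 (S t (U - W) - (S t U - S t W)) = 0.
Proof. by move=> t0 hU hW; rewrite !stateB; have := semigroup_linear sgS (-1) t0 hW hU; rewrite !stateB. Qed.

Lemma semigroup_lip t U W : 0 <= t -> X2 U -> X2 W ->
  normX2 (S t U - S t W) <= normX2 (U - W).
Proof.
move=> t0 hU hW.
have XU := semigroup_stable sgS t0 hU; have XW := semigroup_stable sgS t0 hW.
have XB := X2_B hU hW; have XSB := semigroup_stable sgS t0 XB.
have := normX2_triangle (-1) (X2_HX (X2_B XSB (X2_B XU XW))) (X2_HX XSB).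
rewrite semigroup_B// mulr0 add0r scaleN1r opprB subrK => /le_trans; apply.
exact: (semigroup_contraction sgS t0 XB).
Qed.

Lemma semigroup_comm s t U : 0 <= s -> 0 <= t -> X2 U ->
  normX2 (S s (S t U) - S t (S s U)) = 0.
Proof.
move=> s0 t0 hU.
have X1 := semigroup_stable sgS t0 hU; have Y1 := semigroup_stable sgS s0 hU.
have X3 := X2_HX (semigroup_stable sgS s0 X1); have X4 := X2_HX (semigroup_stable sgS t0 Y1).
have X5 := X2_HX (semigroup_stable sgS (addr_ge0 s0 t0) hU).
apply: le_anti; rewrite normX2_ge0 andbT.
rewrite (le_trans (normX2_dist X3 X5 X4))// normX2BC// (semigroup_add sgS s0 t0 hU) add0r.
by rewrite (addrC s t) (semigroup_add sgS t0 s0 hU).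
Qed.

Variables (U0 W0 : state R).
Hypotheses (XU0 : X2 U0) (XW0 : X2 W0) (gUW : graph_A2 a U0 W0).

Let XU t : 0 <= t -> X2 (S t U0). Proof. by move=> t0; exact: (semigroup_stable sgS t0 XU0). Qed.
Let XW t : 0 <= t -> X2 (S t W0). Proof. by move=> t0; exact: (semigroup_stable sgS t0 XW0). Qed.

(** Error of a first-order expansion, left undivided so that null and negative increments are
    allowed. *)
Definition step A B t W := normX2 (A - B - t *: W).

Lemma normX2_eq A B : HX A -> HX B -> normX2 (A - B) = 0 -> normX2 A = normX2 B.
Proof.
move=> hA hB AB; apply: le_anti; apply/andP; split.
  have := normX2D (HX_B hA hB) hB; by rewrite AB add0r subrK.
have := normX2D (HX_B hB hA) hA; by rewrite normX2BC// AB add0r subrK.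
Qed.

Lemma HX_step A B t W : HX A -> HX B -> HX W -> HX (A - B - t *: W).
Proof. by move=> hA hB hW; apply: HX_B; [exact: HX_B|exact: HX_Z]. Qed.

Lemma step_congr A A' B t W : HX A -> HX A' -> HX B -> HX W ->
  normX2 (A - A') = 0 -> step A B t W = step A' B t W.
Proof.
move=> hA hA' hB hW AA; apply: normX2_eq; try exact: HX_step.
by rewrite !opprB !addrA (_ : A - B - t *: W + t *: W + B - A' = A - A')// !subrK.
Qed.

(** Up to null vectors, the error on the left is the image under [S t] of the error on the right,
    and [S t] contracts. *)
Lemma semigroup_step t h A B W : 0 <= t -> X2 A -> X2 B -> X2 W ->
  step (S t A) (S t B) h (S t W) <= step A B h W.
Proof.
move=> t0 hA hB hW; rewrite /step.
have XAB := X2_B hA hB.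
have XD := X2_lin (- h) hW XAB.
have E U V Z : U - V - h *: Z = (- h) *: Z + (U - V) by rewrite scaleNr addrC.
have sA := X2_HX (semigroup_stable sgS t0 hA).
have sB := X2_HX (semigroup_stable sgS t0 hB).
have sW := X2_HX (semigroup_stable sgS t0 hW).
have sAB := X2_HX (semigroup_stable sgS t0 XAB).
have sD := X2_HX (semigroup_stable sgS t0 XD).
rewrite !E (le_trans _ (semigroup_contraction sgS t0 XD))//.
rewrite le_eqVlt; apply/orP; left; apply/eqP.
have e1 : normX2 ((- h) *: S t W + S t (A - B)) = normX2 (S t (- h *: W + (A - B))).
  apply/esym; apply: normX2_eq => //; first exact: HX_lin.
  exact: (semigroup_linear sgS (- h) t0 hW XAB).
rewrite -e1; apply/esym; apply: normX2_eq; [exact: HX_lin|by apply: HX_lin => //; exact: HX_B|].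
by rewrite opprD addrACA subrr add0r semigroup_B.
Qed.

Lemma step_scale h A B W : 0 < h -> HX A -> HX B -> HX W ->
  normX2 (h^-1 *: (A - B) - W) = h^-1 * step A B h W.
Proof.
move=> h0 hA hB hW; have hs := HX_step h hA hB hW.
rewrite /step -[X in X * _]ger0_norm ?invr_ge0 ?ltW// -normX2Z//.
by rewrite scalerBr scalerA mulVf ?gt_eqF// scale1r.
Qed.

Lemma generator_step eta : 0 < eta ->
  exists2 de, 0 < de & forall h, 0 < h -> h < de -> step (S h U0) U0 h W0 <= eta * h.
Proof.
move=> eta0.
have /(genS XU0 XW0) /cvgrPdist_le /(_ eta eta0) := gUW.
rewrite near_withinE => -[de de0 H]; exists de => // h h0 hde.
have := H h; rewrite /ball_ /= sub0r normrN gtr0_norm// => /(_ hde h0).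
rewrite sub0r normrN ger0_norm ?normX2_ge0// step_scale//.
- by rewrite ler_pdivrMl// mulrC.
- by apply: X2_HX; apply: XU; exact: ltW.
- exact: X2_HX.
- exact: X2_HX.
Qed.

(** [S t] commutes with [S h] up to a null vector and contracts the error of the difference quotient
    at time 0; hence the domain is invariant and the generator commutes with the semigroup. *)
Lemma trajectory_graph t : 0 <= t -> graph_A2 a (S t U0) (S t W0).
Proof.
move=> t0; apply/(genS (XU t0) (XW t0)); apply/cvgrPdist_le => eta eta0.
have [de de0 H] := generator_step eta0.
rewrite near_withinE; exists de => // h /=; rewrite /ball_/= sub0r normrN => hde h0.
rewrite sub0r normrN ger0_norm ?normX2_ge0//.
have h00 := ltW h0.
have X1 := X2_HX (semigroup_stable sgS h00 (XU t0)).
have X3 := X2_HX (semigroup_stable sgS t0 (XU h00)).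
have X4 := X2_HX (XU t0); have X5 := X2_HX (XW t0).
rewrite step_scale// (step_congr h X1 X3 X4 X5 (semigroup_comm h00 t0 XU0)).
rewrite ler_pdivrMl// mulrC (le_trans (semigroup_step h t0 (XU h00) XU0 XW0))//.
by apply: H => //; rewrite gtr0_norm in hde.
Qed.

Lemma trajectory_le t s U : 0 <= s -> s <= t -> X2 U -> normX2 (S t U) <= normX2 (S s U).
Proof.
move=> s0 st hU; have d0 : 0 <= t - s by rewrite subr_ge0.
have t0 : 0 <= t by exact: le_trans st.
have X1 := semigroup_stable sgS s0 hU.
have X3 := semigroup_stable sgS d0 X1.
have Y := semigroup_add sgS d0 s0 hU; rewrite subrK in Y.
rewrite (normX2_eq (X2_HX (semigroup_stable sgS t0 hU)) (X2_HX X3) Y).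
exact: (semigroup_contraction sgS d0 X1).
Qed.

(** The generator only gives a right derivative. For [e < 0] the expansion is made forward from
    [t + e], then [S (t + e) W0] is replaced by [S t W0] using strong continuity; each of the two
    errors receives [eta / 2]. *)
Lemma trajectory_diff t eta : 0 < t -> 0 < eta ->
  exists2 de, 0 < de & forall e, `|e| < de -> 0 <= t + e /\
    step (S (t + e) U0) (S t U0) e (S t W0) <= eta * `|e|.
Proof.
move=> t0 eta0; have t00 := ltW t0.
have eta2 : 0 < eta / 2 by rewrite divr_gt0.
have [de de0 H] := generator_step eta2.
have /cvgrPdist_le /(_ _ eta2) := semigroup_continuous sgS XW0.
rewrite near_withinE => -[dc dc0 Hc].
exists (Num.min t (Num.min de dc)); first by rewrite !lt_min t0 de0.
move=> e; rewrite !lt_min => /andP[et /andP[ede edc]].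
have te0 : 0 <= t + e by move: et; rewrite ltr_norml => /andP[h _]; lra.
split => //.
have X1 := X2_HX (XU te0); have X4 := X2_HX (XU t00); have X5 := X2_HX (XW t00).
have [e0|e0|e0] := ltgtP e 0; last first.
- rewrite e0 addr0 normr0 mulr0 /step scale0r subr0 subrr.
  by rewrite (_ : 0 = 0 *: S t U0) ?scale0r// -(scale0r (S t U0)) normX2Z// normr0 mul0r.
- have h00 := ltW e0; have X3 := X2_HX (semigroup_stable sgS t00 (XU h00)).
  rewrite (step_congr e X1 X3 X4 X5 (semigroup_add sgS t00 h00 XU0)).
  rewrite (le_trans (semigroup_step e t00 (XU h00) XU0 XW0))//.
  move: ede; rewrite gtr0_norm// => ede; rewrite (le_trans (H e e0 ede))//.
  by rewrite ler_wpM2r//; lra.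
- pose h := - e; have h0 : 0 < h by rewrite oppr_gt0.
  have h00 := ltW h0; pose s := t + e.
  have ts : t = s + h by rewrite /s /h addrK.
  have nE : `|e| = h by rewrite ltr0_norm.
  rewrite nE in ede edc *.
  have s0 : 0 <= s by [].
  have Xs := X2_HX (XU s0); have Xws := X2_HX (XW s0).
  have YU := semigroup_add sgS s0 h00 XU0; rewrite -ts in YU.
  have YW := semigroup_add sgS s0 h00 XW0; rewrite -ts in YW.
  have XSU := X2_HX (semigroup_stable sgS s0 (XU h00)).
  have XSW := X2_HX (semigroup_stable sgS s0 (XW h00)).
  have st1 : step (S t U0) (S s U0) h (S s W0) <= eta / 2 * h.
    rewrite (step_congr h X4 XSU Xs Xws YU).
    exact: (le_trans (semigroup_step h s0 (XU h00) XU0 XW0) (H h h0 ede)).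
  have st2 : normX2 (S s W0 - S t W0) <= eta / 2.
    rewrite (le_trans (normX2_dist Xws XSW X5))// [X in _ + X]normX2BC// YW addr0.
    rewrite (le_trans (semigroup_lip s0 XW0 (XW h00)))// normX2BC; [|exact: X2_HX|exact: X2_HX (XW h00)].
    have := Hc h; rewrite /ball_/= sub0r normrN gtr0_norm// => /(_ edc h0).
    by rewrite sub0r normrN ger0_norm// normX2_ge0.
  rewrite /step.
  have -> : S (t + e) U0 - S t U0 - e *: S t W0 =
      (- 1) *: (S t U0 - S s U0 - h *: S s W0) + (- h) *: (S s W0 - S t W0).
    rewrite -/s /h opprK scaleN1r !opprD !opprK scalerBr scaleNr.
    by rewrite addrA subrK [- S t U0 + _]addrC.
  have hA := HX_step h X4 Xs Xws; have hB := HX_B Xws X5.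
  rewrite (le_trans (normX2_triangle _ hA (HX_Z _ hB)))// normrN1 mul1r normX2Z//.
  rewrite normrN gtr0_norm// [leRHS](_ : _ = eta / 2 * h + h * (eta / 2)); last by field.
  by apply: lerD => //; rewrite ler_wpM2l.
Qed.

End Trajectories.

(** * Duality pairing, dissipation law and derivative of the energy *)

Section Duality.
Variable R : realType.
Notation mu := (@lebesgue_measure R).
Implicit Types (c d x y a t s e : R) (f g u v w phi h : R -> R) (U W Z A B C : state R).

Lemma ip_coprim_gen w h : L2 0 1 w -> L2 0 1 h ->
  ip 0 1 (coprim 1 w) h = ip 0 1 w (prim 0 h).
Proof. by move=> hw hh; apply: ip_coprim; exact: L2_itg. Qed.

Lemma ip_prim_gen p h : L2 0 1 p -> L2 0 1 h ->
  ip 0 1 (prim 0 p) h = ip 0 1 p (coprim 1 h).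
Proof. by move=> hp hh; apply: iterated_integral; exact: L2_itg. Qed.

Lemma L2_prim01 g : L2 0 1 g -> L2 0 1 (prim 0 g).
Proof. by move=> hg; apply: L2_prim => //; exact: L2_itg. Qed.

Lemma L2_coprim01 g : L2 0 1 g -> L2 0 1 (coprim 1 g).
Proof. by move=> hg; apply: L2_coprim => //; exact: L2_itg. Qed.

Lemma prim_ae c d g g' x : c <= x <= d -> L2 c d g -> L2 c d g' ->
  {ae mu, forall x, x \in `]c, d[ -> g x = g' x} -> prim c g x = prim c g' x.
Proof.
move=> /andP[cx xd] hg hg' gg; apply: ae_int.
- exact: itg_sub (L2_itg hg).
- exact: itg_meas (itg_sub (lexx c) xd (L2_itg hg')).
- exact: int_ae_sub gg.
Qed.

Definition probe a U := trace 0 1 U.2 a.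

(** [W.1] equals [U.2] only almost everywhere, so the structure of the domain is restated with
    [der W]: at a fixed time the state is made of primitives of its image and of a multiple of
    [1 - after a]. *)
Lemma graph_snapshot a U W : 0 < a -> a < 1 -> X2 W -> graph_A2 a U W ->
  [/\ HX U, HX W, probe a U = prim 0 (der W) a,
      {ae mu, forall x, x \in `]0, 1[ -> U.2 x = prim 0 (der W) x} &
      {ae mu, forall x, x \in `]0, 1[ ->
        der U x = - coprim 1 W.2 x - probe a U * (1 - after a x)}].
Proof.
move=> a0 a1 XW gUW; have [E1 E2 E3] := graph_structure a0 a1 gUW.
have [[[[hu _] _ _ _ [hv _]] _] aeW1 lw _] := gUW.
have HW := X2_HX XW.
have hp := wderiv_ae_eq HW.1.1 hv aeW1.
have lq := der_L2 HW.
have [lp _] := wderivP hv.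
have PE x : 0 <= x <= 1 -> prim 0 (der W) x = prim 0 (wderiv 0 1 U.2) x.
  by move=> x01; exact: prim_ae lq lp hp.
split; [by split; [exact: hu|exact: hv.1]|exact: HW| | |exact: E3].
- by rewrite PE ?ltW.
- apply: aeS E2 => x + xcd => /(_ xcd) ->.
  by apply/esym/PE; move: xcd; rewrite in_itv/= => /andP[x0 x1]; rewrite !ltW.
Qed.

Lemma ip_snapshot_flux a w h (k : R) : 0 < a -> a < 1 -> L2 0 1 w -> L2 0 1 h ->
  ip 0 1 (fun x => - coprim 1 w x - k * (1 - after a x)) h =
  - ip 0 1 w (prim 0 h) - k * prim 0 h a.
Proof.
move=> a0 a1 hw hh; have lc := L2_coprim01 hw; have la := L2_after 0 1 a.
have l1 := L2_cst 0 1 (1 : R).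
have ls : L2 0 1 (fun x => - 1 * after a x + (cst 1 : R -> R) x) := L2_lin (-1) la l1.
rewrite (_ : (fun x => _) = (fun x => (- 1) * coprim 1 w x +
    (- k) * (- 1 * after a x + (cst 1 : R -> R) x))); last first.
  by apply/funext => x /=; ring.
rewrite (ip_lin (-1) lc (L2Z (- k) ls) hh) (ipZl (- k) ls hh) (ip_lin (-1) la l1 hh).
rewrite (ip_coprim_gen hw hh) (ipC _ _ (after a)) ip_after ?ltW//.
rewrite -[\int[mu]_(y in `]a, 1[) h y]/(coprim 1 h a) /coprim.
rewrite (@int_coprim _ 0 1 a) ?ltW//; last exact: L2_itg.
rewrite [ip 0 1 (cst 1) h]/ip; under [\int[mu]_(x in `]0, 1[) (cst 1 x * h x)]eq_Rintegral do rewrite mul1r.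
by rewrite /prim; ring.
Qed.

(** The adjoint relation written through primitives: the state is replaced by its snapshot and both
    integrations are moved onto [h1] and [h2]. When these are space derivatives of a wave, the wave
    itself comes back. *)
Lemma graph_dual a U W h1 h2 : 0 < a -> a < 1 -> X2 W -> graph_A2 a U W ->
  L2 0 1 h1 -> L2 0 1 h2 ->
  ip2 (der U) U.2 h2 h1 =
  ip2 (der W) W.2 (coprim 1 h1) (fun x => - prim 0 h2 x) - probe a U * prim 0 h2 a.
Proof.
move=> a0 a1 XW gUW l1 l2; have [hU hW Ef Ev EG] := graph_snapshot a0 a1 XW gUW.
have lG := der_L2 hU; have lq := der_L2 hW; have lv := hU.2; have lw := hW.2.
have lS : L2 0 1 (fun x => - coprim 1 W.2 x - probe a U * (1 - after a x)).
  apply: L2B; first by apply: L2N; exact: L2_coprim01.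
  by apply: L2Z; apply: L2B; [exact: L2_cst|exact: L2_after].
rewrite /ip2 (ip_ae1 lG lS l2 EG) (ip_ae1 lv (L2_prim01 lq) l1 Ev).
rewrite (ip_snapshot_flux _ a0 a1 lw l2) (ip_prim_gen lq l1).
have -> : ip 0 1 W.2 (fun x => - prim 0 h2 x) = - ip 0 1 W.2 (prim 0 h2).
  rewrite ipC (_ : (fun x => - prim 0 h2 x) = (fun x => (-1) * prim 0 h2 x)).
    by rewrite (ipZl (-1) (L2_prim01 l2) lw) ipC mulN1r.
  by apply/funext => x; rewrite mulN1r.
by rewrite /ip2; ring.
Qed.

(** Once the snapshot is inserted, the two bulk terms are opposite because [prim] and [coprim] are
    adjoint; only the jump term remains. *)
Lemma graph_dissipation a U W : 0 < a -> a < 1 -> X2 W -> graph_A2 a U W ->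
  ipX U W = - probe a U ^+ 2.
Proof.
move=> a0 a1 XW gUW; have [hU hW Ef Ev EG] := graph_snapshot a0 a1 XW gUW.
have lG := der_L2 hU; have lq := der_L2 hW; have lv := hU.2; have lw := hW.2.
have lS : L2 0 1 (fun x => - coprim 1 W.2 x - probe a U * (1 - after a x)).
  apply: L2B; first by apply: L2N; exact: L2_coprim01.
  by apply: L2Z; apply: L2B; [exact: L2_cst|exact: L2_after].
rewrite /ipX /ip2 (ip_ae1 lG lS lq EG) (ip_ae1 lv (L2_prim01 lq) lw Ev).
rewrite (ip_snapshot_flux _ a0 a1 lw lq) (ipC _ _ (prim 0 _)) -Ef; ring.
Qed.

Section Functional.
Variables (a : R) (S : R -> state R -> state R).
Hypothesis sgS : contraction_semigroup (@X2 R) (@normX2 R) S.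
Hypothesis genS : generated_by (@X2 R) (@normX2 R) (graph_A2 a) S.
Variables (U0 W0 : state R).
Hypotheses (XU0 : X2 U0) (XW0 : X2 W0) (gUW : graph_A2 a U0 W0).
Hypotheses (a_gt0 : 0 < a) (a_lt1 : a < 1).

Let HU t (t0 : 0 <= t) : HX (S t U0) := X2_HX (semigroup_stable sgS t0 XU0).
Let HW t (t0 : 0 <= t) : HX (S t W0) := X2_HX (semigroup_stable sgS t0 XW0).

Definition energy t := ipX (S t U0) (S t U0).

Lemma ipX_B U W Z : HX U -> HX W -> HX Z -> ipX (U - W) Z = ipX U Z - ipX W Z.
Proof. by move=> hU hW hZ; rewrite stateB ipXl//; ring. Qed.

Lemma ip2_pair_bound U g1 g2 (M : R) : HX U -> 0 <= M -> L2 0 1 g1 -> L2 0 1 g2 ->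
  (forall x, 0 < x < 1 -> `|g1 x| <= M /\ `|g2 x| <= M) ->
  `|ip2 (der U) U.2 g1 g2| <= 2 * M * normX2 U.
Proof.
move=> hU M0 l1 l2 HM.
have sq g : L2 0 1 g -> (forall x, 0 < x < 1 -> `|g x| <= M) -> ip 0 1 g g <= M ^+ 2.
  move=> lg Hg; rewrite -[leRHS]mulr1 -[X in _ * X](subr0 1) -int_cst//.
  apply: le_int; [exact: L2_mul|exact: itg_cst|] => x x01.
  by rewrite -expr2 -real_normK ?num_real// lerXn2r ?nnegrE// Hg.
have h := ip2_CS (der_L2 hU) hU.2 l1 l2.
rewrite -(@ler_pXn2r _ 2)// ?nnegrE ?mulr_ge0 ?normX2_ge0//.
rewrite real_normK ?num_real// (le_trans h)// exprMn normX2_sq// mulrC.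
apply: ler_wpM2r; first exact: ipX_ge0.
have e1 := sq _ l1 (fun x x01 => (HM x x01).1); have e2 := sq _ l2 (fun x x01 => (HM x x01).2).
have := sqr_ge0 M; rewrite /ip2 exprMn; nra.
Qed.

Lemma energy_derive t : 0 < t ->
  is_derive t 1 energy (- 2 * probe a (S t U0) ^+ 2).
Proof.
move=> t0; have t00 := ltW t0.
have gt := trajectory_graph sgS genS XU0 XW0 gUW t00.
have Xt := semigroup_stable sgS t00 XW0.
have <- : 2 * ipX (S t U0) (S t W0) = - 2 * probe a (S t U0) ^+ 2.
  by rewrite (graph_dissipation a_gt0 a_lt1 Xt gt); ring.
apply: is_derive_eps => eta eta0.
set nU := normX2 (S t U0); set nW := normX2 (S t W0).
have nU0 : 0 <= nU by exact: normX2_ge0.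
have nW0 : 0 <= nW by exact: normX2_ge0.
(* The first two summands are the coefficients of the error terms [2 * ipX Z (S t U0)] and [ipX D D]
   below; the last one keeps [K] positive. *)
pose K := 2 * nU + (nW + 1) ^+ 2 + 1.
have K0 : 0 < K by rewrite /K; nra.
pose eta1 := Num.min 1 (eta / (2 * K)).
have eta10 : 0 < eta1 by rewrite lt_min ltr01 divr_gt0// mulr_gt0.
have [de de0 H] := trajectory_diff sgS genS XU0 XW0 gUW t0 eta10.
exists (Num.min de (eta / (2 * K))); first by rewrite lt_min de0 divr_gt0// mulr_gt0.
move=> e; rewrite lt_min => /andP[ede eK].
have [te0 He] := H e ede.
set D := S (t + e) U0 - S t U0; set Z := D - e *: S t W0.
have hU := HU t00; have hW := HW t00; have hV := HU te0.
have hD : HX D by exact: HX_B.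
have hZ : HX Z by apply: HX_B => //; exact: HX_Z.
have E : energy (t + e) - energy t - e * (2 * ipX (S t U0) (S t W0)) =
    2 * ipX Z (S t U0) + ipX D D.
  have -> : ipX Z (S t U0) = ipX D (S t U0) - e * ipX (S t W0) (S t U0).
    rewrite /Z (_ : D - _ = (- e) *: S t W0 + D); last by rewrite scaleNr addrC.
    by rewrite ipXl//; ring.
  rewrite (ipXC (S t W0)) /D ipX_B// ![ipX _ (_ - _)]ipXC ipX_B//.
  by rewrite ![ipX _ (_ - _)]ipXC !ipX_B// (ipXC (S t U0) (S (t + e) U0)) /energy; ring.
rewrite E.
have nZ : normX2 Z <= eta1 * `|e| by exact: He.
have nD : normX2 D <= (nW + 1) * `|e|.
  rewrite (_ : D = e *: S t W0 + Z); last by rewrite /Z addrC subrK.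
  rewrite (le_trans (normX2_triangle _ hW hZ))// -/nW mulrDl mul1r mulrC lerD2l.
  by rewrite (le_trans nZ)// ler_piMl// ge_min lexx.
have c1 : `|ipX Z (S t U0)| <= eta1 * `|e| * nU.
  rewrite -(@ler_pXn2r _ 2)// ?nnegrE ?mulr_ge0// ?(ltW eta10)//.
  rewrite real_normK ?num_real// (le_trans (ipX_CS hZ hU))// exprMn -!normX2_sq//.
  by rewrite ler_wpM2r ?sqr_ge0// lerXn2r// ?nnegrE ?normX2_ge0// mulr_ge0// ltW.
have c2 : ipX D D <= ((nW + 1) * `|e|) ^+ 2.
  by rewrite -normX2_sq// lerXn2r// ?nnegrE ?normX2_ge0// mulr_ge0// addr_ge0.
rewrite (le_trans (ler_normD _ _))// (ger0_norm (ipX_ge0 D)) normrM (ger0_norm (ler0n R 2)).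
have e1K : eta1 <= eta / (2 * K) by rewrite ge_min lexx orbT.
set r := eta / (2 * K) in eK e1K *.
have rK : eta = 2 * r * K by rewrite /r; field; rewrite gt_eqF.
have ne := normr_ge0 e.
have r0 : 0 < r by rewrite divr_gt0// mulr_gt0.
have e3 : `|e| * `|e| <= r * `|e| by rewrite ler_wpM2r// ltW.
rewrite (le_trans (_ : _ <= 2 * (eta1 * `|e| * nU) + ((nW + 1) * `|e|) ^+ 2))//.
  by apply: lerD => //; rewrite ler_pM2l.
rewrite rK /K.
have h1 : eta1 * `|e| * nU <= r * `|e| * nU by rewrite ler_wpM2r// ler_wpM2r.
have h2 : ((nW + 1) * `|e|) ^+ 2 <= (nW + 1) ^+ 2 * (r * `|e|).
  by rewrite exprMn ler_wpM2l ?sqr_ge0// expr2.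
have h3 : 0 <= r * `|e| by rewrite mulr_ge0// ltW.
have h4 : 0 <= r * `|e| * nU by rewrite mulr_ge0.
have h5 : 0 <= (nW + 1) ^+ 2 * (r * `|e|) by rewrite mulr_ge0// sqr_ge0.
by move: h1 h2 h3 h4 h5; set X := eta1 * _ * _; set Y := _ ^+ 2; lra.
Qed.

End Functional.

End Duality.

(** * Pairings with moving test functions *)

Section MovingFunctional.
Variable R : realType.
Notation mu := (@lebesgue_measure R).
Implicit Types (c d x y t s e : R) (f g u v w phi h : R -> R) (U W Z A B C : state R).

Section Functional.
Variables (a : R) (S : R -> state R -> state R).
Hypothesis sgS : contraction_semigroup (@X2 R) (@normX2 R) S.
Hypothesis genS : generated_by (@X2 R) (@normX2 R) (graph_A2 a) S.
Variables (U0 W0 : state R).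
Hypotheses (XU0 : X2 U0) (XW0 : X2 W0) (gUW : graph_A2 a U0 W0).

Let HU t (t0 : 0 <= t) : HX (S t U0) := X2_HX (semigroup_stable sgS t0 XU0).
Let HW t (t0 : 0 <= t) : HX (S t W0) := X2_HX (semigroup_stable sgS t0 XW0).

Definition pairing U g1 g2 := ip2 (der U) U.2 g1 g2.

Lemma pairing_linr U k g1 g2 h1 h2 : HX U -> L2 0 1 g1 -> L2 0 1 g2 -> L2 0 1 h1 -> L2 0 1 h2 ->
  pairing U (fun x => k * g1 x + h1 x) (fun x => k * g2 x + h2 x) =
  k * pairing U g1 g2 + pairing U h1 h2.
Proof.
move=> hU l1 l2 l3 l4; have lG := der_L2 hU; have lv := hU.2.
by rewrite /pairing ip2C (ip2_lin k l1 l2 l3 l4 lG lv) ![ip2 _ _ (der U) _]ip2C.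
Qed.

Lemma pairing_linl U W k g1 g2 : HX U -> HX W -> L2 0 1 g1 -> L2 0 1 g2 ->
  pairing (k *: U + W) g1 g2 = k * pairing U g1 g2 + pairing W g1 g2.
Proof. exact: ipX_lin. Qed.

Lemma pairing_bound U g1 g2 (M : R) : HX U -> 0 <= M -> L2 0 1 g1 -> L2 0 1 g2 ->
  (forall x, 0 < x < 1 -> `|g1 x| <= M /\ `|g2 x| <= M) ->
  `|pairing U g1 g2| <= 2 * M * normX2 U.
Proof. exact: ip2_pair_bound. Qed.

(** Product rule between a trajectory, differentiable only in the seminorm, and test functions whose
    expansion in time is controlled pointwise: [M] bounds them, their increments and their quadratic
    remainders. *)
Lemma pairing_derive t (g1 g2 : R -> R -> R) (k1 k2 : R -> R) (M : R) : 0 < t -> 0 <= M ->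
  (forall s, L2 0 1 (g1 s) /\ L2 0 1 (g2 s)) -> L2 0 1 k1 -> L2 0 1 k2 ->
  (forall x, 0 < x < 1 -> `|g1 t x| <= M /\ `|g2 t x| <= M) ->
  (forall e x, `|e| <= 1 -> 0 < x < 1 ->
    `|- 1 * g1 t x + g1 (t + e) x| <= M * `|e| /\ `|- 1 * g2 t x + g2 (t + e) x| <= M * `|e|) ->
  (forall e x, `|e| <= 1 -> 0 < x < 1 ->
    `|- e * k1 x + (- 1 * g1 t x + g1 (t + e) x)| <= M * e ^+ 2 /\
    `|- e * k2 x + (- 1 * g2 t x + g2 (t + e) x)| <= M * e ^+ 2) ->
  is_derive t 1 (fun s => pairing (S s U0) (g1 s) (g2 s))
    (pairing (S t W0) (g1 t) (g2 t) + pairing (S t U0) k1 k2).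
Proof.
move=> t0 M0 Lg lk1 lk2 B0 B1 B2; have t00 := ltW t0.
apply: is_derive_eps => eta eta0.
set nU := normX2 (S t U0); set nW := normX2 (S t W0).
have nU0 : 0 <= nU by exact: normX2_ge0.
have nW0 : 0 <= nW by exact: normX2_ge0.
pose K := 2 * M * (1 + nU + (nW + 1)) + 1.
have K0 : 0 < K by rewrite /K; nra.
pose eta1 := Num.min 1 (eta / K).
have eta10 : 0 < eta1 by rewrite lt_min ltr01 divr_gt0.
have [de de0 H] := trajectory_diff sgS genS XU0 XW0 gUW t0 eta10.
exists (Num.min de eta1); first by rewrite lt_min de0.
move=> e; rewrite lt_min => /andP[ede ee1].
have e1 : `|e| <= 1 by rewrite (le_trans (ltW ee1))// ge_min lexx.
have [te0 He] := H e ede.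
have [l1 l2] := Lg t; have [l1e l2e] := Lg (t + e).
set D := S (t + e) U0 - S t U0; set Z := D - e *: S t W0.
have hU := HU t00; have hW := HW t00; have hV := HU te0.
have hD : HX D by exact: HX_B.
have hZ : HX Z by apply: HX_B => //; exact: HX_Z.
pose d1 := fun x => - 1 * g1 t x + g1 (t + e) x.
pose d2 := fun x => - 1 * g2 t x + g2 (t + e) x.
pose r1 := fun x => - e * k1 x + d1 x.
pose r2 := fun x => - e * k2 x + d2 x.
have ld1 : L2 0 1 d1 by exact: L2_lin.
have ld2 : L2 0 1 d2 by exact: L2_lin.
have lr1 : L2 0 1 r1 by exact: L2_lin.
have lr2 : L2 0 1 r2 by exact: L2_lin.
(* First-order error of the trajectory, first-order error of the test functions, and product of the
   two increments. *)
have E : pairing (S (t + e) U0) (g1 (t + e)) (g2 (t + e)) - pairing (S t U0) (g1 t) (g2 t) -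
    e * (pairing (S t W0) (g1 t) (g2 t) + pairing (S t U0) k1 k2) =
    pairing Z (g1 t) (g2 t) + pairing (S t U0) r1 r2 + pairing D d1 d2.
  rewrite (pairing_linr (- e) hU lk1 lk2 ld1 ld2).
  rewrite (pairing_linr (- 1) hU l1 l2 l1e l2e) (pairing_linr (- 1) hD l1 l2 l1e l2e).
  rewrite /Z (_ : D - _ = (- e) *: S t W0 + D); last by rewrite scaleNr addrC.
  rewrite (pairing_linl (- e) hW hD l1 l2) /D !stateB.
  rewrite (pairing_linl (- 1) hU hV l1 l2) (pairing_linl (- 1) hU hV l1e l2e).
  move: (pairing _ (g1 t) (g2 t)) (pairing (S t W0) _ _) (pairing _ k1 k2) => *.
  by ring.
rewrite E {E}.
have nZ : normX2 Z <= eta1 * `|e| by exact: He.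
have nD : normX2 D <= (nW + 1) * `|e|.
  rewrite (_ : D = e *: S t W0 + Z); last by rewrite /Z addrC subrK.
  rewrite (le_trans (normX2_triangle _ hW hZ))// -/nW mulrDl mul1r mulrC lerD2l.
  by rewrite (le_trans nZ)// ler_piMl// ge_min lexx.
have c1 : `|pairing Z (g1 t) (g2 t)| <= 2 * M * (eta1 * `|e|).
  by rewrite (le_trans (pairing_bound hZ M0 l1 l2 B0))// ler_wpM2l// mulr_ge0.
have Me2 : 0 <= M * e ^+ 2 by rewrite mulr_ge0// sqr_ge0.
have c2 : `|pairing (S t U0) r1 r2| <= 2 * (M * e ^+ 2) * nU.
  by apply: pairing_bound => // x x01; apply: B2.
have Me : 0 <= M * `|e| by rewrite mulr_ge0.
have c3 : `|pairing D d1 d2| <= 2 * (M * `|e|) * ((nW + 1) * `|e|).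
  apply: (le_trans (pairing_bound hD Me ld1 ld2 (fun x x01 => B1 e x e1 x01))).
  by rewrite ler_wpM2l// mulr_ge0.
rewrite (le_trans (ler_normD _ _))// (le_trans (lerD (ler_normD _ _) (lexx _)))//.
rewrite (le_trans (lerD (lerD c1 c2) c3))//.
have ee : e ^+ 2 = `|e| * `|e| by rewrite -expr2 real_normK ?num_real.
have ne := normr_ge0 e.
have e3 : `|e| * `|e| <= eta1 * `|e| by rewrite ler_wpM2r// ltW.
have e1K : eta1 * K <= eta by rewrite -ler_pdivlMr// ge_min lexx orbT.
have f1 : 2 * (M * e ^+ 2) * nU <= 2 * M * nU * (eta1 * `|e|).
  rewrite ee [leLHS](_ : _ = 2 * M * nU * (`|e| * `|e|)); last by ring.
  by rewrite ler_wpM2l// mulr_ge0// mulr_ge0.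
have f2 : 2 * (M * `|e|) * ((nW + 1) * `|e|) <= 2 * M * (nW + 1) * (eta1 * `|e|).
  rewrite [leLHS](_ : _ = 2 * M * (nW + 1) * (`|e| * `|e|)); last by ring.
  by rewrite ler_wpM2l// mulr_ge0 ?addr_ge0// mulr_ge0.
have f3 : K * (eta1 * `|e|) <= eta * `|e|.
  by rewrite mulrA ler_wpM2r// mulrC.
have f4 : 0 <= eta1 * `|e| by rewrite mulr_ge0// ltW.
move: f1 f2 f3 f4; rewrite /K; move: (2 * (M * `|e|) * _) (2 * (M * e ^+ 2) * nU) (eta1 * `|e|) (eta * `|e|) => P Q X Y.
by move=> g1' g2' g3' g4'; lra.
Qed.

End Functional.

Section Tame.

(** Bounded with a bounded Lipschitz derivative, uniformly on the line: this is what
    [pairing_derive] asks of the profile of a wave. *)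
Definition tame f f1 := (forall x, is_derive x 1 f (f1 x)) /\
  exists2 B : R, 0 <= B & forall x y,
    [/\ `|f x| <= B, `|f1 x| <= B & `|f1 x - f1 y| <= B * `|x - y|].

Lemma lipschitz_of_derivative f f1 (B : R) : (forall x, is_derive x 1 f (f1 x)) ->
  (forall x, `|f1 x| <= B) -> forall x y, `|f x - f y| <= B * `|x - y|.
Proof.
move=> df Hf.
have key x y : x <= y -> `|f x - f y| <= B * `|x - y|.
  move=> xy.
  have cf : {within `[x, y], continuous f}.
    apply: continuous_subspaceT => z; apply: differentiable_continuous; apply/derivable1_diffP.
    by have [] := df z.
  have [z _ E] := MVT_segment xy (fun z _ => df z) cf.
  by rewrite distrC E normrM (distrC x) ler_wpM2r.
move=> x y; have [xy|yx] := leP x y; first exact: key.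
by rewrite distrC (distrC x) key// ltW.
Qed.

Lemma tame_remainder f f1 : tame f f1 -> exists2 B : R, 0 <= B & forall x e,
  [/\ `|f x| <= B, `|f1 x| <= B, `|f (x + e) - f x| <= B * `|e| & `|f (x + e) - f x - e * f1 x| <= B * e ^+ 2].
Proof.
move=> [df [B B0 HB]]; exists B => // x e.
have [h1 h2 _] := HB x x.
have L := lipschitz_of_derivative df (fun x => let: And3 _ h _ := HB x x in h).
split => //; first by have := L (x + e) x; rewrite addrAC subrr add0r.
(* The mean value theorem for [f] minus its linear part at [x] yields the quadratic remainder from
   the Lipschitz bound on [f1]. *)
pose F y := f y - y * f1 x.
have dF y : is_derive y 1 F (f1 y - f1 x).
  have d1 := df y.
  by apply: is_derive_eq; rewrite /GRing.scale/=; ring.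
have cF z1 z2 : {within `[z1, z2], continuous F}.
  apply: continuous_subspaceT => z; apply: differentiable_continuous; apply/derivable1_diffP.
  by have [] := dF z.
have E : f (x + e) - f x - e * f1 x = F (x + e) - F x by rewrite /F; ring.
rewrite E -real_normK ?num_real// expr2 mulrA.
have [e0|e0] := leP 0 e.
  have xe : x <= x + e by rewrite lerDl.
  have [z] := MVT_segment xe (fun z _ => dF z) (@cF x (x + e)).
  rewrite in_itv/= => /andP[xz zx] ->.
  rewrite addrAC subrr add0r normrM ler_wpM2r//.
  have [_ _ h3] := HB z x; rewrite (le_trans h3)// ler_wpM2l//.
  by rewrite !ger0_norm ?subr_ge0// lerBlDl.
have xe : x + e <= x by rewrite gerDl ltW.
have [z] := MVT_segment xe (fun z _ => dF z) (@cF (x + e) x).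
rewrite in_itv/= => /andP[xz zx] Ez.
rewrite distrC Ez opprD addrA subrr sub0r normrM normrN ler_wpM2r//.
have [_ _ h3] := HB z x; rewrite (le_trans h3)// ler_wpM2l//.
by rewrite (ltr0_norm e0) distrC ger0_norm ?subr_ge0//; lra.
Qed.

Lemma tameD f f1 g h : tame f f1 -> tame g h -> tame (fun x => f x + g x) (fun x => f1 x + h x).
Proof.
move=> [df [B B0 HB]] [dg [C C0 HC]]; split => [x|].
  by have d1 := df x; have d2 := dg x; apply: is_derive_eq.
exists (B + C); first exact: addr_ge0.
move=> x y; have [b1 b2 b3] := HB x y; have [c1 c2 c3] := HC x y; split.
- by rewrite (le_trans (ler_normD _ _))// lerD.
- by rewrite (le_trans (ler_normD _ _))// lerD.
- by rewrite opprD addrACA (le_trans (ler_normD _ _))// mulrDl lerD.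
Qed.

Lemma tameM f f1 g h : tame f f1 -> tame g h ->
  tame (fun x => f x * g x) (fun x => f1 x * g x + f x * h x).
Proof.
move=> [df [B B0 HB]] [dg [C C0 HC]]; split => [x|].
  have d1 := df x; have d2 := dg x.
  by apply: is_derive_eq; rewrite /GRing.scale/=; ring.
have Lf := lipschitz_of_derivative df (fun x => let: And3 _ h _ := HB x x in h).
have Lg := lipschitz_of_derivative dg (fun x => let: And3 _ h _ := HC x x in h).
exists (4 * (B * C)); first by rewrite !mulr_ge0.
have BC : 0 <= B * C by rewrite mulr_ge0.
move=> x y; have [b1 b2 b3] := HB x y; have [c1 c2 c3] := HC x y.
have [b1y b2y _] := HB y x; have [c1y c2y _] := HC y x.
have m1 (p q p' q' : R) : `|p| <= p' -> `|q| <= q' -> `|p * q| <= p' * q'.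
  by move=> hp hq; rewrite normrM ler_pM.
split.
- by rewrite (le_trans (m1 _ _ _ _ b1 c1))//; lra.
- rewrite (le_trans (ler_normD _ _))//.
  by have := m1 _ _ _ _ b2 c1; have := m1 _ _ _ _ b1 c2; lra.
- rewrite (_ : _ - _ = (f1 x - f1 y) * g x + f1 y * (g x - g y) + (f x - f y) * h x + f y * (h x - h y)); last by ring.
  have n1 := m1 _ _ _ _ b3 c1; have n2 := m1 _ _ _ _ b2y (Lg x y).
  have n3 := m1 _ _ _ _ (Lf x y) c2; have n4 := m1 _ _ _ _ b1y c3.
  rewrite (le_trans (ler_normD _ _))// (le_trans (lerD (ler_normD _ _) (lexx _)))//.
  rewrite (le_trans (lerD (lerD (ler_normD _ _) (lexx _)) (lexx _)))//.
  rewrite (le_trans (lerD (lerD (lerD n1 n2) n3) n4))//.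
  by rewrite le_eqVlt; apply/orP; left; apply/eqP; ring.
Qed.

Lemma tame_cst (k : R) : tame (cst k) (cst 0).
Proof.
split => [x|]; first exact: is_derive_cst.
exists `|k|; first exact: normr_ge0.
by move=> x y; rewrite /= subrr normr0 lexx normr_ge0 mulr_ge0.
Qed.

Lemma tameZ (k : R) f f1 : tame f f1 -> tame (fun x => k * f x) (fun x => k * f1 x).
Proof.
move=> /(tameM (tame_cst k)) h.
by rewrite (_ : (fun x => k * f1 x) = (fun x => cst 0 x * f x + cst k x * f1 x))//; apply/funext => x /=; ring.
Qed.

Lemma tame_sum N (F F1 : nat -> R -> R) : (forall i, tame (F i) (F1 i)) ->
  tame (fun x => \sum_(i < N) F i x) (fun x => \sum_(i < N) F1 i x).
Proof.
move=> H; elim: N => [|N IH].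
  under eq_fun do rewrite big_ord0; under [X in tame _ X]eq_fun do rewrite big_ord0.
  exact: tame_cst.
under eq_fun do rewrite big_ord_recr/=; under [X in tame _ X]eq_fun do rewrite big_ord_recr/=.
exact: tameD.
Qed.

Lemma tame_cosM (k : R) : tame (fun x => cos (k * x)) (fun x => - (k * sin (k * x))).
Proof.
split => [x|]; first exact: is_derive_cosM.
have d2 x : is_derive x 1 (fun x => - (k * sin (k * x))) (- (k * (k * cos (k * x)))).
  have h := is_derive_sinM k x.
  by apply: is_derive_eq.
have k0 := normr_ge0 k.
have L := @lipschitz_of_derivative _ _ (k ^+ 2) d2.
have ck x : `|cos (k * x)| <= 1 by rewrite ler_norml cos_geN1 cos_le1.
have sk x : `|sin (k * x)| <= 1 by rewrite ler_norml sin_geN1 sin_le1.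
exists (1 + `|k| + k ^+ 2); first by rewrite !addr_ge0 ?sqr_ge0.
have kk := sqr_ge0 k.
move=> x y; split.
- by rewrite (le_trans (ck x))//; lra.
- rewrite normrN normrM (le_trans (ler_wpM2l k0 (sk x)))// mulr1; lra.
- rewrite (le_trans (L _ x y))//; last by rewrite ler_wpM2r//; lra.
  move=> z; rewrite normrN mulrA normrM -expr2 (ger0_norm kk).
  by rewrite ler_piMr.
Qed.

Lemma tame_sinM (k : R) : tame (fun x => sin (k * x)) (fun x => k * cos (k * x)).
Proof.
split => [x|]; first exact: is_derive_sinM.
have d2 x : is_derive x 1 (fun x => k * cos (k * x)) (k * - (k * sin (k * x))).
  have h := is_derive_cosM k x.
  by apply: is_derive_eq.
have k0 := normr_ge0 k.
have L := @lipschitz_of_derivative _ _ (k ^+ 2) d2.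
have ck x : `|cos (k * x)| <= 1 by rewrite ler_norml cos_geN1 cos_le1.
have sk x : `|sin (k * x)| <= 1 by rewrite ler_norml sin_geN1 sin_le1.
exists (1 + `|k| + k ^+ 2); first by rewrite !addr_ge0 ?sqr_ge0.
have kk := sqr_ge0 k.
move=> x y; split.
- by rewrite (le_trans (sk x))//; lra.
- rewrite normrM (le_trans (ler_wpM2l k0 (ck x)))// mulr1; lra.
- rewrite (le_trans (L _ x y))//; last by rewrite ler_wpM2r//; lra.
  move=> z; rewrite mulrN normrN mulrA normrM -expr2 (ger0_norm kk).
  by rewrite ler_piMr.
Qed.

Lemma tame_continuous f f1 : tame f f1 -> continuous f.
Proof.
move=> [df _] x; apply: differentiable_continuous; apply/derivable1_diffP.
by have [] := df x.
Qed.

Lemma lipschitz_continuous f (B : R) : 0 <= B -> (forall x y, `|f x - f y| <= B * `|x - y|) -> continuous f.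
Proof.
move=> B0 H x; apply/cvgrPdist_le => e e0.
have B1 : 0 < B + 1 by rewrite ltr_wpDl.
near=> y; rewrite (le_trans (H x y))//.
rewrite (le_trans (_ : _ <= (B + 1) * `|x - y|))//; first by rewrite ler_wpM2r// lerDl.
rewrite mulrC -ler_pdivlMr//; near: y.
by apply: cvgr_dist_le => //; rewrite divr_gt0.
Unshelve. all: by end_near. Qed.

Lemma tame_continuous1 f f1 : tame f f1 -> continuous f1.
Proof. by move=> [_ [B B0 HB]]; apply: (lipschitz_continuous B0) => x y; have [] := HB x y. Qed.

Definition ramp x : R := Num.max 0 x.

Lemma ramp_lip x y : `|ramp x - ramp y| <= `|x - y|.
Proof.
rewrite /ramp; have [x0|x0] := leP 0 x; have [y0|y0] := leP 0 y;
  rewrite ?subr0 ?sub0r ?subrr ?normr0 ?normr_ge0 ?lexx//.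
- by rewrite !ger0_norm//; lra.
- by rewrite normrN (ger0_norm y0) ler0_norm; lra.
Qed.

(** The quadratic bound on the remainder, with constant 1, also holds across the kink of [ramp], so
    all points are treated alike. *)
Lemma is_derive_ramp_sq x : is_derive x 1 (fun x => ramp x ^+ 2) (2 * ramp x).
Proof.
apply: (@is_derive_quadratic _ _ _ _ 1 1) => // e _.
have e2 := sqr_ge0 e.
rewrite mul1r /ramp; have [xe|xe] := leP 0 (x + e); have [x0|x0] := leP 0 x; rewrite ler_norml; apply/andP; split; nra.
Qed.

(** The C^1 quadratic spline joining 1 to 0 over [1, 3]; its derivative is
    Lipschitz, which is all that [tame] asks for. *)
Definition cutoff x : R := 1 - 2^-1 * (ramp (x - 1) ^+ 2 - 2 * ramp (x - 2) ^+ 2 + ramp (x - 3) ^+ 2).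
Definition cutoff1 x : R := - (ramp (x - 1) - 2 * ramp (x - 2) + ramp (x - 3)).

Lemma cutoff_one x : x <= 1 -> cutoff x = 1.
Proof.
move=> x1; by rewrite /cutoff /ramp !max_l; [ring|lra|lra|lra].
Qed.

Lemma cutoff_zero x : 3 <= x -> cutoff x = 0.
Proof.
move=> x1; by rewrite /cutoff /ramp !max_r; [field|lra|lra|lra].
Qed.

Lemma cutoff_norm x : `|cutoff x| <= 1.
Proof.
rewrite ler_norml /cutoff /ramp.
have [x1|x1] := leP 0 (x - 1); have [x2|x2] := leP 0 (x - 2); have [x3|x3] := leP 0 (x - 3);
 try (exfalso; lra); apply/andP; split; nra.
Qed.

Lemma tame_cutoff : tame cutoff cutoff1.
Proof.
split => [x|].
  have dr (k : R) : is_derive x 1 (fun x => ramp (x - k) ^+ 2) (2 * ramp (x - k)).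
    have d1 : is_derive x 1 (fun x : R => x - k) 1 by apply: is_derive_eq; rewrite subr0.
    have := @is_derive1_comp _ (fun x => ramp x ^+ 2) (fun x => x - k) x _ _ (is_derive_ramp_sq (x - k)) d1.
    by move=> d2; apply: is_derive_eq; rewrite mulr1.
  have h1 := dr 1; have h2 := dr 2; have h3 := dr 3.
  by apply: is_derive_eq; rewrite /cutoff1 /GRing.scale/=; field.
exists 4 => // x y; split.
- by rewrite (le_trans (cutoff_norm x))//; lra.
- rewrite ler_norml /cutoff1 /ramp.
  have [x1|x1] := leP 0 (x - 1); have [x2|x2] := leP 0 (x - 2); have [x3|x3] := leP 0 (x - 3);
   apply/andP; split; lra.
- have r k := ramp_lip (x - k) (y - k).
  have rk k : x - k - (y - k) = x - y by ring.
  have := (r 1, r 2, r 3); rewrite !rk => -[[r1 r2] r3].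
  rewrite /cutoff1 (_ : _ - _ = - (ramp (x - 1) - ramp (y - 1)) + 2 * (ramp (x - 2) - ramp (y - 2)) - (ramp (x - 3) - ramp (y - 3))); last by ring.
  rewrite (le_trans (ler_normB _ _))// (le_trans (lerD (ler_normD _ _) (lexx _)))// normrN normrM (ger0_norm (ler0n R 2)); lra.
Qed.

End Tame.

End MovingFunctional.

(** * D'Alembert waves and observability *)

Section Observability.
Variable R : realType.
Notation mu := (@lebesgue_measure R).
Implicit Types (c d x y t s e : R) (f g u v w phi h q chi : R -> R) (U W Z A B C : state R).
Notation lam := (@lam R).

Section Waves.
Variable a : R.
Hypotheses (a_gt0 : 0 < a) (a_lt1 : a < 1).

(** For fixed [chi], ([wave1], [wave2]) is a solution [(z_x, z_t)] of the
    undamped wave equation on each side of [a]; [z_t] vanishes at 0, [z_x]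
    vanishes at 1, and [z_t] is continuous at [a], where [z_x] jumps by [kick]. *)
Definition left1 chi t x : R :=
  chi (x + (t + 1 - a)) + chi (x + (t - 1 + a)) + chi ((t + 1 - a) - x) + chi ((t - 1 + a) - x).
Definition left2 chi t x : R :=
  chi (x + (t + 1 - a)) + chi (x + (t - 1 + a)) - chi ((t + 1 - a) - x) - chi ((t - 1 + a) - x).
Definition right1 chi t x : R :=
  - chi ((t + 1 + a) - x) + chi ((t + 1 - a) - x) + chi (x + (t - 1 + a)) - chi (x + (t - 1 - a)).
Definition right2 chi t x : R :=
  chi ((t + 1 + a) - x) - chi ((t + 1 - a) - x) + chi (x + (t - 1 + a)) - chi (x + (t - 1 - a)).

Definition wave1 chi t := gluef a (left1 chi t) (right1 chi t).
Definition wave2 chi t := gluef a (left2 chi t) (right2 chi t).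

Lemma is_derive_shift f f1 (l : R) : (forall x, is_derive x 1 f (f1 x)) ->
  forall x, is_derive x 1 (fun x => f (x + l)) (f1 (x + l)).
Proof.
move=> df x; have d1 : is_derive x 1 (fun x : R => x + l) 1 by apply: is_derive_eq; rewrite addr0.
have := @is_derive1_comp _ f (fun x => x + l) x _ _ (df (x + l)) d1.
by move=> d2; apply: is_derive_eq; rewrite mulr1.
Qed.

Lemma is_derive_reflect f f1 (l : R) : (forall x, is_derive x 1 f (f1 x)) ->
  forall x, is_derive x 1 (fun x => f (l - x)) (- f1 (l - x)).
Proof.
move=> df x; have d1 : is_derive x 1 (fun x : R => l - x) (- 1) by have := is_deriveB (is_derive_cst l x 1) (is_derive_id x 1); rewrite sub0r.
have := @is_derive1_comp _ f (fun x => l - x) x _ _ (df (l - x)) d1.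
by move=> d2; apply: is_derive_eq; rewrite mulrN1.
Qed.

Lemma continuous_shift f (l : R) : continuous f -> continuous (fun x => f (x + l)).
Proof.
move=> cf x; apply: (@continuous_comp _ _ _ (fun x => x + l) f); last exact: cf.
by apply: continuousD; [exact: cvg_id|exact: cvg_cst].
Qed.

Lemma continuous_reflect f (l : R) : continuous f -> continuous (fun x => f (l - x)).
Proof.
move=> cf x; apply: (@continuous_comp _ _ _ (fun x => l - x) f); last exact: cf.
by apply: continuousB; [exact: cvg_cst|exact: cvg_id].
Qed.

Lemma continuous_add f g : continuous f -> continuous g -> continuous (fun x => f x + g x).
Proof. by move=> cf cg x; apply: cvgD; [exact: cf|exact: cg]. Qed.

Lemma continuous_opp f : continuous f -> continuous (fun x => - f x).
Proof. by move=> cf x; apply: cvgN; exact: cf. Qed.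

Section FixedTime.
Variables (chi chi1 : R -> R) (t : R).
Hypothesis dchi : forall x, is_derive x 1 chi (chi1 x).
Hypothesis cchi1 : continuous chi1.

Lemma is_derive_left1 x : is_derive x 1 (left1 chi t) (left2 chi1 t x).
Proof.
have h1 := is_derive_shift (t + 1 - a) dchi x; have h2 := is_derive_shift (t - 1 + a) dchi x.
have h3 := is_derive_reflect (t + 1 - a) dchi x; have h4 := is_derive_reflect (t - 1 + a) dchi x.
by apply: is_derive_eq.
Qed.

Lemma is_derive_left2 x : is_derive x 1 (left2 chi t) (left1 chi1 t x).
Proof.
have h1 := is_derive_shift (t + 1 - a) dchi x; have h2 := is_derive_shift (t - 1 + a) dchi x.
have h3 := is_derive_reflect (t + 1 - a) dchi x; have h4 := is_derive_reflect (t - 1 + a) dchi x.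
by apply: is_derive_eq; rewrite /left1 !opprK.
Qed.

Lemma is_derive_right1 x : is_derive x 1 (right1 chi t) (right2 chi1 t x).
Proof.
have h1 := is_derive_reflect (t + 1 + a) dchi x; have h2 := is_derive_reflect (t + 1 - a) dchi x.
have h3 := is_derive_shift (t - 1 + a) dchi x; have h4 := is_derive_shift (t - 1 - a) dchi x.
by apply: is_derive_eq; rewrite /right2 opprK.
Qed.

Lemma is_derive_right2 x : is_derive x 1 (right2 chi t) (right1 chi1 t x).
Proof.
have h1 := is_derive_reflect (t + 1 + a) dchi x; have h2 := is_derive_reflect (t + 1 - a) dchi x.
have h3 := is_derive_shift (t - 1 + a) dchi x; have h4 := is_derive_shift (t - 1 - a) dchi x.
by apply: is_derive_eq; rewrite /right1 opprK.
Qed.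

End FixedTime.

Section Continuity.
Variables (chi : R -> R) (t : R).
Hypothesis cchi : continuous chi.

Lemma continuous_left1 : continuous (left1 chi t).
Proof.
by rewrite /left1; do !apply: continuous_add; try apply: continuous_opp;
  first [exact: continuous_shift|exact: continuous_reflect].
Qed.

Lemma continuous_left2 : continuous (left2 chi t).
Proof.
by rewrite /left2; do !apply: continuous_add; try apply: continuous_opp;
  first [exact: continuous_shift|exact: continuous_reflect].
Qed.

Lemma continuous_right1 : continuous (right1 chi t).
Proof.
by rewrite /right1; do !apply: continuous_add; try apply: continuous_opp;
  first [exact: continuous_shift|exact: continuous_reflect].
Qed.

Lemma continuous_right2 : continuous (right2 chi t).
Proof.
by rewrite /right2; do !apply: continuous_add; try apply: continuous_opp;
  first [exact: continuous_shift|exact: continuous_reflect].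
Qed.

Lemma L2_wave1 : L2 0 1 (wave1 chi t).
Proof. by apply: L2_glue => //; apply: L2_cont; [exact: continuous_left1|exact: continuous_right1]. Qed.

Lemma L2_wave2 : L2 0 1 (wave2 chi t).
Proof. by apply: L2_glue => //; apply: L2_cont; [exact: continuous_left2|exact: continuous_right2]. Qed.

End Continuity.

Lemma left2_0 chi t : left2 chi t 0 = 0.
Proof. by rewrite /left2 !add0r !subr0; ring. Qed.

Lemma right1_1 chi t : right1 chi t 1 = 0.
Proof.
rewrite /right1.
have -> : t + 1 + a - 1 = t + a by ring.
have -> : t + 1 - a - 1 = t - a by ring.
have -> : 1 + (t - 1 + a) = t + a by ring.
have -> : 1 + (t - 1 - a) = t - a by ring.
by ring.
Qed.

Lemma wave_at_a chi t : left2 chi t a = right2 chi t a.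
Proof.
rewrite /left2 /right2.
have -> : a + (t + 1 - a) = t + 1 + a - a by ring.
have -> : t - 1 + a - a = a + (t - 1 - a) by ring.
by ring.
Qed.

(** [z_t] vanishes at 0 and is continuous at [a], so integrating its space derivative across [a]
    leaves no jump term. *)
Lemma prim_wave chi chi1 t x : (forall x, is_derive x 1 chi (chi1 x)) -> continuous chi1 ->
  0 <= x -> x <= 1 -> prim 0 (wave1 chi1 t) x = wave2 chi t x.
Proof.
move=> dchi cchi x0 x1.
have cl := @continuous_left1 chi1 t cchi; have cr := @continuous_right1 chi1 t cchi.
have Pl y : 0 <= y -> y <= a -> prim 0 (wave1 chi1 t) y = left2 chi t y.
  move=> y0 ya; transitivity (\int[mu]_(z in `]0, y[) left1 chi1 t z).
    by apply: eq_int => z /andP[_ zy]; rewrite /wave1 /gluef (lt_le_trans zy ya).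
  by rewrite (int_FTC y0 (is_derive_left2 t dchi) cl) left2_0 subr0.
have [xa|ax] := ltP x a; first by rewrite Pl ?(ltW xa)// /wave2 /gluef xa.
rewrite /prim (int_split (ltW a_gt0) ax); last first.
  exact: itg_sub (L2_itg (L2_wave1 t cchi)).
rewrite -/(prim 0 (wave1 chi1 t) a) Pl// ?ltW//.
have -> : \int[mu]_(y in `]a, x[) wave1 chi1 t y = \int[mu]_(y in `]a, x[) right1 chi1 t y.
  by apply: eq_int => z /andP[az _]; rewrite /wave1 /gluef ltNge (ltW az).
rewrite (int_FTC ax (is_derive_right2 t dchi) cr) wave_at_a /wave2 /gluef ltNge ax/=.
by rewrite addrC subrK.
Qed.

(** It vanishes on the frequencies [lam n]: as [cos (lam n) = 0], the values at [t + 1] and [t - 1]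
    are then opposite. *)
Definition kick chi t := 2 * (chi (t + 1) + chi (t - 1)).

Lemma kickE chi t : left1 chi t a - right1 chi t a = kick chi t.
Proof.
rewrite /left1 /right1 /kick.
have -> : a + (t + 1 - a) = t + 1 by ring.
have -> : t - 1 + a - a = t - 1 by ring.
have -> : t + 1 + a - a = t + 1 by ring.
have -> : a + (t - 1 - a) = t - 1 by ring.
by ring.
Qed.

(** Integrating the space derivative of [z_x] from [x] to 1 meets the jump at [a] exactly when
    [x < a]. *)
Lemma coprim_wave chi chi1 t x : (forall x, is_derive x 1 chi (chi1 x)) -> continuous chi1 ->
  0 <= x -> x <= 1 ->
  coprim 1 (wave2 chi1 t) x = - 1 * wave1 chi t x + kick chi t * before a x.
Proof.
move=> dchi cchi x0 x1.
have cl := @continuous_left2 chi1 t cchi; have cr := @continuous_right2 chi1 t cchi.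
have Pr y : a <= y -> y <= 1 -> coprim 1 (wave2 chi1 t) y = - right1 chi t y.
  move=> ay y1; transitivity (\int[mu]_(z in `]y, 1[) right2 chi1 t z).
    by apply: eq_int => z /andP[yz _]; rewrite /wave2 /gluef ltNge (le_trans ay (ltW yz)).
  by rewrite (int_FTC y1 (is_derive_right1 t dchi) cr) right1_1 sub0r.
rewrite /before; have [xa|ax] := ltP x a; last first.
  by rewrite Pr// /wave1 /gluef ltNge ax/= mulr0 addr0 mulN1r.
rewrite /coprim (int_split (ltW xa) (ltW a_lt1)); last first.
  exact: itg_sub (L2_itg (L2_wave2 t cchi)).
rewrite -/(coprim 1 (wave2 chi1 t) a) Pr// ?ltW//.
have -> : \int[mu]_(y in `]x, a[) wave2 chi1 t y = \int[mu]_(y in `]x, a[) left2 chi1 t y.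
  by apply: eq_int => z /andP[_ za]; rewrite /wave2 /gluef za.
rewrite (int_FTC (ltW xa) (is_derive_left1 t dchi) cl) /wave1 /gluef xa -kickE mulr1; ring.
Qed.

(** A shift in time is a shift of the profile, so expansions of a wave in time follow from those of
    its profile. *)
Lemma wave_time chi t e x :
  wave1 chi (t + e) x = gluef a (left1 (fun y => chi (y + e)) t) (right1 (fun y => chi (y + e)) t) x /\
  wave2 chi (t + e) x = gluef a (left2 (fun y => chi (y + e)) t) (right2 (fun y => chi (y + e)) t) x.
Proof.
have E1 : x + (t + e + 1 - a) = x + (t + 1 - a) + e by ring.
have E2 : x + (t + e - 1 + a) = x + (t - 1 + a) + e by ring.
have E3 : t + e + 1 - a - x = t + 1 - a - x + e by ring.
have E4 : t + e - 1 + a - x = t - 1 + a - x + e by ring.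
have E5 : t + e + 1 + a - x = t + 1 + a - x + e by ring.
have E6 : x + (t + e - 1 - a) = x + (t - 1 - a) + e by ring.
by rewrite /wave1 /wave2 /gluef /left1 /left2 /right1 /right2 E1 E2 E3 E4 E5 E6.
Qed.

Lemma wave_bound chi t x (B : R) : (forall y, `|chi y| <= B) ->
  `|wave1 chi t x| <= 4 * B /\ `|wave2 chi t x| <= 4 * B.
Proof.
move=> H.
have n4 (p1 p2 p3 p4 : R) : `|p1| <= B -> `|p2| <= B -> `|p3| <= B -> `|p4| <= B ->
    `|p1 + p2 + p3 + p4| <= 4 * B.
  move=> h1 h2 h3 h4; rewrite (le_trans (ler_normD _ _))//.
  by have := ler_normD (p1 + p2) p3; have := ler_normD p1 p2; lra.
rewrite /wave1 /wave2 /gluef /left1 /left2 /right1 /right2.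
by case: ifP => _; split; apply: n4; rewrite ?normrN; exact: H.
Qed.

Lemma wave_lin (k l m : R) f1 f2 f3 t x :
  wave1 (fun y => k * f1 y + l * f2 y + m * f3 y) t x =
    k * wave1 f1 t x + l * wave1 f2 t x + m * wave1 f3 t x /\
  wave2 (fun y => k * f1 y + l * f2 y + m * f3 y) t x =
    k * wave2 f1 t x + l * wave2 f2 t x + m * wave2 f3 t x.
Proof.
by rewrite /wave1 /wave2 /gluef /left1 /left2 /right1 /right2; case: ifP => _; split; ring.
Qed.

Variables (S : R -> state R -> state R).
Hypothesis sgS : contraction_semigroup (@X2 R) (@normX2 R) S.
Hypothesis genS : generated_by (@X2 R) (@normX2 R) (graph_A2 a) S.
Variables (U0 W0 : state R).
Hypotheses (XU0 : X2 U0) (XW0 : X2 W0) (gUW : graph_A2 a U0 W0).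

(** This is [kick chi t] minus the value of [wave2 chi t] at [a]: the jump of the wave, and the
    contribution of the damping. *)
Definition observer chi t : R :=
  chi (t + 1) + 3 * chi (t - 1) + chi (t + 1 - 2 * a) - chi (t - 1 + 2 * a).

Definition test_pairing chi t0 s :=
  pairing (S s U0) (wave1 chi (s - t0)) (wave2 chi (s - t0)).

(** The bulk terms cancel because the wave is a solution away from [a]. What remains is the jump of
    [z_x] met by [v(a)], and the damping force [- v(a)] met by [z_t(a)]. *)
Lemma test_pairing_derive chi chi1 t0 s : tame chi chi1 -> 0 < s ->
  is_derive s 1 (test_pairing chi t0) (probe a (S s U0) * observer chi (s - t0)).
Proof.
move=> tc s0; have s00 := ltW s0.
have cc := tame_continuous tc; have cc1 := tame_continuous1 tc.
have dc := tc.1.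
have [B B0 HB] := tame_remainder tc.
set tau := s - t0.
have gt := trajectory_graph sgS genS XU0 XW0 gUW s00.
have Xt := semigroup_stable sgS s00 XW0.
have [hU hW Ef _ _] := graph_snapshot a_gt0 a_lt1 Xt gt.
have lq := der_L2 hW.
have <- : pairing (S s W0) (wave1 chi tau) (wave2 chi tau) +
    pairing (S s U0) (wave1 chi1 tau) (wave2 chi1 tau) =
    probe a (S s U0) * observer chi tau.
  have l1 := L2_wave1 tau cc1; have l2 := L2_wave2 tau cc1.
  have m1 := L2_wave1 tau cc; have m2 := L2_wave2 tau cc.
  have lb := L2_before 0 1 a.
  rewrite {2}/pairing (graph_dual a_gt0 a_lt1 Xt gt l2 l1) (prim_wave tau dc cc1 (ltW a_gt0) (ltW a_lt1)).
  have -> : ip2 (der (S s W0)) (S s W0).2 (coprim 1 (wave2 chi1 tau)) (fun x => - prim 0 (wave1 chi1 tau) x) =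
      ip 0 1 (der (S s W0)) (fun x => - 1 * wave1 chi tau x + kick chi tau * before a x) +
      ip 0 1 (S s W0).2 (fun x => - 1 * wave2 chi tau x).
    congr (_ + _); apply: eq_int => x /andP[x0 x1].
      by rewrite (coprim_wave tau dc cc1 (ltW x0) (ltW x1)).
    by rewrite (prim_wave tau dc cc1 (ltW x0) (ltW x1)) mulN1r.
  rewrite ipC (ip_lin (- 1) m1 (L2Z (kick chi tau) lb) lq) (ipZl (kick chi tau) lb lq).
  rewrite [ip 0 1 _ (fun x => - 1 * _)]ipC (ipZl (- 1) m2 hW.2).
  rewrite (ipC _ _ (before a)) (ip_before _ lq); last by rewrite !ltW.
  rewrite -/(prim 0 (der (S s W0)) a) -Ef.
  rewrite /pairing /ip2 (ipC _ _ (der _) (wave1 _ _)) (ipC _ _ _ (wave2 chi tau)).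
  have -> : wave2 chi tau a = right2 chi tau a by rewrite /wave2 /gluef ltxx.
  have -> : right2 chi tau a = chi (tau + 1) - chi (tau + 1 - 2 * a) + chi (tau - 1 + 2 * a) - chi (tau - 1).
    rewrite /right2.
    have -> : tau + 1 + a - a = tau + 1 by ring.
    have -> : tau + 1 - a - a = tau + 1 - 2 * a by ring.
    have -> : a + (tau - 1 + a) = tau - 1 + 2 * a by ring.
    by have -> : a + (tau - 1 - a) = tau - 1 by ring.
  rewrite /observer /kick.
  move: (ip 0 1 _ _) (ip 0 1 _ (S s W0).2) (probe a _) => p1 p2 p3; ring.
have te e : s + e - t0 = tau + e by rewrite /tau addrAC.
have B4 : 0 <= 4 * B by rewrite mulr_ge0.
rewrite /test_pairing.
apply: (@pairing_derive R a S sgS genS U0 W0 XU0 XW0 gUW s (fun s => wave1 chi (s - t0)) (fun s => wave2 chi (s - t0))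
   (wave1 chi1 tau) (wave2 chi1 tau) (4 * B)) => //.
- by move=> z; split; [exact: L2_wave1|exact: L2_wave2].
- exact: L2_wave1.
- exact: L2_wave2.
- by move=> x _; apply: wave_bound => y; have [] := HB y 0.
- move=> e x _ _; rewrite te -/tau.
  have [-> ->] := wave_time chi tau e x.
  have [H1 H2] := wave_lin (- 1) 1 0 chi (fun y => chi (y + e)) (cst 0) tau x.
  rewrite !mul1r !mul0r !addr0 in H1 H2; rewrite -[in X in X /\ _]H1 -[in X in _ /\ X]H2.
  rewrite -[4 * B * _]mulrA; apply: wave_bound => y.
  by rewrite mul0r addr0 mul1r mulN1r addrC; have [] := HB y e.
- move=> e x _ _; rewrite te -/tau.
  have [-> ->] := wave_time chi tau e x.
  have [H1 H2] := wave_lin (- e) (- 1) 1 chi1 chi (fun y => chi (y + e)) tau x.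
  rewrite !mul1r -!addrA in H1 H2; rewrite -[in X in X /\ _]H1 -[in X in _ /\ X]H2.
  rewrite -[4 * B * _]mulrA; apply: wave_bound => y.
  have -> : - e * chi1 y + -1 * chi y + 1 * chi (y + e) = chi (y + e) - chi y - e * chi1 y by ring.
  by have [] := HB y e.
Qed.

End Waves.

End Observability.

(** * Trigonometric profiles *)

Section Profiles.
Variable R : realType.
Notation mu := (@lebesgue_measure R).
Implicit Types (c d x y t s e : R) (f g u v w phi h q chi : R -> R) (U W Z A B C : state R).
Implicit Types (al be : nat -> R).
Notation lam := (@lam R).

Section TrigWaves.
Variable a : R.

(** Since [cos (lam n) = 0] and [sin (lam n) = (-1) ^+ n], the formulas on the two sides of [a]
    agree and give one mode with weight [sin (lam n * a)]: in the strain for a cosine profile, in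
    the velocity for a sine profile. *)
Lemma wave_cos n x :
  wave1 a (fun y => cos (lam n * y)) 0 x = 4 * ((-1) ^+ n * sin (lam n * a)) * cos (lam n * x) /\
  wave2 a (fun y => cos (lam n * y)) 0 x = 0.
Proof.
set k := lam n.
have A1 : k * (x + (0 + 1 - a)) = k * x + (k - k * a) by ring.
have A2 : k * (x + (0 - 1 + a)) = k * x - (k - k * a) by ring.
have A3 : k * (0 + 1 - a - x) = (k - k * a) - k * x by ring.
have A4 : k * (0 - 1 + a - x) = - (k * x + (k - k * a)) by ring.
have A5 : k * (0 + 1 + a - x) = (k + k * a) - k * x by ring.
have A6 : k * (x + (0 - 1 - a)) = k * x - (k + k * a) by ring.
rewrite /wave1 /wave2 /gluef /left1 /left2 /right1 /right2 A1 A2 A3 A4 A5 A6.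
rewrite ?cosN !(cosB, sinB, cosD, sinD) cos_lam sin_lam.
by case: ifP => _; split; ring.
Qed.

Lemma wave_sin n x :
  wave1 a (fun y => sin (lam n * y)) 0 x = 0 /\
  wave2 a (fun y => sin (lam n * y)) 0 x = 4 * ((-1) ^+ n * sin (lam n * a)) * sin (lam n * x).
Proof.
set k := lam n.
have A1 : k * (x + (0 + 1 - a)) = k * x + (k - k * a) by ring.
have A2 : k * (x + (0 - 1 + a)) = k * x - (k - k * a) by ring.
have A3 : k * (0 + 1 - a - x) = (k - k * a) - k * x by ring.
have A4 : k * (0 - 1 + a - x) = - (k * x + (k - k * a)) by ring.
have A5 : k * (0 + 1 + a - x) = (k + k * a) - k * x by ring.
have A6 : k * (x + (0 - 1 - a)) = k * x - (k + k * a) by ring.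
rewrite /wave1 /wave2 /gluef /left1 /left2 /right1 /right2 A1 A2 A3 A4 A5 A6.
rewrite ?sinN !(cosB, sinB, cosD, sinD) cos_lam sin_lam.
by case: ifP => _; split; ring.
Qed.

Definition trigpoly N al be x : R :=
  \sum_(i < N) (al i * cos (lam i * x) + be i * sin (lam i * x)).

Lemma wave_trigpoly N al be x :
  wave1 a (trigpoly N al be) 0 x =
    \sum_(i < N) 4 * ((-1) ^+ i * sin (lam i * a)) * al i * cos (lam i * x) /\
  wave2 a (trigpoly N al be) 0 x =
    \sum_(i < N) 4 * ((-1) ^+ i * sin (lam i * a)) * be i * sin (lam i * x).
Proof.
elim: N => [|N [IH1 IH2]].
  rewrite !big_ord0; have -> : trigpoly 0 al be = cst 0 by apply/funext => y; rewrite /trigpoly big_ord0.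
  by rewrite /wave1 /wave2 /gluef /left1 /left2 /right1 /right2 /=; case: ifP => _; split; ring.
have -> : trigpoly N.+1 al be =
    fun y => 1 * trigpoly N al be y + al N * cos (lam N * y) + be N * sin (lam N * y).
  by apply/funext => y; rewrite /trigpoly big_ord_recr/= mul1r addrA.
have [-> ->] := wave_lin a 1 (al N) (be N) (trigpoly N al be) (fun y => cos (lam N * y)) (fun y => sin (lam N * y)) 0 x.
rewrite IH1 IH2 !big_ord_recr/=.
have [-> ->] := wave_cos N x; have [-> ->] := wave_sin N x.
by split; ring.
Qed.

End TrigWaves.

(** Sums and differences of the [lam n] are integer multiples of [pi], so products of modes have
    period 2. *)
Lemma cos_lam_period n m (k : R) x : (k = lam n - lam m \/ k = lam n + lam m) ->
  sin (k * (x + 2)) = sin (k * x) /\ cos (k * (x + 2)) = cos (k * x).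
Proof.
move=> H; have sk : sin k = 0 by case: H => ->; rewrite ?sin_lamB ?sin_lamD.
have ck : cos k ^+ 2 = 1 by rewrite cos2sin2 sk expr0n subr0.
have -> : k * (x + 2) = k * x + (k + k) by ring.
rewrite !(sinD, cosD) sk !mulr0 !mul0r subr0 addr0 -expr2 ck.
by split; ring.
Qed.

Lemma trig_period_ortho n m s :
  [/\ ip s (s + 2) (fun x => cos (lam n * x)) (fun x => cos (lam m * x)) = (n == m)%:R,
      ip s (s + 2) (fun x => sin (lam n * x)) (fun x => sin (lam m * x)) = (n == m)%:R &
      ip s (s + 2) (fun x => sin (lam n * x)) (fun x => cos (lam m * x)) = 0].
Proof.
have s2 : s <= s + 2 by rewrite lerDl.
have S0 : lam n + lam m != 0 by rewrite gt_eqF// addr_gt0 ?lam_gt0.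
rewrite ip_cos_cos// ip_sin_sin// ip_sin_cos// (int_cosM S0 s2) (int_sinM S0 s2).
have [-> ->] := @cos_lam_period n m _ s (or_intror erefl).
rewrite !subrr !mul0r !addr0 subr0.
have [<-|nm] := eqVneq n m.
  rewrite subrr int_cos0//.
  have -> : \int[mu]_(x in `]s, s + 2[) sin (0 * x) = 0.
    by under eq_Rintegral do rewrite mul0r sin0; rewrite int_cst// mul0r.
  have -> : s + 2 - s = 2 by ring.
  by split; rewrite ?mulr0//; apply: mulVf; rewrite pnatr_eq0.
rewrite (int_cosM (lamB_neq0 R nm) s2) (int_sinM (lamB_neq0 R nm) s2).
have [-> ->] := @cos_lam_period n m _ s (or_introl erefl).
by rewrite !subrr !mul0r !mulr0; split.
Qed.

Lemma trigpoly_tame N al be : exists q1, tame (trigpoly N al be) q1.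
Proof.
eexists; apply: (@tame_sum R N (fun i x => al i * cos (lam i * x) + be i * sin (lam i * x))
  (fun i x => al i * - (lam i * sin (lam i * x)) + be i * (lam i * cos (lam i * x)))) => i.
by apply: tameD; apply: tameZ; [exact: tame_cosM|exact: tame_sinM].
Qed.

(** Parseval over an interval of length 2, wherever it starts; the modes have norm 1 there. *)
Lemma trigpoly_mean N al be s :
  ip s (s + 2) (trigpoly N al be) (trigpoly N al be) = \sum_(i < N) (al i ^+ 2 + be i ^+ 2).
Proof.
pose F i x := al i * cos (lam i * x) + be i * sin (lam i * x).
have lc i : L2 s (s + 2) (fun x => cos (lam i * x)) by exact: L2_cosM.
have ls i : L2 s (s + 2) (fun x => sin (lam i * x)) by exact: L2_sinM.
have lF i : L2 s (s + 2) (F i) by apply: L2D; exact: L2Z.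
have lq : L2 s (s + 2) (fun x => \sum_(i < N) F i x) by exact: L2_sum.
rewrite (ip_suml _ lF lq); apply: eq_bigr => i _.
rewrite ipC (ip_suml _ lF (lF i)) (bigD1 i)//= big1 ?addr0 => [|j /negPf ji];
  rewrite /F (ip_lin _ (lc _) (L2Z _ (ls _)) (lF _)) (ipZl _ (ls _) (lF _)).
  rewrite ![ip _ _ _ (F _)]ipC !(ip_lin _ (lc _) (L2Z _ (ls _)) _)// !ipZl//.
  have [h1 h2 h3] := trig_period_ortho i i s.
  have h4 : ip s (s + 2) (fun x => cos (lam i * x)) (fun x => sin (lam i * x)) = 0 by rewrite ipC.
  by rewrite h1 h2 h3 h4 eqxx /=; ring.
rewrite ![ip _ _ _ (F _)]ipC !(ip_lin _ (lc _) (L2Z _ (ls _)) _)// !ipZl//.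
have [h1 h2 h3] := trig_period_ortho i j s; have [_ _ h4] := trig_period_ortho j i s.
have h5 : ip s (s + 2) (fun x => cos (lam i * x)) (fun x => sin (lam j * x)) = 0 by rewrite ipC.
have ij : (i == j :> nat) = false by rewrite eq_sym; exact: ji.
by rewrite h1 h2 h3 h5 ij /=; ring.
Qed.

Lemma antiderivative f c x : continuous f -> c < x ->
  is_derive x 1 (fun s => \int[mu]_(y in `]c, s]) f y) (f x).
Proof.
move=> cf cx; have xu : x < x + 1 by rewrite ltrDl.
have [|||h1 h2] := @continuous_FTC1 R f (BRight c) x (x + 1) xu.
- apply: integrableS (itg_cont c (x + 2) cf) => //.
  move=> y /=; rewrite !in_itv/= => /andP[-> yx]; rewrite (le_lt_trans yx)//.
  by rewrite ltrD2l ltr1n.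
- by rewrite lte_bnd || exact: cx.
- exact: cf.
by apply: DeriveDef; [exact: h1|rewrite -derive1E; exact: h2].
Qed.

Lemma antiderivative_shift f c x l : continuous f -> c < x + l ->
  is_derive x 1 (fun s => \int[mu]_(y in `]c, s + l]) f y) (f (x + l)).
Proof.
move=> cf cx.
have d1 : is_derive x 1 (fun x : R => x + l) 1 by apply: is_derive_eq; rewrite addr0.
have := @is_derive1_comp _ (fun s => \int[mu]_(y in `]c, s]) f y) (fun x => x + l) x _ _ (antiderivative cf cx) d1.
by move=> d2; apply: is_derive_eq; rewrite mulr1.
Qed.

(** The observation time 4 covers two periods of the squared profile. *)
Lemma antiderivative_trigpoly N al be c s : c <= s ->
  \int[mu]_(y in `]c, s + 4]) trigpoly N al be y ^+ 2 =
  \int[mu]_(y in `]c, s]) trigpoly N al be y ^+ 2 + 2 * \sum_(i < N) (al i ^+ 2 + be i ^+ 2).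
Proof.
move=> cs; have [q1 tq] := trigpoly_tame N al be; have cq := tame_continuous tq.
have iq d d' : itg d d' (fun y => trigpoly N al be y ^+ 2) by apply: L2_sq; exact: L2_cont.
rewrite !int_oc// (int_split cs _ (iq _ _)) ?lerDl//.
have s2 : s <= s + 2 by rewrite lerDl.
have s4 : s + 2 <= s + 4 by rewrite lerD2l ler_nat.
rewrite (int_split s2 s4 (iq _ _)).
have -> : s + 4 = s + 2 + 2 by rewrite -addrA -natrD.
have E d : \int[mu]_(y in `]d, d + 2[) trigpoly N al be y ^+ 2 = \sum_(i < N) (al i ^+ 2 + be i ^+ 2).
  by rewrite -(trigpoly_mean N al be d); apply: eq_int => x _; rewrite expr2.
by rewrite !E; ring.
Qed.

End Profiles.

(** * Observability of the weighted modes *)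

Section ObservabilityInequality.
Variable R : realType.
Notation mu := (@lebesgue_measure R).
Implicit Types (c d x y t s e : R) (f g u v w phi h q chi : R -> R) (U W Z A B C : state R).
Implicit Types (al be : nat -> R).
Notation lam := (@lam R).

Variable a : R.
Hypotheses (a_gt0 : 0 < a) (a_lt1 : a < 1).

Lemma pairing_eq U f1 f2 g1 g2 : (forall x, 0 < x < 1 -> f1 x = g1 x /\ f2 x = g2 x) ->
  pairing U f1 f2 = pairing U g1 g2.
Proof.
by move=> H; congr (_ + _); apply: eq_int => x x01; have [h1 h2] := H x x01; rewrite ?h1 ?h2.
Qed.

Lemma pairing0 U : pairing U (cst 0) (cst 0) = 0.
Proof.
rewrite /pairing /ip2 /ip.
by under eq_int => x _ do rewrite /= mulr0; rewrite int_cst// mul0r; under eq_int => x _ do rewrite /= mulr0; rewrite int_cst// mul0r addr0.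
Qed.

(** At time [t] all arguments of the profile lie in [[t - 1, t + 1]]. A profile vanishing from 3 on
    is therefore extinct at time 4, and its values up to 1 determine the data at time 0, see
    [wave_initial]. *)
Lemma wave_vanish chi x : (forall y, 3 <= y -> chi y = 0) -> 0 < x < 1 ->
  wave1 a chi 4 x = 0 /\ wave2 a chi 4 x = 0.
Proof.
move=> H /andP[x0 x1].
have a0 := a_gt0; have a1 := a_lt1.
rewrite /wave1 /wave2 /gluef /left1 /left2 /right1 /right2.
by case: ltP => xa; split; rewrite !H ?subr0 ?addr0 ?oppr0 ?add0r//; lra.
Qed.

Lemma wave_initial chi q x : (forall y, y <= 1 -> chi y = q y) -> 0 < x < 1 ->
  wave1 a chi 0 x = wave1 a q 0 x /\ wave2 a chi 0 x = wave2 a q 0 x.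
Proof.
move=> H /andP[x0 x1].
have a0 := a_gt0; have a1 := a_lt1.
rewrite /wave1 /wave2 /gluef /left1 /left2 /right1 /right2.
by case: ltP => xa; split; rewrite !H//; lra.
Qed.

(** Cauchy-Schwarz with weights 1, 3, 1, 1, of sum 6. *)
Lemma observer_bound chi q t : (forall y, `|chi y| <= `|q y|) ->
  observer a chi t ^+ 2 <= 6 * (q (t + 1) ^+ 2 + 3 * q (t - 1) ^+ 2 +
    q (t + 1 - 2 * a) ^+ 2 + q (t - 1 + 2 * a) ^+ 2).
Proof.
move=> H; have H2 y : chi y ^+ 2 <= q y ^+ 2 by rewrite -(real_normK (num_real (chi y))) -(real_normK (num_real (q y))) lerXn2r ?nnegrE.
have := (H2 (t + 1), H2 (t - 1), H2 (t + 1 - 2 * a), H2 (t - 1 + 2 * a)).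
rewrite /observer; move: (chi (t + 1)) (chi (t - 1)) (chi (t + 1 - 2 * a)) (chi (t - 1 + 2 * a)).
move: (q (t + 1)) (q (t - 1)) (q (t + 1 - 2 * a)) (q (t - 1 + 2 * a)) => q1 q2 q3 q4 p1 p2 p3 p4.
move=> -[[[h1 h2] h3] h4].
have := sqr_ge0 (p1 - p2); have := sqr_ge0 (p1 - p3); have := sqr_ge0 (p1 + p4).
have := sqr_ge0 (p2 - p3); have := sqr_ge0 (p2 + p4); have := sqr_ge0 (p3 + p4).
by lra.
Qed.

Variables (S : R -> state R -> state R).
Hypothesis sgS : contraction_semigroup (@X2 R) (@normX2 R) S.
Hypothesis genS : generated_by (@X2 R) (@normX2 R) (graph_A2 a) S.
Variables (U0 W0 : state R).
Hypotheses (XU0 : X2 U0) (XW0 : X2 W0) (gUW : graph_A2 a U0 W0).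

Let E := energy S U0.

Lemma test_pairing_final chi t0 : (forall y, 3 <= y -> chi y = 0) ->
  test_pairing a S U0 chi t0 (t0 + 4) = 0.
Proof.
move=> H; rewrite /test_pairing -[RHS](pairing0 (S (t0 + 4) U0)); apply: pairing_eq => x x01.
have -> : t0 + 4 - t0 = 4 by ring.
exact: wave_vanish.
Qed.

Lemma test_pairing_initial chi N al be t0 : 0 <= t0 ->
  (forall y, y <= 1 -> chi y = trigpoly N al be y) ->
  test_pairing a S U0 chi t0 t0 =
  \sum_(i < N) 4 * ((-1) ^+ i * sin (lam i * a)) *
    (al i * ip 0 1 (der (S t0 U0)) (fun x => cos (lam i * x)) +
     be i * ip 0 1 (S t0 U0).2 (fun x => sin (lam i * x))).
Proof.
move=> t00 H; have hU := X2_HX (semigroup_stable sgS t00 XU0).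
have lG := der_L2 hU; have lv := hU.2.
pose F i x := 4 * ((-1) ^+ i * sin (lam i * a)) * al i * cos (lam i * x).
pose G i x := 4 * ((-1) ^+ i * sin (lam i * a)) * be i * sin (lam i * x).
have lc i : L2 0 1 (fun x => cos (lam i * x)) by exact: L2_cosM.
have ls i : L2 0 1 (fun x => sin (lam i * x)) by exact: L2_sinM.
have lF i : L2 0 1 (F i) by exact: L2Z.
have lGi i : L2 0 1 (G i) by exact: L2Z.
transitivity (pairing (S t0 U0) (fun x => \sum_(i < N) F i x) (fun x => \sum_(i < N) G i x)).
  rewrite /test_pairing subrr; apply: pairing_eq => x x01.
  by have [-> ->] := wave_initial H x01; exact: wave_trigpoly.
rewrite /pairing /ip2 ipC (ip_suml _ lF lG) (ipC _ _ (S t0 U0).2) (ip_suml _ lGi lv) -big_split/=.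
apply: eq_bigr => i _; rewrite (ipZl _ (lc i) lG) (ipZl _ (ls i) lv).
by rewrite (ipC _ _ (der _)) (ipC _ _ (S t0 U0).2); ring.
Qed.

(** The functional [Phi] below is nonincreasing: Young's inequality absorbs the
    derivative of the pairing into the dissipation [- 9 f^2] and into the
    derivative of the primitives [P] of [q^2], so that no integrability of [f]
    in time is needed. *)
Lemma modal_observability N al be t0 : 0 < t0 ->
  \sum_(i < N) 4 * ((-1) ^+ i * sin (lam i * a)) *
    (al i * ip 0 1 (der (S t0 U0)) (fun x => cos (lam i * x)) +
     be i * ip 0 1 (S t0 U0).2 (fun x => sin (lam i * x)))
  <= 9 / 2 * (E t0 - E (t0 + 4)) + 2 * \sum_(i < N) (al i ^+ 2 + be i ^+ 2).
Proof.
move=> t00; set q := trigpoly N al be.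
have [q1 tq] := trigpoly_tame N al be.
pose chi x := cutoff x * q x.
have tc := tameM (tame_cutoff R) tq.
have chi3 y : 3 <= y -> chi y = 0 by move=> y3; rewrite /chi cutoff_zero// mul0r.
have chi1 y : y <= 1 -> chi y = q y by move=> y1; rewrite /chi cutoff_one// mul1r.
have chin y : `|chi y| <= `|q y| by rewrite normrM ler_piMl// cutoff_norm.
rewrite -(test_pairing_initial (ltW t00) chi1).
have cq := tame_continuous tq.
have cq2 : continuous (fun x => q x ^+ 2).
  by have := tame_continuous (tameM tq tq); under eq_fun do rewrite -expr2.
(* For [s >= t0] the arguments of [P] used below are at least -1, so the base point -2 lies strictly
   to their left. *)
pose P s := \int[mu]_(y in `]-2, s]) q y ^+ 2.
have E1 s : s - t0 + 1 = s + (1 - t0) by ring.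
have E2 s : s - t0 - 1 = s + (- 1 - t0) by ring.
have E3 s : s - t0 + 1 - 2 * a = s + (1 - t0 - 2 * a) by ring.
have E4 s : s - t0 - 1 + 2 * a = s + (- 1 - t0 + 2 * a) by ring.
(* Write [k] for the observer and [K] for the weighted sum of squares of [q]. As [k ^+ 2 <= 6 * K],
   the derivative is at most [- (3 * f + k / 6) ^+ 2]: this matches 1/6 with 9/2. Over the window
   the primitives, of total weight 6, contribute twice the sum of the squared coefficients. *)
pose Phi s := - test_pairing a S U0 chi t0 s + 9 / 2 * E s - 6^-1 *
  (P (s + (1 - t0)) + 3 * P (s + (- 1 - t0)) + P (s + (1 - t0 - 2 * a)) + P (s + (- 1 - t0 + 2 * a))).
pose dPhi s := - (probe a (S s U0) * observer a chi (s - t0)) + 9 / 2 * (- 2 * probe a (S s U0) ^+ 2) - 6^-1 *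
  (q (s + (1 - t0)) ^+ 2 + 3 * q (s + (- 1 - t0)) ^+ 2 + q (s + (1 - t0 - 2 * a)) ^+ 2 + q (s + (- 1 - t0 + 2 * a)) ^+ 2).
have a0 := a_gt0; have a1 := a_lt1.
have dP s : t0 <= s -> is_derive s 1 Phi (dPhi s).
  move=> ts; have s0 : 0 < s by exact: lt_le_trans ts.
  have d1 := test_pairing_derive a_gt0 a_lt1 sgS genS XU0 XW0 gUW t0 tc s0.
  have d2 := energy_derive sgS genS XU0 XW0 gUW a_gt0 a_lt1 s0.
  have d3 : is_derive s 1 (fun s => P (s + (1 - t0))) (q (s + (1 - t0)) ^+ 2).
    by apply: (antiderivative_shift cq2); lra.
  have d4 : is_derive s 1 (fun s => P (s + (- 1 - t0))) (q (s + (- 1 - t0)) ^+ 2).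
    by apply: (antiderivative_shift cq2); lra.
  have d5 : is_derive s 1 (fun s => P (s + (1 - t0 - 2 * a))) (q (s + (1 - t0 - 2 * a)) ^+ 2).
    by apply: (antiderivative_shift cq2); lra.
  have d6 : is_derive s 1 (fun s => P (s + (- 1 - t0 + 2 * a))) (q (s + (- 1 - t0 + 2 * a)) ^+ 2).
    by apply: (antiderivative_shift cq2); lra.
  have d3' : is_derive s 1 (fun s => 3 * P (s + (- 1 - t0))) (3 * q (s + (- 1 - t0)) ^+ 2).
    exact: is_deriveZ d4.
  have d7 := is_deriveD (is_deriveD (is_deriveD d3 d3') d5) d6.
  have d8 := is_deriveD (is_deriveN d1) (is_deriveZ (9 / 2) d2).
  exact: is_deriveB d8 (is_deriveZ 6^-1 d7).
have dle s : dPhi s <= 0.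
  rewrite /dPhi; have := observer_bound (s - t0) chin; rewrite E3 E4 E1 E2.
  move: (observer _ _ _) (probe _ _) (_ + _ + _ + _) => k f K hk.
  by have := sqr_ge0 (3 * f + 6^-1 * k); nra.
have t4 : t0 <= t0 + 4 by rewrite lerDl.
have cP : {within `[t0, t0 + 4], continuous Phi}.
  apply: derivable_within_continuous => s; rewrite in_itv/= => /andP[ts _].
  by have [] := dP s ts.
have dP' s : s \in `]t0, t0 + 4[ -> is_derive s 1 Phi (dPhi s).
  by rewrite in_itv/= => /andP[/ltW ts _]; exact: dP.
have [s _ Es] := MVT_segment t4 dP' cP.
have : Phi (t0 + 4) - Phi t0 <= 0.
  by rewrite Es mulr_le0_ge0// ?subr_ge0.
rewrite /Phi (test_pairing_final t0 chi3).
have PE l : -2 <= t0 + l -> P (t0 + 4 + l) = P (t0 + l) + 2 * \sum_(i < N) (al i ^+ 2 + be i ^+ 2).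
  by move=> h; rewrite /P addrAC; exact: antiderivative_trigpoly.
by rewrite !PE; lra.
Qed.

Definition modal_energy N U := \sum_(i < N) sin (lam i * a) ^+ 2 *
    (ip 0 1 (der U) (fun x => cos (lam i * x)) ^+ 2 +
     ip 0 1 U.2 (fun x => sin (lam i * x)) ^+ 2).

(** With [al] and [be] the signed weights times the modal coefficients, both sums become the modal
    energy [Q], and observability reads [4 Q <= 9/2 dE + 2 Q]. *)
Lemma modal_energy_le N t0 : 0 < t0 ->
  modal_energy N (S t0 U0) <= 9 / 4 * (E t0 - E (t0 + 4)).
Proof.
move=> t00.
pose sg i := (-1) ^+ i * sin (lam i * a).
pose al i := sg i * ip 0 1 (der (S t0 U0)) (fun x => cos (lam i * x)).
pose be i := sg i * ip 0 1 (S t0 U0).2 (fun x => sin (lam i * x)).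
have := modal_observability N al be t00.
have sg2 i : sg i ^+ 2 = sin (lam i * a) ^+ 2 by rewrite exprMn sqrr_sign mul1r.
have -> : \sum_(i < N) (al i ^+ 2 + be i ^+ 2) = modal_energy N (S t0 U0).
  by apply: eq_bigr => i _; rewrite /al /be (exprMn 2 (sg i)) (exprMn 2 (sg i)) sg2 -mulrDr.
have -> : \sum_(i < N) 4 * ((-1) ^+ i * sin (lam i * a)) *
    (al i * ip 0 1 (der (S t0 U0)) (fun x => cos (lam i * x)) +
     be i * ip 0 1 (S t0 U0).2 (fun x => sin (lam i * x))) = 4 * modal_energy N (S t0 U0).
  by rewrite /modal_energy mulr_sumr; apply: eq_bigr => i _; rewrite -sg2 /al /be -/(sg i); ring.
by move: (modal_energy _ _) (E _) (E _) => *; lra.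
Qed.

End ObservabilityInequality.

(** * Energy at one instant from its low modes *)

Section Snapshot.
Variable R : realType.
Notation mu := (@lebesgue_measure R).
Implicit Types (c d x y t s e : R) (f g u v w p phi h q chi : R -> R) (U W Z A B C : state R).
Notation lam := (@lam R).

Variable a : R.
Hypotheses (a_gt0 : 0 < a) (a_lt1 : a < 1).

Lemma prim_cos n x : 0 <= x -> prim 0 (fun x => cos (lam n * x)) x = sin (lam n * x) / lam n.
Proof. by move=> x0; rewrite /prim int_cosM ?lam_neq0// mulr0 sin0 subr0. Qed.

Lemma coprim_sin n x : x <= 1 -> coprim 1 (fun x => sin (lam n * x)) x = cos (lam n * x) / lam n.
Proof. by move=> x1; rewrite /coprim int_sinM ?lam_neq0// mulr1 cos_lam subr0. Qed.

Lemma snapshot_sine n p : L2 0 1 p ->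
  ip 0 1 (prim 0 p) (fun x => sin (lam n * x)) = ip 0 1 p (fun x => cos (lam n * x)) / lam n.
Proof.
move=> hp; have ls : L2 0 1 (fun x => sin (lam n * x)) by exact: L2_sinM.
have lc : L2 0 1 (fun x => cos (lam n * x)) by exact: L2_cosM.
rewrite (ip_prim_gen hp ls) ipC [in RHS]ipC [RHS]mulrC -(ipZl _ lc hp).
by apply: eq_int => x /andP[_ x1]; rewrite (coprim_sin _ (ltW x1)) [cos _ / _]mulrC.
Qed.

Lemma snapshot_cosine n w k : L2 0 1 w ->
  ip 0 1 (fun x => - coprim 1 w x - k * (1 - after a x)) (fun x => cos (lam n * x)) =
  - (ip 0 1 w (fun x => sin (lam n * x)) / lam n) - k * (sin (lam n * a) / lam n).
Proof.
move=> hw; have ls : L2 0 1 (fun x => sin (lam n * x)) by exact: L2_sinM.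
have lc : L2 0 1 (fun x => cos (lam n * x)) by exact: L2_cosM.
rewrite (ip_snapshot_flux k a_gt0 a_lt1 hw lc) (prim_cos _ (ltW a_gt0)).
congr (- _ - _); rewrite mulrC [in RHS]ipC -(ipZl _ ls hw) ipC.
by apply: eq_int => x /andP[x0 _]; rewrite (prim_cos _ (ltW x0)) [sin _ / _]mulrC.
Qed.

Lemma snapshot_flux_le w k : L2 0 1 w ->
  ip 0 1 (fun x => - coprim 1 w x - k * (1 - after a x))
         (fun x => - coprim 1 w x - k * (1 - after a x)) <= 2 * ip 0 1 (coprim 1 w) (coprim 1 w) + 2 * k ^+ 2.
Proof.
move=> hw; have lc := L2_coprim01 hw.
set g := fun x => _.
have la := L2_after 0 1 a.
have lg : L2 0 1 g.
  have l1 := L2_cst 0 1 (1 : R).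
  by apply: L2B; [exact: L2N|apply: L2Z; exact: L2B].
have ic := L2_mul lc lc.
apply: (@le_trans _ _ (\int[mu]_(x in `]0, 1[) (2 * (coprim 1 w x * coprim 1 w x) + cst (2 * k ^+ 2) x))).
  apply: le_int; [exact: L2_mul|apply: itgD; [exact: itgZ|exact: itg_cst]|].
  move=> x _; rewrite /g /=.
  have : (1 - after a x) ^+ 2 <= 1 by rewrite /after; case: (a < x); rewrite /=; lra.
  have := sqr_ge0 (coprim 1 w x - k * (1 - after a x)); have := sqr_ge0 k.
  move: (coprim 1 w x) (1 - after a x) => r z; nra.
rewrite intD; [|exact: itgZ|exact: itg_cst]; rewrite intZ// int_cst// subr0 mulr1.
exact: lexx.
Qed.

Lemma sin_sq_le1 x : sin x ^+ 2 <= 1.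
Proof. by rewrite -(cos2Dsin2 x) lerDr sqr_ge0. Qed.

(** Recovers a coefficient [r] of the image from the coefficient [- r - z] of the strain, [z] being
    due to the jump. *)
Lemma sq_le_shift (r z y : R) : z ^+ 2 <= y -> r ^+ 2 <= 2 * (- r - z) ^+ 2 + 2 * y.
Proof. by have := sqr_ge0 (r + 2 * z); lra. Qed.

(** The strain is a primitive of [W.2] up to sign and jump, the velocity a primitive of [der W], and
    the tail estimates bound both. The factor 8 combines a 2 from separating the jump, a 2 from
    [sine_tail] and a 2 from returning to the coefficients of the strain; the jump counts for
    [6 = 2 + 4]. *)
Lemma snapshot_bound N U W kappa : X2 W -> graph_A2 a U W -> 0 < kappa ->
  (forall i, (i < N)%N -> kappa <= sin (lam i * a) ^+ 2) ->
  normX2 U ^+ 2 <= 8 * (modal_energy a N U / kappa) + 6 * probe a U ^+ 2 + 2 * (normX2 W ^+ 2 / lam N ^+ 2).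
Proof.
move=> XW gUW k0 Hk.
have [hU hW _ aev aeG] := graph_snapshot a_gt0 a_lt1 XW gUW.
set f := probe a U in aeG *; pose w := W.2; pose p := der W.
have lw : L2 0 1 w by exact: hW.2.
have lp : L2 0 1 p by exact: der_L2.
have lv : L2 0 1 U.2 by exact: hU.2.
have lG : L2 0 1 (der U) by exact: der_L2.
have lpr := L2_prim01 lp; have lco := L2_coprim01 lw.
pose g x := - coprim 1 w x - f * (1 - after a x).
have lg : L2 0 1 g.
  have l1 := L2_cst 0 1 (1 : R); have la := L2_after 0 1 a.
  by apply: L2B; [exact: L2N|apply: L2Z; exact: L2B].
have ls i : L2 0 1 (fun x => sin (lam i * x)) by exact: L2_sinM.
have lc i : L2 0 1 (fun x => cos (lam i * x)) by exact: L2_cosM.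
have Eal i : ip 0 1 (der U) (fun x => cos (lam i * x)) =
    - (ip 0 1 w (fun x => sin (lam i * x)) / lam i) - f * (sin (lam i * a) / lam i).
  by rewrite (ip_ae1 lG lg (lc i) aeG) (snapshot_cosine i f lw).
have Ebe i : ip 0 1 U.2 (fun x => sin (lam i * x)) = ip 0 1 p (fun x => cos (lam i * x)) / lam i.
  by rewrite (ip_ae1 lv lpr (ls i) aev) (snapshot_sine i lp).
have T1 := sine_tail N lw; have T2 := cosine_tail N lp.
have F1 := snapshot_flux_le f lw.
have EG : ip 0 1 (der U) (der U) = ip 0 1 g g.
  exact: (ip_ae lG lG (L2_meas lg) (L2_meas lg) aeG aeG).
have Ev : ip 0 1 U.2 U.2 = ip 0 1 (prim 0 p) (prim 0 p).
  exact: (ip_ae lv lv (L2_meas lpr) (L2_meas lpr) aev aev).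
rewrite (normX2_sq hU) (normX2_sq hW) /ipX /ip2 EG Ev -/p -/w.
pose al i := ip 0 1 (der U) (fun x => cos (lam i * x)).
pose be i := ip 0 1 U.2 (fun x => sin (lam i * x)).
(* The jump contributes at most [f ^+ 2 * lam i ^- 2] to each mode, and the sum of [lam i ^- 2] is
   at most 1/2. *)
have S1 : \sum_(i < N) (ip 0 1 w (fun x => sin (lam i * x)) / lam i) ^+ 2 <=
    2 * \sum_(i < N) al i ^+ 2 + f ^+ 2.
  apply: (@le_trans _ _ (2 * \sum_(i < N) al i ^+ 2 + 2 * f ^+ 2 * \sum_(i < N) lam i ^- 2)); last first.
    have := ler_wpM2l (sqr_ge0 f) (sum_lam_le R N); rewrite lerD2l.
  move: (\sum_(i < N) _) (f ^+ 2) => X Y; clear; lra.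
  rewrite !mulr_sumr -big_split/=; apply: ler_sum => i _.
  rewrite /al Eal.
  rewrite -mulrA; apply: sq_le_shift.
  rewrite exprMn exprMn exprVn mulrCA ler_piMl ?sin_sq_le1// mulr_ge0 ?sqr_ge0//.
  by rewrite invr_ge0 sqr_ge0.
have S2 : \sum_(i < N) (ip 0 1 p (fun x => cos (lam i * x)) / lam i) ^+ 2 = \sum_(i < N) be i ^+ 2.
  by apply: eq_bigr => i _; rewrite /be Ebe.
have S3 : \sum_(i < N) al i ^+ 2 + \sum_(i < N) be i ^+ 2 <= modal_energy a N U / kappa.
  rewrite ler_pdivlMr// -big_split/= mulr_suml; apply: ler_sum => i _.
  rewrite mulrC ler_wpM2r ?addr_ge0 ?sqr_ge0//; exact: Hk.
have S4 : 0 <= \sum_(i < N) be i ^+ 2 by apply: sumr_ge0 => i _; exact: sqr_ge0.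
rewrite S2 in T2.
have l0 : 0 <= (lam N ^+ 2)^-1 by rewrite invr_ge0 sqr_ge0.
rewrite (mulrDl (ip 0 1 p p)).
have r1 : 0 <= ip 0 1 p p / lam N ^+ 2 by rewrite mulr_ge0// ip_ge0.
have r2 : 0 <= ip 0 1 w w / lam N ^+ 2 by rewrite mulr_ge0// ip_ge0.
move: T1 T2 F1 S1 S3 S4 r1 r2; rewrite -/g.
move: (ip 0 1 w w / _) (ip 0 1 p p / _) (ip 0 1 (coprim 1 w) _) (ip 0 1 (prim 0 p) _) (ip 0 1 g g).
move: (modal_energy a N U / kappa) (f ^+ 2) (\sum_(i < N) al i ^+ 2) (\sum_(i < N) be i ^+ 2) (\sum_(i < N) _ ^+ 2).
by clear; move=> *; lra.
Qed.

End Snapshot.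

(** * The rate and the decay estimate *)

Section EnvelopeRate.
Variable R : realType.
Implicit Types (u : nat -> R) (w : R -> R) (x y t s : R).

(** The upper half-plane is closed, convex and contains the points. *)
Lemma closed_hull_ge0 u : (forall n, 0 <= u n) -> closed_hull u `<=` [set p | 0 <= p.2].
Proof.
move=> u0.
have cl : closed [set p : R^o * R^o | 0 <= p.2].
  apply: (@closed_comp _ _ (@snd R^o R^o) [set y : R^o | 0 <= y]) => [p _|].
    exact: cvg_snd.
  exact: closed_ge.
rewrite [X in _ `<=` X](closure_id _).1//; apply: closureS; apply: smallest_sub.
  move=> p q k /=; rewrite !inE/= => p0 q0.
  have k0 : 0 <= k%:num by [].
  have k1 : 0 <= 1 - k%:num by rewrite subr_ge0.
  by apply: addr_ge0; apply: mulr_ge0.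
by move=> p [n _ <-] /=.
Qed.

Variables (u : nat -> R) (w : R -> R).
Hypothesis u_ge0 : forall n, 0 <= u n.
Hypothesis env : lower_convex_envelope u w.

Lemma envelope_le n : (0 < n)%N -> w n%:R <= u n.
Proof.
move=> n0; have n1 : 1 <= n%:R :> R by rewrite ler1n.
have [_] := envelope_min env n1; apply.
by apply: subset_closure; apply: sub_gen_smallest; exists n.
Qed.

(** The hull only gives [w (t + 1) >= 0]; strict decrease makes [w t] positive. *)
Lemma envelope_gt0 t : 0 <= t -> 0 < w t.
Proof.
move=> t0; have t1 : 1 <= t + 1 by rewrite lerDr.
apply: (@le_lt_trans _ _ (w (t + 1))); last first.
  by apply: (envelope_decreasing env) => //; rewrite ltrDl.
have [h _] := envelope_min env t1.
exact: (closed_hull_ge0 u_ge0 h).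
Qed.

Lemma envelope_nonincreasing x y : 0 <= x -> x <= y -> w y <= w x.
Proof.
move=> x0; rewrite le_eqVlt => /predU1P[->//|xy].
exact/ltW/(envelope_decreasing env).
Qed.

Lemma rate_decreasing x y : 0 < x -> x < y -> rate w y < rate w x.
Proof.
move=> x0 xy; have y0 := lt_trans x0 xy; rewrite /rate.
have wy := envelope_gt0 (ltW y0); have wx := envelope_decreasing env (ltW x0) xy.
rewrite (@lt_trans _ _ (w x / y ^+ 2))//.
  by rewrite ltr_pM2r// invr_gt0 exprn_gt0.
rewrite ltr_pM2l; last exact: lt_trans wx.
by rewrite ltf_pV2 ?posrE ?exprn_gt0// ltrXn2r ?nnegrE ?(ltW x0) ?(ltW y0).
Qed.

Lemma rate_inj : {in `]0, +oo[%classic &, injective (rate w)}.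
Proof.
move=> x y; rewrite !inE/= !in_itv/= !andbT => x0 y0 E.
apply/eqP; rewrite eq_le !leNgt; apply/andP; split; apply/negP => h.
  by have := rate_decreasing y0 h; rewrite E ltxx.
by have := rate_decreasing x0 h; rewrite E ltxx.
Qed.

Lemma rate_surj y : 0 < y -> exists2 s, 0 < s & rate w s = y.
Proof.
move=> y0; have w0 := envelope_gt0 (lexx 0).
(* Chosen so that [y * L ^+ 2 >= y * L >= w 0 >= w L]. *)
pose L := 1 + w 0 / y.
have L1 : 1 <= L by rewrite lerDl divr_ge0// ltW.
have L0 : 0 <= L by rewrite (le_trans _ L1).
pose h x := w x - y * x ^+ 2.
have ch : {within `[0, L], continuous h}.
  move=> x; apply: cvgB.
    have : {within `[0, L], continuous w}.
      apply: continuous_subspaceW (envelope_continuous env) => z /=.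
      by rewrite !in_itv/= => /andP[->].
    by apply.
  have : {within `[0, L], continuous (fun x => y * x ^+ 2)}.
    apply: continuous_subspaceT => z; apply: cvgM; first exact: cvg_cst.
    exact: exprn_continuous.
  by apply.
have hL : h L <= 0.
  rewrite subr_le0; apply: (le_trans (envelope_nonincreasing (lexx 0) L0)).
  have yL : w 0 <= y * L by rewrite /L mulrDr mulr1 mulrC divfK ?gt_eqF// lerDr ltW.
  apply: (le_trans yL); rewrite ler_pM2l// expr2 ler_peMl//.
have h0 : 0 <= h 0 by rewrite /h expr0n/= mulr0 subr0 ltW.
have [|c] := @IVT R h 0 L 0 L0 ch.
  by rewrite ge_min hL orbT/= le_max h0.
rewrite in_itv/= => /andP[c0 _] hc.
have cn : c != 0.
  by apply/eqP => E; move: hc; rewrite E /h expr0n/= mulr0 subr0 => /eqP; rewrite gt_eqF.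
exists c; first by rewrite lt_neqAle eq_sym cn.
move/eqP: hc; rewrite /h subr_eq0 /rate => /eqP ->.
by rewrite mulfK// expf_neq0.
Qed.

(** [pinv_] returns its default 0 outside the image; as [rate w] is onto and injective, the true
    preimage is returned, and it is positive. *)
Lemma rate_invP y : 0 < y -> 0 < rate_inv w y /\ w (rate_inv w y) = y * rate_inv w y ^+ 2.
Proof.
move=> y0; have [s s0 sy] := rate_surj y0.
have As : (rate w @` `]0, +oo[) y by exists s => //=; rewrite in_itv/= s0.
have E : rate w (rate_inv w y) = y by apply: pinvK; rewrite inE.
have pos : 0 < rate_inv w y.
  have := injpinv_image (fun=> 0) rate_inj.
  move=> /seteqP[/(_ (rate_inv w y)) h _].
  have := h (ex_intro2 _ _ _ As erefl).
  by rewrite /= in_itv/= andbT.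
move: (rate_inv w y) E pos => r E pos; split => //.
by rewrite -E /rate divfK// expf_neq0// gt_eqF.
Qed.

End EnvelopeRate.

(** * Energy lost over a window *)

Section Decay.
Variable R : realType.
Implicit Types (x y t s : R).
Notation lam := (@lam R).

(** Pigeonhole: the [K] increments telescope to at most [e 0]. *)
Lemma small_increment (e : nat -> R) K : (0 < K)%N -> 0 <= e K ->
  exists2 k, (k < K)%N & e k - e k.+1 <= e 0%N / K%:R.
Proof.
move=> K0 eK; apply: contrapT => H.
have H1 k : (k < K)%N -> e 0%N / K%:R < e k - e k.+1.
  by move=> kK; rewrite ltNge; apply/negP => h; apply: H; exists k.
have : \sum_(i < K) (e 0%N / K%:R) < \sum_(i < K) (e i - e i.+1).
  apply: ltr_sum; first by apply/hasP; exists (Ordinal K0); rewrite ?mem_index_enum.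
  by move=> i _; exact: H1.
rewrite sumr_const card_ord -[X in X < _]mulr_natr divfK ?pnatr_eq0 -?lt0n//.
rewrite -(big_mkord xpredT (fun i => e i - e i.+1)).
have -> : \sum_(0 <= i < K) (e i - e i.+1) = e 0%N - e K.
  by under eq_bigr do rewrite -opprB; rewrite sumrN telescope_sumr// opprB.
by rewrite ltNge lerBlDr lerDl eK.
Qed.

(** Here [21 = 8 * 9 / 4 + 6 / 2]: observability gives the first term, the flux the second. *)
Lemma window_arith (q f d m n : R) : q <= 9 / 4 * d -> 2 * f <= d -> m <= n ->
  8 * q + 6 * f + 2 * m <= 21 * d + 2 * n.
Proof. by lra. Qed.

Variable a : R.
Hypotheses (a_gt0 : 0 < a) (a_lt1 : a < 1).
Variables (S : R -> state R -> state R).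
Hypothesis sgS : contraction_semigroup (@X2 R) (@normX2 R) S.
Hypothesis genS : generated_by (@X2 R) (@normX2 R) (graph_A2 a) S.
Variables (U0 W0 : state R).
Hypotheses (XU0 : X2 U0) (XW0 : X2 W0) (gUW : graph_A2 a U0 W0).

Lemma energyE t : 0 <= t -> energy S U0 t = normX2 (S t U0) ^+ 2.
Proof. by move=> t0; rewrite normX2_sq//; exact/X2_HX/(semigroup_stable sgS). Qed.

Lemma energy_ge0 t : 0 <= t -> 0 <= energy S U0 t.
Proof. by move=> t0; rewrite energyE// sqr_ge0. Qed.

Lemma energy_le s t : 0 <= s -> s <= t -> energy S U0 t <= energy S U0 s.
Proof.
move=> s0 st; have t0 := le_trans s0 st; rewrite !energyE//.
by rewrite lerXn2r ?nnegrE ?normX2_ge0//; exact: (trajectory_le sgS).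
Qed.

(** The mean value theorem for the energy on [[s, s + 1]] provides an instant at which [2 f^2]
    equals the loss there, without averaging [f]. *)
Lemma small_flux s : 0 < s -> exists2 t, s < t < s + 1 &
  2 * probe a (S t U0) ^+ 2 <= energy S U0 s - energy S U0 (s + 5).
Proof.
move=> s0; have s1 : s < s + 1 by rewrite ltrDl.
have dE t : s <= t -> is_derive t 1 (energy S U0) (- 2 * probe a (S t U0) ^+ 2).
  by move=> st; apply: (energy_derive sgS genS XU0 XW0 gUW a_gt0 a_lt1); exact: lt_le_trans st.
have cE : {within `[s, s + 1], continuous (energy S U0)}.
  apply: derivable_within_continuous => t; rewrite in_itv/= => /andP[st _].
  by have [] := dE t st.
have dE' t : t \in `]s, s + 1[ -> is_derive t 1 (energy S U0) (- 2 * probe a (S t U0) ^+ 2).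
  by rewrite in_itv/= => /andP[/ltW st _]; exact: dE.
have [t] := MVT s1 dE' cE; rewrite in_itv/= => st E; exists t => //.
have h : energy S U0 (s + 5) <= energy S U0 (s + 1).
  by apply: energy_le; [lra|lra].
by move: E h; move: (energy _ _ _) (energy _ _ _) (energy _ _ _) (probe _ _ ^+ 2) => *; lra.
Qed.

Lemma window_bound M s kappa t delta : 0 < s -> s + 5 <= t -> 0 < kappa -> kappa <= 1 ->
  (forall i, (i < M)%N -> kappa <= sin (lam i * a) ^+ 2) ->
  energy S U0 s - energy S U0 (s + 5) <= delta ->
  normX2 (S t U0) ^+ 2 <= 21 * (delta / kappa) + 2 * (normX2 W0 ^+ 2 / lam M ^+ 2).
Proof.
move=> s0 st k0 k1 Hk Hd.
have [r /andP[sr rs] Hr] := small_flux s0.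
have r0 : 0 < r by exact: lt_trans sr.
have r00 := ltW r0; have rt : r <= t by lra.
have gr := trajectory_graph sgS genS XU0 XW0 gUW r00.
have Xr := semigroup_stable sgS r00 XW0.
have B := snapshot_bound a_gt0 a_lt1 Xr gr k0 Hk.
have Q := modal_energy_le a_gt0 a_lt1 sgS genS XU0 XW0 gUW M r0.
have e1 := energy_le (ltW s0) (ltW sr).
have e2 : energy S U0 (s + 5) <= energy S U0 (r + 4) by apply: energy_le; lra.
have e3 := energy_le r00 rt; rewrite (energyE r00) (energyE (le_trans r00 rt)) in e3.
have w1 := semigroup_contraction sgS r00 XW0.
have w2 : normX2 (S r W0) ^+ 2 / lam M ^+ 2 <= normX2 W0 ^+ 2 / lam M ^+ 2.
  rewrite ler_wpM2r ?invr_ge0 ?sqr_ge0//.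
  by rewrite lerXn2r ?nnegrE ?normX2_ge0.
have ki : 0 <= kappa^-1 by rewrite invr_ge0 ltW.
have q1 : modal_energy a M (S r U0) / kappa <= 9 / 4 * (delta / kappa).
  rewrite mulrA ler_wpM2r//; apply: (le_trans Q).
  by rewrite ler_wpM2l//; move: e1 e2 Hd; move: (energy _ _ _) (energy _ _ _) (energy _ _ _) (energy _ _ _) => *; lra.
(* [kappa <= 1] lets the flux term share the denominator of the modal one. *)
have q2 : 2 * probe a (S r U0) ^+ 2 <= delta / kappa.
  rewrite ler_pdivlMr//; apply: le_trans (le_trans Hr Hd).
  by rewrite ler_piMr// mulr_ge0// sqr_ge0.
apply: (le_trans e3); apply: (le_trans B).
exact: window_arith.
Qed.

End Decay.

Section Rate.
Variable R : realType.
Implicit Types (x y t s w D : R).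

Lemma ler_of_sqr (x y : R) : 0 <= y -> x ^+ 2 <= y ^+ 2 -> x <= y.
Proof.
move=> y0 xy; apply: (le_trans (ler_norm x)).
by rewrite -(ler_pXn2r (ltn0Sn 1)) ?nnegrE// real_normK ?num_real.
Qed.

(** Windows start at time 1 because the energy is differentiated at positive times only. With [K]
    the integer part of [(t - 1) / 5], one has [t + 1 < 5 * K + 7 <= 12 * K] as soon as [K >= 1]. *)
Lemma windows_count (t : R) : 11 <= t -> exists K,
  [/\ (0 < K)%N, 1 + 5 * K%:R <= t & t + 1 <= 12 * K%:R].
Proof.
move=> t11; have t0 : 0 <= (t - 1) / 5 by rewrite divr_ge0// subr_ge0; lra.
have /andP[] := truncn_itv t0; move: (Num.truncn _) => K.
rewrite ler_pdivlMr// ltr_pdivrMr// -[K.+1%:R]natr1 => h1 h2.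
have h3 : t + 1 <= 12 * K%:R by lra.
exists K; split; [|lra|exact: h3].
by rewrite lt0n; apply/eqP => E; move: h3; rewrite E mulr0; lra.
Qed.

End Rate.

(** * Choice of the number of modes *)

Section Main.
Variable R : realType.
Notation lam := (@lam R).
Variable a : R.
Hypotheses (a_gt0 : 0 < a) (a_lt1 : a < 1).
Variable w : R -> R.
Hypothesis env : lower_convex_envelope (fun n : nat => sin ((n%:R + 2^-1) * pi * a) ^+ 2) w.

(** Weight of mode 0, which a sequence indexed from 1 does not see. *)
Let c0 := sin (lam 0 * a) ^+ 2.

Lemma first_mode_gt0 : 0 < c0.
Proof.
rewrite exprn_gt0// sin_gt0_pi// mulr_gt0 ?lam_gt0//=.
rewrite lamE add0r -mulrA (lt_le_trans (_ : _ < 2^-1 * pi))//.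
  by rewrite ltr_pM2l// -[ltRHS]mulr1 ltr_pM2l ?pi_gt0.
by rewrite ler_piMl ?pi_ge0// invf_le1// ler1n.
Qed.

Lemma envelope_le1 : w 1 <= 1.
Proof.
have := envelope_le env (isT : (0 < 1)%N); move/le_trans; apply.
exact: sin_sq_le1.
Qed.

(** For [i >= 1] the envelope is decreasing and below the sequence, and [c0 <= 1]. For [i = 0] the
    weight is [c0] itself, and [w M <= w 1 <= 1]. *)
Lemma modes_bound M i : (0 < M)%N -> (i < M)%N -> c0 * w M%:R <= sin (lam i * a) ^+ 2.
Proof.
move=> M0 iM; have c00 := first_mode_gt0.
have u0 n : 0 <= (fun n : nat => sin ((n%:R + 2^-1) * pi * a) ^+ 2) n by exact: sqr_ge0.
have wM := envelope_gt0 u0 env (ler0n R M).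
case: i iM => [_|i iM].
  rewrite ler_piMr ?(ltW c00)//; apply: le_trans envelope_le1.
  by apply: (envelope_nonincreasing env); rewrite ?ler1n.
apply: (le_trans (_ : _ <= w M%:R)); first by rewrite ler_piMl ?(ltW wM)// sin_sq_le1.
apply: le_trans (envelope_le env (ltn0Sn i)).
by apply: (envelope_nonincreasing env); rewrite ?ler0n// ler_nat ltnW.
Qed.

Variables (S : R -> state R -> state R).
Hypothesis sgS : contraction_semigroup (@X2 R) (@normX2 R) S.
Hypothesis genS : generated_by (@X2 R) (@normX2 R) (graph_A2 a) S.

(** [252 = 21 * 12]: the best window loses at most [12 D^2 / (t + 1)], and dividing by [w s] turns
    this into a multiple of [D^2 / s^2]. [8 = 2 * 4] because [lam M >= s / 2]. *)
Lemma decay_window (U0 W0 : state R) (D t s : R) : X2 U0 -> X2 W0 -> graph_A2 a U0 W0 ->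
  normX2 U0 <= D -> normX2 W0 <= D -> 11 <= t -> 1 <= s -> w s * (t + 1) = s ^+ 2 ->
  normX2 (S t U0) ^+ 2 <= (252 / c0 + 8) * (D ^+ 2 / s ^+ 2).
Proof.
move=> XU0 XW0 gUW UD WD t11 s1 Hs.
have D0 : 0 <= D := le_trans (normX2_ge0 U0) UD.
have c00 := first_mode_gt0.
have s0 : 0 < s by exact: lt_le_trans s1.
have t1 : 0 < t + 1 by lra.
have [K [K0 Kt tK]] := windows_count t11.
have KR0 : 0 < K%:R :> R by rewrite ltr0n.
pose e k := energy S U0 (1 + 5 * k%:R).
have eK : 0 <= e K by apply: (energy_ge0 sgS XU0); rewrite addr_ge0// mulr_ge0.
have [k kK Hk] := small_increment K0 eK.
have k0 : 0 < 1 + 5 * k%:R :> R by rewrite ltr_pwDl// mulr_ge0.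
have ek : e k.+1 = energy S U0 (1 + 5 * k%:R + 5).
  by rewrite /e -[k.+1%:R]natr1 mulrDr mulr1 addrA.
have e0 : e 0%N <= D ^+ 2.
  rewrite /e mulr0 addr0 (energyE sgS XU0 ler01) lerXn2r ?nnegrE ?normX2_ge0//.
  exact: le_trans (semigroup_contraction sgS ler01 XU0) UD.
have Hd : energy S U0 (1 + 5 * k%:R) - energy S U0 (1 + 5 * k%:R + 5) <= 12 * (D ^+ 2 / (t + 1)).
  rewrite -ek; apply: (le_trans Hk).
  rewrite ler_pdivrMr// (_ : 12 * _ * _ = D ^+ 2 * (12 * K%:R) / (t + 1)); last by ring.
  rewrite ler_pdivlMr//; apply: (le_trans (ler_wpM2r (ltW t1) e0)).
  by rewrite ler_wpM2l ?sqr_ge0.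
have kt : 1 + 5 * k%:R + 5 <= t.
  apply: le_trans Kt; rewrite -addrA lerD2l -[X in _ + X]mulr1 -mulrDr natr1.
  by rewrite ler_wpM2l// ler_nat.
pose M := Num.truncn s.
have /andP[Ms sM] := truncn_itv (ltW s0).
have M0 : (0 < M)%N by rewrite /M truncn_ge_nat// ltW.
(* The envelope is taken at [s] instead of [M <= s]: it is no larger there, and tied to [t] by an
   exact equation. *)
have ws : c0 * w s <= c0 * w M%:R.
  by rewrite ler_wpM2l ?(ltW c00)//; apply: (envelope_nonincreasing env).
have wE : w s = s ^+ 2 / (t + 1) by rewrite -Hs mulfK// gt_eqF.
have kap0 : 0 < c0 * w s by rewrite mulr_gt0// wE divr_gt0// exprn_gt0.
have kap i : (i < M)%N -> c0 * w s <= sin (lam i * a) ^+ 2.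
  by move=> iM; apply: (le_trans ws); exact: modes_bound.
have kap1 : c0 * w s <= 1.
  by apply: (le_trans (kap 0%N M0)); exact: sin_sq_le1.
apply: (le_trans (window_bound a_gt0 a_lt1 sgS genS XU0 XW0 gUW k0 kt kap0 kap1 kap Hd)).
rewrite [leRHS]mulrDl; apply: lerD.
  rewrite wE le_eqVlt; apply/orP; left; apply/eqP; field.
  by rewrite !gt_eqF.
(* [s < M + 1 <= 2 * M <= 2 * lam M], where [s >= 1] ensures [M >= 1]. *)
have lM : s <= 2 * lam M.
  apply: (@le_trans _ _ (2 * M%:R)); last by rewrite ler_wpM2l// lam_ge.
  apply: (le_trans (ltW sM)); rewrite -/M -[M.+1%:R]natr1.
  have : 1 <= M%:R :> R by rewrite ler1n.
  by move: (M%:R) => x; lra.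
have lM0 := lam_gt0 R M.
have -> : 8 * (D ^+ 2 / s ^+ 2) = 2 * (D ^+ 2 / (s / 2) ^+ 2) by field; rewrite gt_eqF.
rewrite ler_wpM2l// ler_pM ?sqr_ge0 ?invr_ge0 ?sqr_ge0//.
  by rewrite lerXn2r ?nnegrE ?normX2_ge0.
rewrite lef_pV2 ?posrE ?exprn_gt0 ?divr_gt0// lerXn2r ?nnegrE ?divr_ge0 ?(ltW s0) ?(ltW lM0)//.
by rewrite ler_pdivrMr// mulrC.
Qed.

Lemma decay u0 u1 t : DA2 a (u0, u1) -> 0 <= t ->
  normX2 (S t (u0, u1)) <= (252 / c0 + 8) / rate_inv w (t + 1)^-1 * normDA2 a (u0, u1).
Proof.
move=> hD t0; set U0 := (u0, u1); set D := normDA2 a U0; set C := 252 / c0 + 8.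
have c00 := first_mode_gt0.
have C8 : 8 <= C by rewrite lerDr; exact: divr_ge0 (ler0n _ _) (ltW c00).
have C0 : 0 <= C by exact: le_trans C8.
have C1 : 1 <= C by apply: le_trans C8; rewrite ler1n.
have C4 : 4 <= C by apply: le_trans C8; rewrite ler_nat.
have [XW gUW] := graph_exists a_gt0 a_lt1 hD.
have [WD UD] := normDA2_bounds a_gt0 a_lt1 hD.
have XU : X2 U0.
  by have [[[h1 h2] _ _ _ [h3 _]] _] := hD; split; [split|case: h3].
have t1 : 0 < t + 1 by rewrite ltr_wpDl.
have u_ge0 n : 0 <= (fun n : nat => sin ((n%:R + 2^-1) * pi * a) ^+ 2) n by exact: sqr_ge0.
have y0 : 0 < (t + 1)^-1 by rewrite invr_gt0.
have [s0 Es] := rate_invP u_ge0 env y0.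
set s := rate_inv w _ in s0 Es *.
have Hs : w s * (t + 1) = s ^+ 2 by rewrite Es mulrAC mulVf ?mul1r// gt_eqF.
have NU : normX2 (S t U0) <= D := le_trans (semigroup_contraction sgS t0 XU) UD.
have D0 : 0 <= D := le_trans (normX2_ge0 _) NU.
(* While [s <= 4], contraction suffices: [C >= 4] makes [C / s] at least 1. *)
have trivial4 : s <= 4 -> normX2 (S t U0) <= C / s * D.
  move=> s4; apply: (le_trans NU); rewrite (ler_peMl D0)// ler_pdivlMr// mul1r.
  exact: le_trans C4.
have [s1|s1] := leP s 1; first by apply: trivial4; lra.
(* For small times [s ^+ 2 = w s * (t + 1) < 12 < 16], so [s <= 4] again. *)
have [t11|t11] := ltP t 11.
  apply: trivial4; apply: ler_of_sqr => //; rewrite -Hs.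
  have w1 : w s <= 1.
    by apply: le_trans envelope_le1; apply: (envelope_nonincreasing env) => //; rewrite ltW.
  have ws := envelope_gt0 u_ge0 env (ltW s0).
  by apply: (@le_trans _ _ (1 * (t + 1))); [rewrite ler_wpM2r// ltW|lra].
have B := decay_window XU XW gUW UD WD t11 (ltW s1) Hs.
apply: ler_of_sqr; first exact: mulr_ge0 (divr_ge0 C0 (ltW s0)) D0.
apply: (le_trans B); rewrite -/C.
(* The estimate bounds the squared norm by [C] times a quotient; as [C >= 1], [C ^+ 2] may replace
   [C], which avoids a square root in the constant. *)
have -> : (C / s * D) ^+ 2 = C * (C * (D ^+ 2 / s ^+ 2)) by field; rewrite gt_eqF.
apply: (ler_wpM2l C0); apply: ler_peMl C1.
by rewrite mulr_ge0 ?invr_ge0 ?sqr_ge0.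
Qed.

End Main.

Theorem theorem5p1p2 (R : realType) (a : R) (a_gt0 : 0 < a) (a_lt1 : a < 1)
    (a_irrational : irrational a) :
  exists C : R, 0 < C /\
  forall omega1 : R -> R,
    lower_convex_envelope
      (fun n : nat => sin ((n%:R + 2^-1) * pi * a) ^+ 2) omega1 ->
  forall S : R -> state R -> state R,
    contraction_semigroup (@X2 R) (@normX2 R) S ->
    generated_by (@X2 R) (@normX2 R) (graph_A2 a) S ->
  forall u0 u1 : R -> R, DA2 a (u0, u1) ->
  forall t : R, 0 <= t ->
    normX2 (S t (u0, u1))
      <= C / rate_inv omega1 (t + 1)^-1 * normDA2 a (u0, u1).
Proof.
exists (252 / sin (lam R 0 * a) ^+ 2 + 8); split.
  exact: ltr_wpDl (divr_ge0 (ler0n _ _) (sqr_ge0 _)) (ltr0Sn _ _).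
move=> w env S sgS genS u0 u1 hD t t0.
exact: (decay a_gt0 a_lt1 env sgS genS hD t0).
Qed.
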